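(* Let $d\ge1$ and $\lambda>0$. For all $p\ge1$, $$\limsup_{h\to\infty}\mathbb{E}_{0\in\mathcal{L}_0}\left[\mathrm{MBD}_{-h}^0(0)^p\right]<\infty.$$
   Context: Let $d\ge1$, $\lambda>0$. Let $H=\{(x,y):x\in\mathbb{R}^d,\ y>0\}$ with the metric $ds_H^2=(dx_1^2+\dots+dx_d^2+dy^2)/y^2$ (the half-space model of the $(d+1)$-dimensional hyperbolic space), hyperbolic distance $d(\cdot,\cdot)$ and volume measure $d\mu=dx_1\cdots dx_d\,dy/y^{d+1}$. Let $N$ be a homogeneous Poisson point process on $H$ of intensity $\lambda$ with respect to $\mu$, viewed as a random element of the space $\mathcal{N}_S$ of locally finite subsets of $H$ (with the $\sigma$-algebra generated by counting maps). The parent $A(z)$ of $z=(x,y)\in N$ is the point of $N$ closest to $z$ for $d(\cdot,\cdot)$ among all points $(x',y')\in N$ with $y'>y$ (almost surely it exists and is unique for all $z\in N$). Denote by $[z,z']_{eucl}$ the Euclidean segment, and let $\mathrm{DSF}:=\bigcup_{z\in N}[z,A(z)]_{eucl}\subset H$. Almost surely, every $z\in\mathrm{DSF}$ lies in $[z_0,A(z_0))_{eucl}$ for a unique $z_0\in N$; set $z_\uparrow:=A(z_0)$. The trajectory from $z$ is $[z,z_\uparrow)_{eucl}\cup\bigcup_{n\ge0}[A^{(n)}(z_\uparrow),A^{(n+1)}(z_\uparrow))_{eucl}$, where $A^{(n)}$ is the $n$-fold iterate of $A$; the ordinate is strictly increasing along it. For $t\in\mathbb{R}$ let $\mathcal{L}_t:=\{x\in\mathbb{R}^d:(x,e^t)\in\mathrm{DSF}\}$.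 For $t_1\le t_2$ and $x\in\mathcal{L}_{t_1}$, $\mathcal{A}_{t_1}^{t_2}(x)$ is the point $x'\in\mathbb{R}^d$ such that $(x',e^{t_2})$ belongs to the trajectory from $(x,e^{t_1})$, and $\mathcal{A}_{t_1}^{t_2}(x):=\infty$ if there is no such point. For $x\in\mathcal{L}_{t_2}$, $\mathcal{D}_{t_1}^{t_2}(x):=\{x'\in\mathcal{L}_{t_1}:\mathcal{A}_{t_1}^{t_2}(x')=x\}$ is the set of descendants of $x$ at level $t_1$. Cumulative Forward Deviation: for $t_1\le t_2$ and $x\in\mathcal{L}_{t_1}$, $\mathrm{CFD}_{t_1}^{t_2}(x):=\int_{t_1}^{t_2}\left\|\frac{\partial}{\partial s}\mathcal{A}_{t_1}^{s}(x)\right\|ds$ (Euclidean norm on $\mathbb{R}^d$), with $\mathrm{CFD}_{t_1}^{t_2}(x):=\infty$ if $\mathcal{A}_{t_1}^s(x)=\infty$ for some $s\in[t_1,t_2]$. Maximal Backward Deviation: for $x\in\mathcal{L}_{t_2}$, $\mathrm{MBD}_{t_1}^{t_2}(x):=\max_{x'\in\mathcal{D}_{t_1}^{t_2}(x)}\mathrm{CFD}_{t_1}^{t_2}(x')$ if $\mathcal{D}_{t_1}^{t_2}(x)\ne\emptyset$, and $\mathrm{MBD}_{t_1}^{t_2}(x):=0$ otherwise. Palm measure: the stationary point process $\mathcal{L}_t$ on $\mathbb{R}^d$ has finite intensity $\alpha_0e^{-dt}$, where $\alpha_0$ is the intensity of $\mathcal{L}_0$. $\mathbb{P}_{0\in\mathcal{L}_t}$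 (expectation $\mathbb{E}_{0\in\mathcal{L}_t}$) is the probability measure on $\mathcal{N}_S$ (the law of $N$ conditioned on $0\in\mathcal{L}_t$ in the Palm sense) defined by $$\mathbb{P}_{0\in\mathcal{L}_t}[\Gamma]=\frac{1}{\alpha_0e^{-dt}\mathrm{Leb}(B)}\,\mathbb{E}\Big[\sum_{s\in\mathcal{L}_t\cap B}\mathbf{1}_{T_{-s}N\in\Gamma}\Big],\qquad \Gamma\subset\mathcal{N}_S\text{ measurable},$$ for any Borel $B\subset\mathbb{R}^d$ with $0<\mathrm{Leb}(B)<\infty$ (the value does not depend on $B$), where $T_{-s}$ acts on $H$ by $(x,y)\mapsto(x-s,y)$. *)

(* Defs.v *)
From HB Require Import structures.
From mathcomp Require Import all_boot all_order all_algebra.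
From mathcomp Require Import all_classical all_reals all_analysis.
From mathcomp Require Import measurable_realfun.

Set Implicit Arguments.
Unset Strict Implicit.
Unset Printing Implicit Defensive.

Import Order.TTheory GRing.Theory Num.Theory.
Import numFieldTopology.Exports numFieldNormedType.Exports.

Local Open Scope classical_set_scope.
Local Open Scope ring_scope.

(* As for tuples in the library, the sigma-algebra on matrices is the product
   one, generated by the coordinate maps; on R^d it is the Borel sigma-algebra. *)

Definition measure_matrix_display : measure_display -> measure_display.
Proof. exact. Qed.

Section measurable_matrix.
Context {disp} {T : measurableType disp} {m n : nat}.

Definition matrix_measurable : set (set 'M[T]_(m, n)) :=
  <<s \bigcup_ij preimage_set_system [set: 'M[T]_(m, n)]
        (fun A => A ij.1 ij.2) measurable >>.

Let matrix_measurable0 : matrix_measurable set0.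
Proof. exact: sigma_algebra0. Qed.

Let matrix_measurableC A : matrix_measurable A -> matrix_measurable (~` A).
Proof. exact: sigma_algebraC. Qed.

Let matrix_measurable_bigcup (F : (set 'M[T]_(m, n))^nat) :
  (forall i, matrix_measurable (F i)) -> matrix_measurable (\bigcup_i F i).
Proof. exact: sigma_algebra_bigcup. Qed.

HB.instance Definition _ :=
  @isMeasurable.Build (measure_matrix_display disp) 'M[T]_(m, n)
    matrix_measurable matrix_measurable0 matrix_measurableC
    matrix_measurable_bigcup.

End measurable_matrix.

(* The measure of R^(n+1) is the image of the product of the measures of R and
   R^n under concatenation; R^0 is a single point, of mass 1. *)
Fixpoint lebesgue_rV (R : realType) (n : nat) : set 'rV[R]_n -> \bar R :=
  match n with
  | 0 => \d_(0 : 'rV[R]_0)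
  | n'.+1 => pushforward (@lebesgue_measure R \x^ @lebesgue_rV R n')%E
               (fun z : R * 'rV[R]_n' => row_mx (const_mx z.1) z.2 : 'rV_(1 + n'))
  end.

(* The canonical norm of 'rV[R]_n in the library is the sup norm. *)
Definition eucl_norm (R : realType) (n : nat) (x : 'rV[R]_n) : R :=
  Num.sqrt (\sum_i x ord0 i ^+ 2).

Section half_space.
Context {R : realType} {d : nat}.
Local Notation point := ('rV[R]_d * R)%type.

Definition half_space : set point := [set z | 0 < z.2].

Definition hyp_volume (A : set point) : \bar R :=
  (\int[@lebesgue_rV R d \x^ @lebesgue_measure R]_(z in A)
    (z.2 ^- d.+1)%R%:E)%E.

(* Length of the curve s |-> (x s, y s), 0 <= s <= 1, for the Riemannian metric
   (dx_1^2 + ... + dx_d^2 + dy^2) / y^2. *)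
Definition hyp_length (x : R -> 'rV[R]_d) (y : R -> R) : \bar R :=
  (\int[@lebesgue_measure R]_(s in `[0%R, 1%R])
    (Num.sqrt (eucl_norm (derive1 x s) ^+ 2 + derive1 y s ^+ 2) / y s)%:E)%E.

(* C^1 curves from z to z' in the half-space; only the restriction of x and y to
   [0, 1] matters, and any C^1 curve on [0, 1] has a C^1 extension to R. *)
Definition hyp_curve (z z' : point) (x : R -> 'rV[R]_d) (y : R -> R) : Prop :=
  [/\ (forall s, derivable x s 1) /\ continuous (derive1 x),
      (forall s, derivable y s 1) /\ continuous (derive1 y),
      {in `[0, 1], forall s, 0 < y s},
      (x 0, y 0) = z & (x 1, y 1) = z'].

Definition hyp_dist (z z' : point) : \bar R :=
  ereal_inf [set l | exists x y, hyp_curve z z' x y /\ l = hyp_length x y].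

Definition locally_finite (eta : set point) : Prop :=
  forall K, compact K -> K `<=` half_space -> finite_set (eta `&` K).

Definition shift (s : 'rV[R]_d) (z : point) : point := (z.1 + s, z.2).

End half_space.

Record config (R : realType) (d : nat) := Config {
  pts :> set ('rV[R]_d * R);
  pts_half_space : pts `<=` half_space;
  pts_locally_finite : locally_finite pts }.

Section config.
Context {R : realType} {d : nat}.
Local Notation point := ('rV[R]_d * R)%type.

Lemma set0_half_space : @set0 point `<=` half_space.
Proof. by []. Qed.

Lemma set0_locally_finite : locally_finite (@set0 point).
Proof. by move=> K _ _; rewrite set0I. Qed.

HB.instance Definition _ := gen_eqMixin (config R d).
HB.instance Definition _ := gen_choiceMixin (config R d).
HB.instance Definition _ := isPointed.Build (config R d)
  (Config set0_half_space set0_locally_finite).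

Definition count_in (A : set point) (eta : config R d) : \bar R :=
  counting (eta `&` A).

Definition config_measurable : set (set (config R d)) :=
  <<s \bigcup_(A in [set A : set point | measurable A /\ A `<=` half_space])
        preimage_set_system [set: config R d] (count_in A) measurable >>.

Let config_measurable0 : config_measurable set0.
Proof. exact: sigma_algebra0. Qed.

Let config_measurableC A : config_measurable A -> config_measurable (~` A).
Proof. exact: sigma_algebraC. Qed.

Let config_measurable_bigcup (F : (set (config R d))^nat) :
  (forall i, config_measurable (F i)) -> config_measurable (\bigcup_i F i).
Proof. exact: sigma_algebra_bigcup. Qed.

Definition config_display : measure_display.
Proof. by constructor. Qed.

HB.instance Definition _ :=
  @isMeasurable.Build config_display (config R d)
    config_measurable config_measurable0 config_measurableC
    config_measurable_bigcup.

Lemma shift_half_space (s : 'rV[R]_d) (eta : config R d) :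
  shift s @` eta `<=` half_space.
Proof. by move=> _ [z etaz <-]; exact: (@pts_half_space _ _ eta z). Qed.

Lemma shift_locally_finite (s : 'rV[R]_d) (eta : config R d) :
  locally_finite (shift s @` eta).
Proof.
move=> K cK KH.
have cshift : continuous (shift (- s) : point -> point).
  move=> z; apply: (@cvg_pair _ _ _ _ (nbhs (z.1 - s)) (nbhs z.2)).
    by apply: cvgD; [exact: cvg_fst|exact: cvg_cst].
  exact: cvg_snd.
have cK' : compact (shift (- s) @` K).
  by apply: continuous_compact => //; exact: continuous_subspaceT.
have K'H : shift (- s) @` K `<=` half_space by move=> _ [z Kz <-]; exact: (KH z).
apply: (@sub_finite_set _ _ (shift s @` (eta `&` shift (- s) @` K))).
  move=> _ [[z etaz <-] Kz]; exists z => //; split=> //.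
  exists (shift s z) => //; case: z {etaz Kz} => x y.
  by rewrite /shift /= addrK.
apply: finite_image; exact: pts_locally_finite.
Qed.

Definition translate (s : 'rV[R]_d) (eta : config R d) : config R d :=
  Config (@shift_half_space s eta) (@shift_locally_finite s eta).

End config.

(* N is a Poisson point process of intensity lambda.hyp_volume.  The second
   argument of the library's poisson_prob is unused. *)
Definition poisson_process (R : realType) (d : nat) (lambda : R)
    (disp : measure_display) (Omega : measurableType disp)
    (P : probability Omega R) (N : {mfun Omega >-> config R d}) : Prop :=
  (forall (A : set ('rV[R]_d * R)) (k : nat),
      measurable A -> A `<=` half_space -> (hyp_volume A < +oo)%E ->
      P [set w | count_in A (N w) = k%:R%:E] =
      poisson_prob (lambda * fine (hyp_volume A)) 0 [set k]) /\
  (forall (n : nat) (A : 'I_n -> set ('rV[R]_d * R)) (k : 'I_n -> nat),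
      (forall i, [/\ measurable (A i), A i `<=` half_space
                   & (hyp_volume (A i) < +oo)%E]) ->
      trivIset setT A ->
      P (\bigcap_i [set w | count_in (A i) (N w) = (k i)%:R%:E]) =
      (\prod_i P [set w | count_in (A i) (N w) = (k i)%:R%:E])%E).

Section directed_spanning_forest.
Context {R : realType} {d : nat} (eta : config R d).
Local Notation point := ('rV[R]_d * R)%type.

Definition is_parent (z z' : point) : Prop :=
  [/\ pts eta z', z.2 < z'.2 &
      forall w, pts eta w -> z.2 < w.2 -> (hyp_dist z z' <= hyp_dist z w)%E].

(* Existence and uniqueness of the parent hold almost surely; when there is no
   parent the junk value is z itself. *)
Definition parent (z : point) : point := xget z (is_parent z).

Definition segment_at (z z' : point) (u : R) : point :=
  ((1 - u) *: z.1 + u *: z'.1, (1 - u) * z.2 + u * z'.2).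

Definition eucl_segment (z z' : point) : set point :=
  segment_at z z' @` `[0, 1].

Definition eucl_segment_co (z z' : point) : set point :=
  segment_at z z' @` `[0, 1[.

Definition DSF : set point := \bigcup_(z in eta) eucl_segment z (parent z).

Definition up (z : point) : point :=
  parent (xget z [set z0 | pts eta z0 /\ eucl_segment_co z0 (parent z0) z]).

Definition trajectory (z : point) : set point :=
  eucl_segment_co z (up z) `|`
  \bigcup_n eucl_segment_co (iter n parent (up z)) (iter n.+1 parent (up z)).

Definition level (t : R) : set 'rV[R]_d := [set x | DSF (x, expR t)].

(* [None] stands for the value infinity. *)
Definition ancestor (t1 t2 : R) (x : 'rV[R]_d) : option 'rV[R]_d :=
  xget None [set Some x' | x' in
    [set x' | trajectory (x, expR t1) (x', expR t2)]].

Definition descendants (t1 t2 : R) (x : 'rV[R]_d) : set 'rV[R]_d :=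
  [set x' | level t1 x' /\ ancestor t1 t2 x' = Some x].

(* The derivative is taken almost everywhere: s |-> ancestor t1 s x is smooth
   except at the finitely many levels of vertices of the trajectory. *)
Definition CFD (t1 t2 : R) (x : 'rV[R]_d) : \bar R :=
  if `[< exists2 s, s \in `[t1, t2] & ancestor t1 s x = None >] then +oo%E
  else (\int[@lebesgue_measure R]_(s in `[t1, t2])
         (eucl_norm (derive1 (fun u => odflt 0 (ancestor t1 u x)) s))%:E)%E.

(* The maximum, over an almost surely finite set, is rendered as a supremum. *)
Definition MBD (t1 t2 : R) (x : 'rV[R]_d) : \bar R :=
  if `[< descendants t1 t2 x !=set0 >]
  then ereal_sup (CFD t1 t2 @` descendants t1 t2 x) else 0%E.

End directed_spanning_forest.

Section palm.
Context {R : realType} {d : nat} {disp : measure_display}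
  {Omega : measurableType disp}.
Variables (P : probability Omega R) (N : {mfun Omega >-> config R d}).

(* Expected number of points of the level set at height 0 in the unit cube. *)
Definition alpha0 : \bar R :=
  (\int[P]_w
     counting (level (N w) 0%R `&` [set x | forall i, x ord0 i \in `[0%R, 1%R]]))%E.

(* The law of N conditioned on 0 in level t, computed with the window B. *)
Definition palm (t : R) (B : set 'rV[R]_d) (Gamma : set (config R d)) : \bar R :=
  ((alpha0 * (expR (- (d%:R * t)))%:E * lebesgue_rV B)^-1 *
   \int[P]_w \esum_(s in level (N w) t `&` B)
                (\1_Gamma (translate (- s) (N w)))%:E)%E.

End palm.

(* Main.v *)
Require Import Defs.
From HB Require Import structures.
From mathcomp Require Import all_boot all_order all_algebra.
From mathcomp Require Import all_classical all_reals all_analysis.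
From mathcomp Require Import measurable_realfun.
From mathcomp Require Import finmap.
From mathcomp Require Import ring lra zify.

(** Fix a unit cube with corner [a] and let [A = base = 2 ^ (d + 3)].  The region
below height 1 is cut into layers, the [k]-th one between the heights [A ^- k.+1]
and [A ^- k], and into windows, the [i]-th one of half-width [A ^+ i] around [a].
The pair [(k, i)] is bad if, within the window, some box just above the layer is
empty (a hole) or some thin box of the layer contains too many points (a cluster).

A nearby point above the layer bounds the distance to the parent, so without
holes the edges of the forest that start in the layer extend by at most
[A ^- k * 2 ^+ (k + i)] in each coordinate ([parent_edge_le]).  Without clusters,
a chain of parents has few vertices in each thin slab.  Hence a chain inside the
window [i] has total variation at most a constant times [2 ^+ (d.+2 * i)]
([total_variation]), much less than [A ^+ i.-1].  So if no pair with [k + i >= n] is bad, then every chain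
that crosses height 1 in the unit cube stays in the window [n], however low it
started ([good_chain]).  This is where uniformity in [h] comes from: [MBD] is at
most [d * A ^+ n] for every [h].

It remains to see that large values of [n] are rare, even when samples are
weighted by the number of edges that cross height 1.  The joint moments of the
number of pairs of Poisson points that cross height 1 inside a set [B] and of the
number of points in a box can be computed from independence, and are bounded by a
multiple of the volume of [B] ([expect_crossing_pairs]).  Applied to the cells of
holes and clusters, this shows that the probability that some pair with [k + i = n]
is bad decays faster than any prescribed power of [A ^- n] ([exists_parameters]),
which beats the volume of the boxes that contain the edge crossing height 1 and
the [p]-th power of [d * A ^+ n].

The Palm integral is the mean of a sum over the points of level 0 in [B], divided
by a normalizing constant.  The sum is dominated, whatever [h] is, by a measurable
function with finite mean ([MBD_le_edge_cost], [MBD_moment_le]).  Since neither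
[MBD] nor the sum is known to be measurable, [palm_integral_le] works with lower
integrals.  The constant must not vanish, because the inverse of 0 is infinite;
this is [alpha0_gt0], where an explicit event of positive probability forces an
edge to cross height 1. *)

Set Implicit Arguments.
Unset Strict Implicit.
Unset Printing Implicit Defensive.

Import Order.TTheory GRing.Theory Num.Theory.
Import numFieldTopology.Exports numFieldNormedType.Exports.

Local Open Scope classical_set_scope.
Local Open Scope ring_scope.

(** * Lebesgue measure on row vectors and hyperbolic volume *)
Section split.
Context {R : realType} {n : nat}.
Local Notation cons_rV := (fun z : measurableTypeR R * 'rV[R]_n => row_mx (const_mx z.1) z.2 : 'rV_(1 + n)).

Lemma measurable_coord m (j : 'I_m) :
  measurable_fun setT (fun x : 'rV[R]_m => x ord0 j).
Proof.
move=> _ Y mY; rewrite setTI.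
apply: sub_sigma_algebra; exists (ord0, j) => //=; exists Y => //; by rewrite setTI.
Qed.

Lemma measurable_fun_rV d0 (T : measurableType d0) m (f : T -> 'rV[R]_m) :
  (forall j, measurable_fun setT (fun t => f t ord0 j)) -> measurable_fun setT f.
Proof.
move=> mf; apply: (measurability (\bigcup_ij preimage_set_system [set: 'rV[R]_m]
        (fun A => A ij.1 ij.2) measurable)) => //.
move=> _ [_ [[i j] _ /= [Y mY <-]] <-].
by rewrite !setTI (ord1 i) -[X in measurable X]setTI; exact: (mf j).
Qed.

Lemma measurable_cons : measurable_fun setT cons_rV.
Proof.
apply: measurable_fun_rV => j; rewrite /=.
have [k ->|k ->] := split_ordP j.
  under eq_fun do rewrite row_mxEl mxE.
  exact: (@measurable_fst _ _ (measurableTypeR R)).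
under eq_fun do rewrite row_mxEr.
apply: (measurableT_comp (measurable_coord k)); exact: measurable_snd.
Qed.

Local Notation uncons_rV := (fun x : 'rV[R]_(1 + n) => (x ord0 ord0, rsubmx x)
  : measurableTypeR R * 'rV[R]_n).

Lemma measurable_uncons : measurable_fun setT uncons_rV.
Proof.
apply/measurable_fun_pairP; split => /=; first exact: (@measurable_coord (1 + n)).
apply: measurable_fun_rV => j; under eq_fun do rewrite mxE.
exact: measurable_coord.
Qed.

Lemma unconsK z : uncons_rV (cons_rV z) = z.
Proof.
case: z => a b /=; congr pair; last by rewrite row_mxKr.
have -> : ord0 = lshift n (@ord0 0) by apply/val_inj.
by rewrite row_mxEl mxE.
Qed.

End split.

Definition push_measure d1 d2 (T1 : measurableType d1) (T2 : measurableType d2)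
  (R : realType) (mu : {measure set T1 -> \bar R}) (f : T1 -> T2)
  (mf : measurable_fun setT f) : {measure set T2 -> \bar R}.
Proof. unshelve refine (pushforward mu f : measure T2 R); exact: mf. Defined.

Definition is_sigma_finite_measure d (T : measurableType d) (R : realType) (m : set T -> \bar R) :=
  [/\ m set0 = 0%E, forall A, (0 <= m A)%E, semi_sigma_additive m & sigma_finite setT m].

(** The proof argument is the key by which unification finds the measure
structure declared below; [measure_carrier] is used in the same way. *)
Definition sigma_finite_carrier d (T : measurableType d) (R : realType) (m : set T -> \bar R)
  of is_sigma_finite_measure m := m.

Section sigma_finite_pack.
Context d (T : measurableType d) (R : realType) (m : set T -> \bar R).
Variable hm : is_sigma_finite_measure m.
Let sfm0 : sigma_finite_carrier hm set0 = 0%E. Proof. by case: hm. Qed.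
Let sfm_ge0 A : (0 <= sigma_finite_carrier hm A)%E. Proof. by case: hm. Qed.
Let sfm_sigma : semi_sigma_additive (sigma_finite_carrier hm). Proof. by case: hm. Qed.
HB.instance Definition _ := isMeasure.Build _ _ _ (sigma_finite_carrier hm) sfm0 sfm_ge0 sfm_sigma.
Let sfm_sf : sigma_finite setT (sigma_finite_carrier hm). Proof. by case: hm. Qed.
HB.instance Definition _ := Measure_isSigmaFinite.Build _ _ _ (sigma_finite_carrier hm) sfm_sf.
Definition sf_measure : {sigma_finite_measure set T -> \bar R} := sigma_finite_carrier hm.
End sigma_finite_pack.

Definition is_measure d (T : measurableType d) (R : realType) (m : set T -> \bar R) :=
  [/\ m set0 = 0%E, forall A, (0 <= m A)%E & semi_sigma_additive m].

Definition measure_carrier d (T : measurableType d) (R : realType) (m : set T -> \bar R)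
  of is_measure m := m.

Section measure_pack.
Context d (T : measurableType d) (R : realType) (m : set T -> \bar R).
Variable hm : is_measure m.
Let ms0 : measure_carrier hm set0 = 0%E. Proof. by case: hm. Qed.
Let ms_ge0 A : (0 <= measure_carrier hm A)%E. Proof. by case: hm. Qed.
Let ms_sigma : semi_sigma_additive (measure_carrier hm). Proof. by case: hm. Qed.
HB.instance Definition _ := isMeasure.Build _ _ _ (measure_carrier hm) ms0 ms_ge0 ms_sigma.
Definition pack_measure : {measure set T -> \bar R} := measure_carrier hm.
End measure_pack.

(** By induction on the dimension: concatenation is a measurable bijection, and it
carries the product of sigma-finite measures to [lebesgue_rV] on [n.+1]
coordinates. *)
Lemma lebesgue_rV_measure (R : realType) n : is_sigma_finite_measure (@lebesgue_rV R n).
Proof.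
elim: n => [|n IHn].
  pose M0 : {measure set 'rV[R]_0 -> \bar R} := \d_(0 : 'rV[R]_0).
  split=> [|A||]; [exact: (measure0 M0)|exact: (measure_ge0 M0)|exact: (@measure_semi_sigma_additive _ _ _ M0)|].
  exact: (sigma_finiteT (\d_(0 : 'rV[R]_0))).
pose m := sf_measure IHn.
have mE : m = @lebesgue_rV R n :> (_ -> _) by [].
pose mu := (@lebesgue_measure R \x^ m)%E.
pose M := push_measure mu (@measurable_cons R n).
pose MM := pushforward mu (fun z : measurableTypeR R * 'rV[R]_n => row_mx (const_mx z.1) z.2 : 'rV_(1 + n)).
have muE : mu = (@lebesgue_measure R \x^ @lebesgue_rV R n)%E :> (_ -> _) by rewrite /mu mE.
have sM : sigma_finite setT M.
  have /sigma_finiteP[F [TF ndF Foo]] := sigma_finiteT (@lebesgue_measure R).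
  have /sigma_finiteP[G [TG ndG Goo]] := sigma_finiteT m.
  pose U := fun x : 'rV[R]_(1 + n) => (x ord0 ord0, rsubmx x) : measurableTypeR R * 'rV[R]_n.
  exists (fun k => U @^-1` (F k `*` G k)).
    apply/esym; rewrite -subTset => x _.
    have [i _ Fi] : (\bigcup_k F k) (U x).1 by rewrite -TF.
    have [j _ Gj] : (\bigcup_k G k) (U x).2 by rewrite -TG.
    exists (maxn i j) => //; split.
    - by move: (U x).1 Fi; exact/subsetPset/ndF/leq_maxl.
    - by move: (U x).2 Gj; exact/subsetPset/ndG/leq_maxr.
  move=> k; have [? ?] := Foo k; have [? ?] := Goo k; split.
    rewrite -[X in measurable X]setTI; apply: measurable_uncons => //; exact: measurableX.
  have -> : M (U @^-1` (F k `*` G k)) = mu (F k `*` G k).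
    by rewrite /M /pushforward; congr (mu _); apply/funext => z; exact: (congr1 (F k `*` G k) (unconsK z)).
  by rewrite /mu product_measure2E// lte_mul_pinfty// ge0_fin_numE.
split=> [|A||]; [exact: (measure0 M)|exact: (measure_ge0 M)|exact: (@measure_semi_sigma_additive _ _ _ M)|exact: sM].
Qed.

Section instance.
Variables (R : realType) (n : nat).
Let leb0 : @lebesgue_rV R n set0 = 0%E. Proof. by case: (lebesgue_rV_measure R n). Qed.
Let leb_ge0 A : (0 <= @lebesgue_rV R n A)%E. Proof. by case: (lebesgue_rV_measure R n). Qed.
Let leb_sigma_additive : semi_sigma_additive (@lebesgue_rV R n).
Proof. by case: (lebesgue_rV_measure R n). Qed.
HB.instance Definition _ := isMeasure.Build _ _ _ (@lebesgue_rV R n) leb0 leb_ge0 leb_sigma_additive.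
Let leb_sigma_finite : sigma_finite setT (@lebesgue_rV R n).
Proof. by case: (lebesgue_rV_measure R n). Qed.
HB.instance Definition _ := Measure_isSigmaFinite.Build _ _ _ (@lebesgue_rV R n) leb_sigma_finite.
End instance.

Definition cube (R : realType) n (a : 'rV[R]_n) (r : R) : set 'rV[R]_n :=
  [set x | forall j, a ord0 j <= x ord0 j < a ord0 j + r].

Lemma measurable_cube (R : realType) n (a : 'rV[R]_n) (r : R) : measurable (cube a r).
Proof.
have -> : cube a r = \bigcap_(j in [set: 'I_n]) (fun x : 'rV[R]_n => x ord0 j) @^-1` `[a ord0 j, a ord0 j + r[.
  apply/seteqP; split=> x /= xa j; first by move=> _; rewrite /= in_itv /= xa.
  by have /= := xa j I; rewrite in_itv.
apply: fin_bigcap_measurable => // j _.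
rewrite -[X in measurable X]setTI; exact: measurable_coord.
Qed.

Definition cons_rV (R : realType) n (t : R) (y : 'rV[R]_n) : 'rV[R]_n.+1 :=
  row_mx (const_mx t) y : 'rV_(1 + n).

Lemma cons_rV0 (R : realType) n t (y : 'rV[R]_n) : cons_rV t y ord0 ord0 = t.
Proof.
transitivity ((const_mx t : 'M[R]_(1, 1)) ord0 ord0); last by rewrite mxE.
rewrite -[RHS](row_mxEl _ y).
by rewrite /cons_rV; congr (row_mx _ _ _ _); apply/val_inj.
Qed.

Lemma cons_rVS (R : realType) n t (y : 'rV[R]_n) k : cons_rV t y ord0 (lift ord0 k) = y ord0 k.
Proof.
have := row_mxEr (const_mx t : 'M[R]_(1, 1)) y ord0 k => <-.
by rewrite /cons_rV; congr (row_mx _ _ _ _); apply/val_inj.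
Qed.

(** [lebesgue_rV] is defined with the product that integrates over the second
factor the lengths of the sections in the first coordinate. *)
Lemma lebesgue_rV_consE (R : realType) n (A : set 'rV[R]_n.+1) :
  lebesgue_rV A = (\int[@lebesgue_rV R n]_y
     @lebesgue_measure R [set t | A (cons_rV t y)])%E.
Proof.
rewrite /lebesgue_rV -/lebesgue_rV /pushforward /product_measure2.
apply: eq_integral => y _ /=; congr lebesgue_measure.
by apply/funext => t; rewrite ysectionE.
Qed.

Lemma lebesgue_rV_cube (R : realType) n (a : 'rV[R]_n) (r : R) : 0 <= r ->
  lebesgue_rV (cube a r) = (r ^+ n)%:E.
Proof.
move=> r0; elim: n a => [|n IHn] a.
  rewrite /lebesgue_rV diracE mem_set //= => -[].
  by case.
pose a' : 'rV[R]_n := \row_j a ord0 (lift ord0 j).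
have -> : lebesgue_rV (cube a r) =
  (@lebesgue_measure R \x^ @lebesgue_rV R n)%E (`[a ord0 ord0, a ord0 ord0 + r[%classic `*` cube a' r).
  rewrite {1}/lebesgue_rV -/lebesgue_rV /pushforward; congr (_ _).
  apply/seteqP; split=> -[t y] /= H.
    have {}H j : a ord0 j <= cons_rV t y ord0 j < a ord0 j + r by exact: H.
    split => [|j]; first by have := H ord0; rewrite in_itv /= cons_rV0.
    by have := H (lift ord0 j); rewrite cons_rVS !mxE.
  have {H} [H1 H2] := H.
  suff : forall j, a ord0 j <= cons_rV t y ord0 j < a ord0 j + r by [].
  move=> j; have [k ->|->] := unliftP ord0 j; last by rewrite cons_rV0; move: H1; rewrite in_itv.
  by rewrite cons_rVS; have := H2 k; rewrite /a' !mxE.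
transitivity (@lebesgue_measure R `[a ord0 ord0, (a ord0 ord0 + r)%R[ * lebesgue_rV (cube a' r))%E.
  by apply: product_measure2E => //; exact: measurable_cube.
rewrite IHn lebesgue_measure_itv /= lte_fin ltrDl.
case: ifPn => [_|]; first by rewrite -EFinD addrAC subrr add0r -EFinM exprS.
by rewrite -leNgt => r0'; have -> : r = 0 by [apply/eqP; rewrite eq_le r0' r0]; rewrite mul0e exprS mul0r.
Qed.

Lemma lebesgue_measure_affine (R : realType) (al v : R) (A : set R) : 0 < al -> measurable A ->
  lebesgue_measure ((fun x => al * x + v) @^-1` A) = (al^-1%:E * lebesgue_measure A)%E.
Proof.
move=> al0 mA.
have mf : measurable_fun setT (fun x : measurableTypeR R => al * x + v : measurableTypeR R).
  by apply: measurable_funD => //; exact: measurable_funM.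
pose al' : {nonneg R} := NngNum (ltW al0).
have -> : lebesgue_measure A = (mscale al' (push_measure (@lebesgue_measure R) mf)) A.
  apply: lebesgue_measure_unique => // _ [[a b]] _ <- /=.
  rewrite /mscale /= /pushforward.
  have -> : (fun x : R => al * x + v) @^-1` [set` `]a, b]] = [set` `](a - v) / al, (b - v) / al]].
    by apply/seteqP; split=> x /=; rewrite !in_itv /= ltr_pdivrMr // ler_pdivlMr //;
       rewrite ltrBlDr lerBrDr mulrC.
  rewrite !lebesgue_measure_itv /= !lte_fin ltr_pM2r ?invr_gt0// ltrD2r.
  case: ifPn => _; last by rewrite mule0.
  by rewrite -!EFinD -EFinM; congr EFin; field; rewrite gt_eqF.
by rewrite /mscale /= muleA -EFinM mulVf ?gt_eqF // mul1e.
Qed.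

Lemma measurable_affine (R : realType) n (al : R) (v : 'rV[R]_n) :
  measurable_fun setT (fun x : 'rV[R]_n => al *: x + v).
Proof.
apply: measurable_fun_rV => j; under eq_fun do rewrite !mxE.
apply: measurable_funD => //; apply: measurable_funM => //; exact: measurable_coord.
Qed.

(** The sections in the first coordinate scale by [lebesgue_measure_affine]; the
integral over the other coordinates scales by induction, applied to the
push-forward of [lebesgue_rV]. *)
Lemma lebesgue_rV_affine (R : realType) n (al : R) (v : 'rV[R]_n) (A : set 'rV[R]_n) :
  0 < al -> measurable A ->
  lebesgue_rV ((fun x => al *: x + v) @^-1` A) = ((al^-1 ^+ n)%:E * lebesgue_rV A)%E.
Proof.
move=> al0; elim: n v A => [|n IHn] v A mA.
  rewrite expr0 mul1e; congr lebesgue_rV; apply/funext => x; rewrite /preimage /=.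
  by rewrite (thinmx0 (_ + _)) (thinmx0 x).
pose v' : 'rV[R]_n := \row_j v ord0 (lift ord0 j).
pose F (y : 'rV[R]_n) := @lebesgue_measure R [set t | A (cons_rV t y)].
have mF : measurable_fun setT F.
  have mA' : measurable ((fun z : measurableTypeR R * 'rV[R]_n => row_mx (const_mx z.1) z.2 : 'rV_(1 + n)) @^-1` A).
    by rewrite -[X in measurable X]setTI; apply: measurable_cons.
  have := measurable_fun_ysection (@lebesgue_measure R) mA'.
  apply: eq_measurable_fun => y _ /=; rewrite /F; congr lebesgue_measure.
  by apply/funext => t; rewrite ysectionE.
have F0 y : (0 <= F y)%E by [].
have mAy y : measurable [set t : measurableTypeR R | A (cons_rV t y)].
  have := measurable_comp measurableT (@subsetT _ _) (@measurable_cons R n) (measurable_pair2 y).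
  by move=> /(_ measurableT _ mA); rewrite setTI.
rewrite !lebesgue_rV_consE.
transitivity (\int[@lebesgue_rV R n]_y ((al^-1)%:E * F (al *: y + v')%R))%E.
  apply: eq_integral => y _; rewrite -(lebesgue_measure_affine (v ord0 ord0)) //; last exact: mAy.
  congr lebesgue_measure; apply/funext => t; rewrite /preimage /=; congr A.
  apply/rowP => j; have [k ->|->] := unliftP ord0 j.
    by rewrite cons_rVS mxE [X in X + _]mxE cons_rVS !mxE.
  by rewrite mxE [X in X + _]mxE !cons_rV0.
rewrite ge0_integralZl //; last 2 first.
- exact: (measurableT_comp mF (measurable_affine _ _)).
- by rewrite lee_fin invr_ge0 ltW.
have alV : 0 <= al^-1 ^+ n by rewrite exprn_ge0 // invr_ge0 ltW.
transitivity ((al^-1)%:E * ((al^-1 ^+ n)%:E * \int[@lebesgue_rV R n]_y F y))%E; last first.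
  by rewrite muleA -EFinM exprS.
congr (_ * _)%E.
rewrite -(ge0_integral_mscale _ measurableT (NngNum alV)) //.
transitivity (\int[push_measure (@lebesgue_rV R n) (measurable_affine al v')]_y F y)%E.
  exact: (esym (ge0_integral_pushforward (measurable_affine al v') (@lebesgue_rV R n) measurableT mF (fun y _ => F0 y))).
apply: eq_measure_integral => B mB _.
by rewrite /mscale /= /pushforward IHn.
Qed.

Section hyp_measure.
Context {R : realType} {d : nat}.
Local Notation point := ('rV[R]_d * R)%type.
Implicit Types A : set point.

Let leb : {measure set _ -> \bar R} := (@lebesgue_rV R d \x^ @lebesgue_measure R)%E.
Let dens (z : 'rV[R]_d * measurableTypeR R) : \bar R := (z.2 ^- d.+1)%R%:E.

Lemma measurable_half_space : measurable (@half_space R d).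
Proof.
have -> : @half_space R d = snd @^-1` `]0, +oo[%classic.
  by apply/seteqP; split=> z /=; rewrite in_itv /= andbT.
rewrite -[X in measurable X]setTI; exact: measurable_snd.
Qed.

Let mdens D : D `<=` @half_space R d -> measurable_fun D dens.
Proof.
move=> DH; apply/measurable_EFinP.
apply: (@eq_measurable_fun _ _ _ _ _ (fun z : 'rV[R]_d * measurableTypeR R => expR (- (d.+1%:R * ln z.2)))).
  move=> z /set_mem /DH z0; by rewrite expRN expRM_natl lnK // posrE.
apply: measurable_funTS; apply: measurableT_comp => //.
apply: measurableT_comp => //; apply: measurable_funM => //.
apply: measurableT_comp => //; exact: measurable_ln.
Qed.

Let dens_ge0 z : @half_space R d z -> (0 <= dens z)%E.
Proof. by move=> z0; rewrite lee_fin invr_ge0 exprn_ge0 // ltW. Qed.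

(** Cutting with the half-space makes the density nonnegative, and so
[hyp_volume] a measure on all sets. *)
Definition hyp_measure A : \bar R := hyp_volume (A `&` @half_space R d).

Lemma hyp_measureE A : A `<=` @half_space R d -> hyp_measure A = hyp_volume A.
Proof. by move=> /setIidPl; rewrite /hyp_measure => ->. Qed.

Let hyp0 : hyp_measure set0 = 0%E.
Proof. by rewrite /hyp_measure /hyp_volume set0I integral_set0. Qed.

Let hyp_ge0 A : (0 <= hyp_measure A)%E.
Proof. by apply: integral_ge0 => z [_ Hz]; exact: dens_ge0. Qed.

Let hyp_sigma_additive : semi_sigma_additive hyp_measure.
Proof.
move=> F mF tF mUF.
rewrite [X in _ --> X](_ : _ = \sum_(n <oo) hyp_measure (F n))%E.
  by apply/cvg_closeP; split; [exact: is_cvg_nneseries|rewrite closeE].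
have mFH k := measurableI _ _ (mF k) measurable_half_space.
rewrite /hyp_measure /hyp_volume setI_bigcupl.
rewrite (@ge0_integral_bigcup _ _ _ leb (fun n => F n `&` @half_space R d) dens) //.
- by apply: mdens => z [k _ []].
- by move=> z [k _ [_ Hz]]; exact: dens_ge0.
- by apply: trivIset_setIr.
Qed.

HB.instance Definition _ := isMeasure.Build _ _ _ hyp_measure hyp0 hyp_ge0 hyp_sigma_additive.

Let leb_box (a : 'rV[R]_d) (r u v : R) : 0 <= r -> u <= v ->
  leb (cube a r `*` `[u, v[%classic) = (r ^+ d * (v - u))%:E.
Proof.
move=> r0 uv; transitivity (lebesgue_rV (cube a r) * @lebesgue_measure R `[u, v[)%E.
  by apply: product_measure2E => //; exact: measurable_cube.
rewrite lebesgue_rV_cube // lebesgue_measure_itv /= lte_fin.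
case: ltrP => [_|vu]; first by rewrite -EFinD -EFinM.
have -> : u = v by apply/eqP; rewrite eq_le uv vu.
by rewrite subrr mulr0 mule0.
Qed.

Lemma measurable_box (a : 'rV[R]_d) (r u v : R) : measurable (cube a r `*` `[u, v[%classic : set point).
Proof. by apply: measurableX => //; exact: measurable_cube. Qed.

Lemma box_half_space (a : 'rV[R]_d) (r u v : R) : 0 < u ->
  cube a r `*` `[u, v[%classic `<=` @half_space R d.
Proof. by move=> u0 z [_ /=]; rewrite in_itv /= => /andP[uz _]; exact: lt_le_trans uz. Qed.

Lemma hyp_measure_le A (u : R) : measurable A -> 0 < u -> (forall z, A z -> u <= z.2) ->
  (hyp_measure A <= (u ^- d.+1)%:E * (@lebesgue_rV R d \x^ @lebesgue_measure R) A)%E.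
Proof.
move=> mA u0 Au; have AH : A `<=` @half_space R d by move=> z /Au; exact: lt_le_trans.
rewrite hyp_measureE // -(@integral_cst _ _ _ leb) //.
apply: ge0_le_integral => //; [|exact: mdens|].
- by move=> z /AH; exact: dens_ge0.
move=> z /Au uz; have z0 : 0 < z.2 by exact: lt_le_trans uz.
rewrite lee_fin lef_pV2 ?posrE ?exprn_gt0 //.
by apply: lerXn2r => //; rewrite nnegrE ltW.
Qed.

Lemma hyp_box_le (a : 'rV[R]_d) (r u v : R) : 0 <= r -> 0 < u -> u <= v ->
  (hyp_measure (cube a r `*` `[u, v[%classic) <= (r ^+ d * (v - u) / u ^+ d.+1)%:E)%E.
Proof.
move=> r0 u0 uv; rewrite EFinM -(leb_box a) // muleC.
apply: hyp_measure_le => //; first exact: measurable_box.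
by move=> z [_ /=]; rewrite in_itv /= => /andP[].
Qed.

Lemma hyp_box_ge (a : 'rV[R]_d) (r u v : R) : 0 <= r -> 0 < u -> u <= v ->
  ((r ^+ d * (v - u) / v ^+ d.+1)%:E <= hyp_measure (cube a r `*` `[u, v[%classic))%E.
Proof.
move=> r0 u0 uv; rewrite hyp_measureE; last exact: box_half_space.
have mB := measurable_box a r u v.
rewrite EFinM -(leb_box a) // muleC -(@integral_cst _ _ _ leb) //.
apply: ge0_le_integral => //.
- by move=> z _; rewrite lee_fin invr_ge0 exprn_ge0 // ltW // (lt_le_trans u0).
- by apply: mdens; exact: box_half_space.
move=> z [_ /=]; rewrite in_itv /= => /andP[uz zv].
have z0 : 0 < z.2 by exact: lt_le_trans uz.
have v0 : 0 < v by exact: lt_le_trans uv.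
rewrite lee_fin lef_pV2 ?posrE ?exprn_gt0 //.
by apply: lerXn2r; rewrite ?nnegrE ltW.
Qed.

Lemma hyp_horizontal : hyp_measure (setT `*` [set 1%R]) = 0%E.
Proof.
have H1 : setT `*` [set 1%R] `<=` @half_space R d by move=> z [_ /=]; rewrite /half_space /= => ->.
rewrite hyp_measureE //; apply: (@null_set_integral _ _ _ leb) => //.
- exact: measurableX.
- exact: mdens.
- transitivity (@lebesgue_rV R d setT * @lebesgue_measure R [set 1%R])%E.
    exact: product_measure2E.
  by rewrite lebesgue_measure_set1 mule0.
Qed.

End hyp_measure.

(** * Bounds for the hyperbolic distance *)
Section lower_integral.
Local Open Scope ereal_scope.
Context d (T : measurableType d) (R : realType) (mu : {measure set T -> \bar R}).

(** The integral of a nonnegative function is the supremum of the integrals of the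
simple functions below it, hence monotone even without measurability. *)
Lemma le_integral_ge0 (D : set T) (f g : T -> \bar R) :
  (forall x, D x -> 0 <= f x) -> (forall x, D x -> f x <= g x) ->
  \int[mu]_(x in D) f x <= \int[mu]_(x in D) g x.
Proof.
move=> f0 fg; rewrite [leLHS]integral_mkcond [leRHS]integral_mkcond.
have f0' x : 0 <= (f \_ D) x by rewrite patchE; case: ifPn => // /set_mem; exact: f0.
have fg' x : (f \_ D) x <= (g \_ D) x by rewrite !patchE; case: ifPn => // /set_mem; exact: fg.
rewrite !ge0_integralTE //; last by move=> x; exact: le_trans (fg' x).
apply: ereal_sup_le => _ [h hf <-]; exists h => // x; exact: le_trans (fg' x).
Qed.

End lower_integral.

Section hyp_dist_bounds.
Context {R : realType} {d : nat}.
Local Notation point := ('rV[R]_d * R)%type.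

Lemma eucl_normZ (c : R) (v : 'rV[R]_d) : eucl_norm (c *: v) = `|c| * eucl_norm v.
Proof.
rewrite /eucl_norm -sqrtr_sqr -sqrtrM ?sqr_ge0 //; congr Num.sqrt.
by rewrite mulr_sumr; apply: eq_bigr => i _; rewrite mxE exprMn.
Qed.

Lemma eucl_norm_ge0 (v : 'rV[R]_d) : 0 <= eucl_norm v.
Proof. exact: sqrtr_ge0. Qed.

Lemma eucl_norm_coord (v : 'rV[R]_d) j : `|v ord0 j| <= eucl_norm v.
Proof.
rewrite -sqrtr_sqr ler_wsqrtr // (bigD1 j) //= lerDl sumr_ge0 // => i _; exact: sqr_ge0.
Qed.

Lemma eucl_norm_le (v : 'rV[R]_d) (r : R) : 0 <= r -> (forall j, `|v ord0 j| <= r) ->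
  eucl_norm v <= d%:R * r.
Proof.
move=> r0 vr; case: d v vr => [|n] v vr.
  by rewrite /eucl_norm big_ord0 sqrtr0 mul0r.
rewrite -[leRHS]ger0_norm ?mulr_ge0 // -sqrtr_sqr ler_wsqrtr //.
apply: (@le_trans _ _ (\sum_(i < n.+1) r ^+ 2)).
  by apply: ler_sum => i _; rewrite -real_normK ?num_real // lerXn2r ?nnegrE // vr.
rewrite sumr_const card_ord exprMn -[leLHS]mulr_natl ler_wpM2r ?sqr_ge0 //.
by rewrite -natrX ler_nat expnS leq_pmulr.
Qed.

Lemma sqrtD_le (a b : R) : 0 <= a -> Num.sqrt (a ^+ 2 + b ^+ 2) <= a + `|b|.
Proof.
move=> a0; rewrite -[leRHS]ger0_norm ?addr_ge0 // -sqrtr_sqr ler_wsqrtr //.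
rewrite -[b ^+ 2]real_normK ?num_real // sqrrD.
have := mulr_ge0 a0 (normr_ge0 b); lra.
Qed.

Section upper_curve.
(* With [S = expR T], the curve is [x] affine in the hyperbolic tangent and [y]
proportional to the hyperbolic secant of [T * (2 * s - 1)], a geodesic half
circle, times the factor [expR (k * s)] that brings the end point to the height
of [w].  Here [1 - 2 * q] is this tangent and [2 * E * q] this secant. *)
Variables (z w : point) (S : R).
Hypothesis (z0 : 0 < z.2) (zw : z.2 <= w.2) (S1 : 1 < S).
Let T := ln S.
Let k := ln (w.2 / z.2).
Let E (s : R) := expR (T * (2 * s - 1)).
Let q (s : R) := (E s ^+ 2 + 1)^-1.
Let tau : R := 1 - 2 / (S ^+ 2 + 1).
Let theta (s : R) : R := (1 - 2 * q s) / (2 * tau) + 2^-1.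
Let x (s : R) : 'rV[R]_d := theta s *: (w.1 - z.1) + z.1.
Let y (s : R) := z.2 * (S + S^-1) * (expR (k * s) * E s * q s).

Let S0 : 0 < S. Proof. exact: lt_trans S1. Qed.

Let dE (s : R) : is_derive s (1 : R) E (2 * T * E s).
Proof.
have -> : E = expR \o (fun s => T * (2 * s - 1)) by [].
by apply: is_derive_eq; rewrite /GRing.scale /=; ring.
Qed.

Let EE1 (s : R) : 0 < E s ^+ 2 + 1.
Proof. by rewrite ltr_wpDl // sqr_ge0. Qed.

Let dq (s : R) : is_derive s (1 : R) q (- (4 * T) * (E s * q s) ^+ 2).
Proof.
have := dE s => ?; have e0 := EE1 s.
have : is_derive s (1 : R) (fun s => E s ^+ 2 + 1) (4 * T * E s ^+ 2).
  by apply: is_derive_eq; rewrite /GRing.scale /=; ring.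
move=> D; apply: (is_derive_eq (is_deriveV (f := fun s => E s ^+ 2 + 1) (lt0r_neq0 e0) D)).
by rewrite /GRing.scale /= /q; field; rewrite gt_eqF.
Qed.

Let tau_gt0 : 0 < tau.
Proof.
have S2 : 1 < S ^+ 2 by rewrite exprn_egt1.
by rewrite /tau subr_gt0 ltr_pdivrMr; lra.
Qed.

Let T_gt0 : 0 < T.
Proof. by rewrite ln_gt0. Qed.

Let dtheta (s : R) : is_derive s (1 : R) theta (4 * T * (E s * q s) ^+ 2 / tau).
Proof.
have := dq s => ?; have t0 := tau_gt0.
rewrite /theta; apply: is_derive_eq; rewrite /GRing.scale /=; field.
by rewrite gt_eqF.
Qed.

Let dy (s : R) : is_derive s (1 : R) y (y s * (k + 2 * T - 4 * T * E s ^+ 2 * q s)).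
Proof.
have := dq s => ?; have := dE s => ?.
by rewrite /y; apply: is_derive_eq; rewrite /GRing.scale /=; ring.
Qed.

Let cE : continuous E.
Proof. by move=> s; apply/differentiable_continuous/derivable1_diffP; have [] := dE s. Qed.
Let cq : continuous q.
Proof. by move=> s; apply/differentiable_continuous/derivable1_diffP; have [] := dq s. Qed.
Let cy : continuous y.
Proof. by move=> s; apply/differentiable_continuous/derivable1_diffP; have [] := dy s. Qed.

Let dx_coord (s : R) i j : is_derive s (1 : R) (fun t => x t i j)
  (4 * T * (E s * q s) ^+ 2 / tau * (w.1 - z.1) i j).
Proof.
have -> : (fun t => x t i j) = (fun t => theta t * (w.1 - z.1) i j + z.1 i j).
  by apply/funext => t; rewrite /x !mxE.
have := dtheta s => ?.
by apply: is_derive_eq; rewrite /GRing.scale /=; ring.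
Qed.

Let derivable_x (s : R) : derivable x s 1.
Proof. by apply/derivable_mxP => i j; have [] := dx_coord s i j. Qed.

Let derive1_x (s : R) : derive1 x s = (4 * T * (E s * q s) ^+ 2 / tau) *: (w.1 - z.1).
Proof.
rewrite derive1E derive_mx //; apply/matrixP => i j; rewrite !mxE.
by have := dx_coord s i j => ?; rewrite derive_val !mxE.
Qed.

Let derive1_y (s : R) : derive1 y s = y s * (k + 2 * T - 4 * T * E s ^+ 2 * q s).
Proof. by rewrite derive1E; have := dy s => ?; rewrite derive_val. Qed.

Let y_gt0 (s : R) : 0 < y s.
Proof.
rewrite /y !mulr_gt0 ?expR_gt0 ?invr_gt0 //.
by rewrite addr_gt0 ?invr_gt0.
Qed.

Let w0 : 0 < w.2. Proof. exact: lt_le_trans zw. Qed.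

Let E0 : E 0 = S^-1.
Proof. by rewrite /E mulr0 sub0r mulrN1 expRN lnK // posrE. Qed.

Let E1 : E 1 = S.
Proof. by rewrite /E mulr1 (_ : 2 - 1 = 1 :> R) ?mulr1 ?lnK ?posrE //; ring. Qed.

Let S2n0 : S ^+ 2 - 1 != 0.
Proof. by have : 1 < S ^+ 2 by [rewrite exprn_egt1]; lra. Qed.

Let tauE : tau = (S ^+ 2 - 1) / (S ^+ 2 + 1).
Proof. by rewrite /tau; field; have := EE1 1; rewrite E1 => /lt0r_neq0. Qed.

Let curve : hyp_curve z w x y.
Proof.
have s1 : S ^+ 2 + 1 != 0 by have := EE1 1; rewrite E1 => /lt0r_neq0.
have sn0 : S != 0 by rewrite lt0r_neq0.
have s1' : 1 + S ^+ 2 != 0 by rewrite addrC.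
split; first 2 last.
- by move=> s _; exact: y_gt0.
- rewrite {1}(surjective_pairing z); congr pair.
    rewrite /x (_ : theta 0 = 0) ?scale0r ?add0r // /theta /q E0 tauE.
    by field; rewrite ?(s1, s1', S2n0, sn0).
  rewrite /y /q E0 mulr0 expR0; field.
  by rewrite ?(s1, s1', S2n0, sn0).
- rewrite {1}(surjective_pairing w); congr pair.
    rewrite /x (_ : theta 1 = 1) ?scale1r ?subrK // /theta /q E1 tauE.
    by field; rewrite s1 S2n0.
  rewrite /y /q E1 mulr1 lnK ?posrE ?divr_gt0 //; field.
  by rewrite ?(s1, s1', S2n0, sn0) gt_eqF.
- split; first exact: derivable_x.
  rewrite (_ : derive1 x = fun s => (4 * T * ((E s * q s) * (E s * q s)) / tau) *: (w.1 - z.1)); last by apply/funext => s; rewrite derive1_x expr2.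
    have cth : continuous (fun s : R => 4 * T * ((E s * q s) * (E s * q s)) / tau).
    move=> s; apply: cvgM; last exact: cvg_cst.
    apply: cvgM; first exact: cvg_cst.
    by apply: cvgM; apply: cvgM; [exact: cE|exact: cq|exact: cE|exact: cq].
  by move=> s; exact: (@cvgZr_tmp R 'rV[R]_d R (nbhs s) _ _ _ (w.1 - z.1) (cth s)).
split; first by move=> s; have [] := dy s.
rewrite (_ : derive1 y = fun s => y s * (k + 2 * T - 4 * T * (E s * E s) * q s)); last by apply/funext => s; rewrite derive1_y expr2.
move=> s; apply: cvgM; first exact: cy.
apply: cvgB; first exact: cvg_cst.
apply: cvgM; last exact: cq.
apply: cvgM; first exact: cvg_cst.
by apply: cvgM; exact: cE.
Qed.

Hypothesis dist_w : eucl_norm (w.1 - z.1) <= z.2 * ((S - S^-1) / 2).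

Let k_ge0 : 0 <= k.
Proof. by apply: ln_ge0; rewrite ler_pdivlMr // mul1r. Qed.

(** The vertical speed is at most [2 * T + k], and the horizontal speed at most
[T] because [dist_w] bounds the displacement in terms of the hyperbolic sine. *)
Let speed (s : R) : 0 <= s ->
  Num.sqrt (eucl_norm (derive1 x s) ^+ 2 + derive1 y s ^+ 2) / y s <= 3 * T + k.
Proof.
move=> s0; have ys := y_gt0 s; rewrite ler_pdivrMr //.
apply: le_trans (sqrtD_le _ _) _; first exact: eucl_norm_ge0.
have e1 := EE1 s; have Es : 0 < E s by exact: expR_gt0.
have q0 : 0 < q s by rewrite invr_gt0.
have Eq1 : E s ^+ 2 * q s <= 1 by rewrite ler_pdivrMr // mul1r lerDl.
have Eq0 : 0 <= E s ^+ 2 * q s by rewrite mulr_ge0 ?sqr_ge0 ?ltW.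
rewrite (_ : (3 * T + k) * y s = T * y s + y s * (2 * T + k)); last by ring.
apply: lerD; last first.
  rewrite derive1_y normrM (ger0_norm (ltW ys)) ler_pM2l //.
  rewrite ler_norml; have := ltW T_gt0; have := k_ge0; nra.
rewrite derive1_x eucl_normZ ger0_norm; last first.
  by rewrite mulr_ge0 ?invr_ge0 ?(ltW tau_gt0) // mulr_ge0 ?sqr_ge0 // mulr_ge0 // ltW.
apply: (@le_trans _ _ (4 * T * (E s * q s) ^+ 2 / tau * (z.2 * ((S - S^-1) / 2)))).
  by rewrite ler_wpM2l // mulr_ge0 ?invr_ge0 ?(ltW tau_gt0) // mulr_ge0 ?sqr_ge0 // mulr_ge0 // ltW.
have -> : 4 * T * (E s * q s) ^+ 2 / tau * (z.2 * ((S - S^-1) / 2)) =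
   T * (z.2 * (S + S^-1) * (E s * q s)) * (2 * (E s * q s)).
  rewrite tauE; have s1 : S ^+ 2 + 1 != 0 by have := EE1 1; rewrite E1 => /lt0r_neq0.
  by field; rewrite s1 S2n0 lt0r_neq0.
have p0 : 0 < z.2 * (S + S^-1) * (E s * q s) by rewrite !mulr_gt0 // addr_gt0 // invr_gt0.
apply: (@le_trans _ _ (T * (z.2 * (S + S^-1) * (E s * q s)))).
  rewrite ler_piMr //; first by rewrite mulr_ge0 // ltW // T_gt0.
  rewrite mulrA ler_pdivrMr // mul1r; have := sqr_ge0 (E s - 1); nra.
have -> : y s = expR (k * s) * (z.2 * (S + S^-1) * (E s * q s)) by rewrite /y; ring.
apply: ler_wpM2l; first exact: ltW T_gt0.
by rewrite ler_peMl ?(ltW p0) // -expR0 ler_expR mulr_ge0 // k_ge0.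
Qed.

Lemma hyp_dist_le : (hyp_dist z w <= (3 * ln S + ln (w.2 / z.2))%:E)%E.
Proof.
apply: (@le_trans _ _ (hyp_length x y)).
  apply: ereal_inf_lbound; exists x; exists y; split; [exact: curve|exact: erefl].
apply: (@le_trans _ _ (\int[@lebesgue_measure R]_(s in `[0%R, 1%R]) cst (3 * T + k)%:E s)%E).
  apply: le_integral_ge0 => s /=; rewrite in_itv /= => /andP[s0 _].
    by rewrite lee_fin divr_ge0 ?sqrtr_ge0 // ltW // y_gt0.
  by rewrite lee_fin speed.
by rewrite integral_cst //= lebesgue_measure_itv /= lte01 oppr0 adde0 mule1.
Qed.
End upper_curve.

(** Along a curve from [z], let [u] be the displacement in coordinate [j].  By
Cauchy-Schwarz, the derivative of [ln (u ^+ 2 + y ^+ 2) / 2] is at most the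
Euclidean speed divided by [Num.sqrt (u ^+ 2 + y ^+ 2)], and [y] is at most this
root. *)
Lemma hyp_dist_ge (z w : point) j : 0 < z.2 ->
  (((ln ((w.1 ord0 j - z.1 ord0 j) ^+ 2 + w.2 ^+ 2) - ln (z.2 ^+ 2)) / 2)%:E <= hyp_dist z w)%E.
Proof.
move=> z0; apply: le_ereal_inf_tmp => _ [x [y [[[dx cx] [dy cy] y0 x0E x1E] ->]]].
pose u s := x s ord0 j - z.1 ord0 j.
have y_gt0 s : 0 <= s <= 1 -> 0 < y s by move=> s01; apply: y0; rewrite in_itv.
have du (s : R) : is_derive s (1 : R) u (derive1 x s ord0 j).
  have dxj : derivable (fun t => x t ord0 j) s 1 by exact: (proj1 (derivable_mxP x s 1) (dx s) ord0 j).
  have : is_derive s (1 : R) (fun t => x t ord0 j) (derive1 x s ord0 j).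
    by apply: DeriveDef => //; rewrite derive1E derive_mx // mxE.
  by move=> ?; apply: is_derive_eq; rewrite subr0.
have dY (s : R) : is_derive s (1 : R) y (derive1 y s) by rewrite derive1E; apply: derivableP.
pose G s := u s ^+ 2 + y s ^+ 2.
pose F s := ln (G s) / 2.
pose f s := (u s * derive1 x s ord0 j + y s * derive1 y s) / G s.
have G0 s : 0 <= s <= 1 -> 0 < G s.
  by move=> /y_gt0 ys; rewrite ltr_wpDl ?sqr_ge0 // exprn_gt0.
have dG (s : R) : is_derive s (1 : R) G (2 * (u s * derive1 x s ord0 j + y s * derive1 y s)).
  have := du s => ?; have := dY s => ?.
  by apply: is_derive_eq; rewrite /GRing.scale /=; ring.
have dF (s : R) : 0 <= s <= 1 -> is_derive s (1 : R) F (f s).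
  move=> /G0 Gs; have := is_derive1_ln Gs => ?; have := dG s => ?.
  have -> : F = (fun s => 2^-1 * s) \o (@ln R \o G) by apply/funext => t; rewrite /F /= mulrC.
  by apply: is_derive_eq; rewrite /GRing.scale /= /f; field; rewrite gt_eqF.
have cu : continuous u.
  by move=> s; apply/differentiable_continuous/derivable1_diffP; have [] := du s.
have cY : continuous y.
  by move=> s; apply/differentiable_continuous/derivable1_diffP; have [] := dY s.
have cxj : continuous (fun s => derive1 x s ord0 j).
  move=> s; apply: (@cvg_comp _ _ _ (derive1 x) (fun M : 'rV[R]_d => M ord0 j) _ (nbhs (derive1 x s)) _ (cx s)).
  exact: coord_continuous.
have cf : {within `[0, 1], continuous f}.
  apply: continuous_in_subspaceT => s /set_mem /=; rewrite in_itv /= => s01.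
  have cG : G t @[t --> s] --> G s by apply: cvgD; [exact: (cvgM (cu s) (cu s))|exact: (cvgM (cY s) (cY s))].
  apply: cvgM; first by apply: cvgD; [exact: (cvgM (cu s) (cxj s))|exact: (cvgM (cY s) (cy s))].
  by apply: cvgV => //; rewrite gt_eqF // G0.
have FTC : (\int[@lebesgue_measure R]_(s in `[0%R, 1%R]) (f s)%:E = (F 1)%:E - (F 0)%:E)%E.
  apply: continuous_FTC2 => //.
  - have cF (s : R) : 0 <= s <= 1 -> F t @[t --> s] --> F s.
      by move=> /dF [dFs _]; apply/differentiable_continuous/derivable1_diffP.
    split; last 2 first.
    + by apply: cvg_at_right_filter; apply: cF; rewrite lexx ler01.
    + by apply: cvg_at_left_filter; apply: cF; rewrite lexx ler01.
    move=> s; rewrite in_itv /= => /andP[s0 s1].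
    by have [] := dF s; rewrite ?ltW.
  - move=> s; rewrite in_itv /= => /andP[s0 s1]; rewrite derive1E.
    have := dF s; rewrite !ltW // => /(_ isT) ?; exact: derive_val.
have -> : ((ln ((w.1 ord0 j - z.1 ord0 j) ^+ 2 + w.2 ^+ 2) - ln (z.2 ^+ 2)) / 2)%:E = ((F 1)%:E - (F 0)%:E)%E.
  rewrite -EFinB /F /G /u; congr EFin; rewrite -x1E -x0E /=.
  by rewrite subrr expr0n /= add0r; ring.
rewrite -FTC.
rewrite integralE; apply: le_trans (geeDl _ _) _.
  by rewrite oppe_le0 integral_ge0.
apply: le_integral_ge0 => s /=; first by rewrite funeposE le_max lexx orbT.
rewrite in_itv /= => s01; have Gs := G0 _ s01; have ys := y_gt0 _ s01.
set V := Num.sqrt _; have V0 : 0 <= V by exact: sqrtr_ge0.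
rewrite funeposE ge_max !lee_fin; apply/andP; split; last by rewrite divr_ge0 // ltW.
rewrite /f ler_pdivrMr // mulrAC ler_pdivlMr //.
set Nn := _ + _; apply: (le_trans (ler_norm _)).
rewrite -ler_sqr ?nnegrE ?normr_ge0 ?(mulr_ge0 V0) ?(ltW Gs) // real_normK ?num_real //.
have aV : (derive1 x s ord0 j) ^+ 2 + (derive1 y s) ^+ 2 <= V ^+ 2.
  rewrite sqr_sqrtr ?addr_ge0 ?sqr_ge0 // lerD2r -real_normK ?num_real //.
  by rewrite lerXn2r ?nnegrE ?eucl_norm_ge0 ?eucl_norm_coord.
have NG : Nn ^+ 2 <= G s * V ^+ 2.
  apply: le_trans (ler_wpM2l (ltW Gs) aV).
  rewrite -subr_ge0 /Nn /G.
  rewrite (_ : _ - _ = (u s * derive1 y s - y s * derive1 x s ord0 j) ^+ 2) ?sqr_ge0 //; ring.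
have yG : y s ^+ 2 <= G s by rewrite lerDr sqr_ge0.
rewrite [leLHS](_ : _ = Nn ^+ 2 * y s ^+ 2); last by ring.
rewrite [leRHS](_ : _ = (G s * V ^+ 2) * G s); last by ring.
by apply: ler_pM => //; exact: sqr_ge0.
Qed.
(** [hyp_dist_ge] bounds the distance of [v] from below and [hyp_dist_le] that of
[w] from above; exponentiating removes the logarithms. *)
Lemma closer_bound (z w v : point) (S : R) j : 0 < z.2 -> z.2 <= w.2 -> 1 < S ->
  eucl_norm (w.1 - z.1) <= z.2 * ((S - S^-1) / 2) -> 0 < v.2 ->
  (hyp_dist z v <= hyp_dist z w)%E ->
  (v.1 ord0 j - z.1 ord0 j) ^+ 2 + v.2 ^+ 2 <= (S ^+ 3 * w.2) ^+ 2.
Proof.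
move=> z0 zw S1 dist_w v0 vw; have w0 : 0 < w.2 by exact: lt_le_trans zw.
have S0 : 0 < S by exact: lt_trans S1.
have G0 : 0 < (v.1 ord0 j - z.1 ord0 j) ^+ 2 + v.2 ^+ 2 by rewrite ltr_wpDl ?sqr_ge0 // exprn_gt0.
have := le_trans (hyp_dist_ge v j z0) (le_trans vw (hyp_dist_le z0 zw S1 dist_w)).
rewrite lee_fin ler_pdivrMr // lerBlDr => H.
rewrite -ler_ln ?posrE ?exprn_gt0 ?mulr_gt0 ?exprn_gt0 //; apply: le_trans H _.
rewrite ln_div ?posrE // !lnXn ?mulr_gt0 ?exprn_gt0 // lnM ?posrE ?exprn_gt0 // lnXn //.
by rewrite [leLHS](_ : _ = (ln S *+ 3 + ln w.2) *+ 2) //; ring.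
Qed.

End hyp_dist_bounds.

(** * Counts of a Poisson process *)
Section poisson_counts.
Context {R : realType} {d : nat} {disp : measure_display} {Omega : measurableType disp}.
Variables (lambda : R) (P : probability Omega R) (N : {mfun Omega >-> config R d}).
Hypothesis lambda0 : 0 < lambda.
Hypothesis PN : poisson_process lambda P N.
Local Notation point := ('rV[R]_d * R)%type.

(** Boxes at positive height are relatively compact in the half-space, so that
such sets have finite volume and contain finitely many points. *)
Definition box_bounded (A : set point) := measurable A /\
  exists a r u v, 0 < u /\ A `<=` cube a r `*` `[u, v[%classic.

Lemma box_bounded_half_space A : box_bounded A -> A `<=` @half_space R d.
Proof. by move=> [_ [a [r [u [v [u0 AB]]]]]] z /AB /(box_half_space u0). Qed.

Lemma box_boundedI A B : box_bounded A -> measurable B -> box_bounded (A `&` B).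
Proof.
move=> [mA [a [r [u [v [u0 AB]]]]]] mB; split; first exact: measurableI.
by exists a, r, u, v; split=> // z [/AB].
Qed.

Lemma box_boundedD A B : box_bounded A -> measurable B -> box_bounded (A `\` B).
Proof. by move=> hA mB; rewrite setDE; apply: box_boundedI => //; exact: measurableC. Qed.

Lemma box_bounded_box (a : 'rV[R]_d) (r u v : R) : 0 < u -> box_bounded (cube a r `*` `[u, v[%classic).
Proof. by move=> u0; split; [exact: measurable_box|exists a, r, u, v; split]. Qed.

Lemma box_bounded_finite A (eta : config R d) : box_bounded A -> finite_set (eta `&` A).
Proof.
move=> [_ [a [r [u [v [u0 AB]]]]]].
pose K : set point := [set x : 'rV[R]_d | forall j, `[a ord0 j, a ord0 j + r]%classic (x ord0 j)]
  `*` `[u, v]%classic.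
apply: (@sub_finite_set _ _ (eta `&` K)).
  move=> z [ez /AB [Cz Iz]]; split=> //; split=> [j|] /=.
    by have := Cz j; rewrite in_itv /= => /andP[-> /ltW ->].
  by move: Iz; rewrite /= !in_itv /= => /andP[-> /ltW ->].
apply: pts_locally_finite.
  apply: compact_setX; last exact: segment_compact.
  by apply: (@rV_compact R d (fun j => `[a ord0 j, a ord0 j + r]%classic)) => j; exact: segment_compact.
move=> z [_ /=]; rewrite in_itv /= => /andP[uz _]; exact: lt_le_trans uz.
Qed.

Lemma box_bounded_volume A : box_bounded A -> (hyp_measure A < +oo)%E.
Proof.
move=> [mA [a [r [u [v [u0 AB]]]]]].
pose r' := Num.max r 0; pose v' := Num.max v u.
have r0 : 0 <= r' by rewrite le_max lexx orbT.
have uv : u <= v' by rewrite le_max lexx orbT.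
apply: le_lt_trans (ltry (r' ^+ d * (v' - u) / u ^+ d.+1)).
apply: le_trans (hyp_box_le a r0 u0 uv).
have mB := measurable_box a r' u v'.
apply: le_measure; [exact: mem_set|exact: mem_set|].
move=> z /AB [Cz /= Iz]; split=> [j|/=].
  have /andP[-> /= lt2] := Cz j; apply: (lt_le_trans lt2).
  by rewrite lerD2l le_max lexx.
by move: Iz; rewrite !in_itv /= => /andP[-> /= lt2]; rewrite lt_max lt2.
Qed.

Definition npts (A : set point) (w : Omega) : nat := #|` fset_set (pts (N w) `&` A) |.

Lemma count_inE A w : box_bounded A -> count_in A (N w) = (npts A w)%:R%:E.
Proof. by move=> /(box_bounded_finite (N w)) ?; rewrite /count_in /counting asboolT. Qed.

Lemma measurable_count_in A : measurable A -> A `<=` @half_space R d ->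
  measurable_fun setT (fun w => count_in A (N w)).
Proof.
move=> mA AH; apply: (@measurableT_comp _ _ _ _ _ _ (count_in A) _ N) => //.
move=> _ Y mY; rewrite setTI; apply: sub_sigma_algebra; exists A => //.
by exists Y => //; rewrite setTI.
Qed.

Lemma npts_eqE A k : box_bounded A ->
  [set w | npts A w = k] = [set w | count_in A (N w) = k%:R%:E].
Proof.
move=> hA; apply/seteqP; split=> w /=; rewrite count_inE //; first by move=> ->.
by move=> [] /eqP; rewrite eqr_nat => /eqP.
Qed.

Lemma measurable_npts_eq A k : box_bounded A -> measurable [set w | npts A w = k].
Proof.
move=> hA; rewrite npts_eqE //.
have -> : [set w | count_in A (N w) = k%:R%:E] = (fun w => count_in A (N w)) @^-1` [set k%:R%:E] by [].
rewrite -[X in measurable X]setTI; apply: measurable_count_in => //; first exact: hA.1.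
exact: box_bounded_half_space.
Qed.

Lemma measurable_npts A : box_bounded A -> measurable_fun setT (npts A).
Proof.
move=> hA _ Y _; rewrite setTI.
have -> : npts A @^-1` Y = \bigcup_(k in Y) [set w | npts A w = k].
  apply/seteqP; split=> [w Yw|w [k Yk E]]; first by exists (npts A w).
  by rewrite /preimage /= E.
by apply: bigcup_measurable => k _; exact: measurable_npts_eq.
Qed.

Lemma measurable_fun_npts A (f : nat -> R) : box_bounded A ->
  measurable_fun setT (fun w => f (npts A w)).
Proof. by move=> hA; apply: (measurableT_comp _ (measurable_npts hA)). Qed.

(** By [prob_npts], the parameter of the Poisson law of the number of points in [A]. *)
Definition vol (A : set point) : R := lambda * fine (hyp_measure A).

Lemma vol_ge0 A : 0 <= vol A.
Proof. by rewrite mulr_ge0 ?(ltW lambda0) // fine_ge0. Qed.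

Definition pois (m : R) (k : nat) : R := m ^+ k / k`!%:R * expR (- m).

Lemma pois_ge0 (m : R) k : 0 <= m -> 0 <= pois m k.
Proof. by move=> m0; rewrite /pois !mulr_ge0 ?exprn_ge0 ?invr_ge0 ?expR_ge0. Qed.

Lemma poisson_probE (m : R) k : 0 <= m -> poisson_prob m 0 [set k] = (pois m k)%:E.
Proof.
rewrite le_eqVlt => /predU1P[<-|m0]; rewrite /poisson_prob /pois.
  rewrite ltxx oppr0 expR0 mulr1 diracE.
  case: k => [|k]; first by rewrite mem_set //= expr0 fact0 divr1.
  by rewrite memNset //= expr0n /= mul0r.
by rewrite m0 esum_set1 ?lee_fin /poisson_pmf ?m0 // -/(pois m k) pois_ge0 // ltW.
Qed.

Lemma sum_pois (m : R) : 0 <= m -> (\sum_(0 <= k <oo) (pois m k)%:E = 1)%E.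
Proof.
rewrite le_eqVlt => /predU1P[<-|m0].
  rewrite nneseries_recl // => [|k _]; last by rewrite lee_fin pois_ge0.
  rewrite eseries0 ?adde0 => [|[|k] // _ _].
    by rewrite /pois expr0 fact0 divr1 mul1r oppr0 expR0.
  by rewrite /pois expr0n /= !mul0r.
transitivity (poisson_prob m 0 setT : \bar R); last exact: probability_setT.
rewrite /poisson_prob m0 -nneseries_esumT => [|k]; last by rewrite lee_fin poisson_pmf_ge0.
by apply: eq_eseriesr => k _; rewrite /poisson_pmf m0.
Qed.

Lemma prob_npts A k : box_bounded A -> P [set w | npts A w = k] = (pois (vol A) k)%:E.
Proof.
move=> hA; rewrite -poisson_probE ?vol_ge0 //.
have AH := box_bounded_half_space hA.
rewrite /vol hyp_measureE // -(PN.1 A k hA.1 AH); last first.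
  by rewrite -hyp_measureE //; exact: box_bounded_volume.
by rewrite npts_eqE.
Qed.

Let ind (k : nat) : nat -> R := fun j => (j == k)%:R.

Lemma sum_ind (f : nat -> R) (j : nat) : (forall k, 0 <= f k) ->
  ((f j)%:E = \sum_(0 <= k <oo) (f k * (j == k)%:R)%:E)%E.
Proof.
move=> f0; rewrite (@nneseriesD1 _ _ j) //=; last by move=> k; rewrite lee_fin mulr_ge0.
by rewrite eqxx mulr1 eseries0 ?adde0 // => k _ kj; rewrite eq_sym (negbTE kj) mulr0.
Qed.

Lemma expect_ind A k : box_bounded A ->
  (\int[P]_w ((npts A w == k)%:R)%:E = P [set w | npts A w = k])%E.
Proof.
move=> hA; have mA := measurable_npts_eq k hA.
transitivity (\int[P]_w (\1_[set w | npts A w = k] w)%:E)%E.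
  apply: eq_integral => w _; rewrite indicE; congr (_%:R%:E).
  by congr nat_of_bool; apply/eqP/idP => [E|/set_mem //]; exact: mem_set.
by rewrite integral_indic // setIT.
Qed.

Lemma expect_npts A (f : nat -> R) : box_bounded A -> (forall k, 0 <= f k) ->
  (\int[P]_w (f (npts A w))%:E = \sum_(0 <= k <oo) (f k * pois (vol A) k)%:E)%E.
Proof.
move=> hA f0.
under eq_integral do rewrite (sum_ind _ f0).
rewrite integral_nneseries //; last 2 first.
- move=> k; apply/measurable_EFinP; exact: (measurable_fun_npts (fun j => f k * (j == k)%:R)).
- by move=> k w _; rewrite lee_fin mulr_ge0.
apply: eq_eseriesr => k _.
under eq_integral do rewrite EFinM.
rewrite ge0_integralZl ?lee_fin //; last first.
  by apply/measurable_EFinP; exact: (measurable_fun_npts (fun j => (j == k)%:R)).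
by rewrite EFinM -prob_npts // expect_ind.
Qed.

Section independence.
Variables (n : nat) (A : 'I_n -> set point).
Hypotheses (hA : forall i, box_bounded (A i)) (tA : trivIset setT A).

Let factor (f : 'I_n -> nat -> R) :=
  (\int[P]_w (\prod_i f i (npts (A i) w))%:E = \prod_i \int[P]_w (f i (npts (A i) w))%:E)%E.

Let fin_f i (f : nat -> R) := (\int[P]_w (f (npts (A i) w))%:E)%E \is a fin_num.

Let mprod (f : 'I_n -> nat -> R) : measurable_fun setT (fun w => \prod_i f i (npts (A i) w)).
Proof. by apply: measurable_prod => i _; exact: measurable_fun_npts. Qed.

Let factor_ind (k : 'I_n -> nat) : factor (fun i => ind (k i)).
Proof.
have E i : (\int[P]_w (ind (k i) (npts (A i) w))%:E = P [set w | npts (A i) w = k i])%E.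
  exact: expect_ind.
rewrite /factor (eq_bigr _ (fun i _ => E i)).
have HE i : [set w | npts (A i) w = k i] = [set w | count_in (A i) (N w) = (k i)%:R%:E].
  exact: npts_eqE.
under [RHS]eq_bigr do rewrite HE.
rewrite -PN.2 //; last first.
  move=> i; split; [exact: (hA i).1|exact: box_bounded_half_space|].
  rewrite -hyp_measureE; first exact: box_bounded_volume.
  exact: box_bounded_half_space.
have mB : measurable (\bigcap_i [set w | count_in (A i) (N w) = (k i)%:R%:E]).
  by apply: fin_bigcap_measurable => // i _; rewrite -HE; exact: measurable_npts_eq.
transitivity (\int[P]_w (\1_(\bigcap_i [set w | count_in (A i) (N w) = (k i)%:R%:E]) w)%:E)%E; last first.
  by rewrite integral_indic // setIT.
apply: eq_integral => w _; rewrite indicE /=; congr (_%:E).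
case: (boolP (w \in _)) => [/set_mem H|/negP H].
  rewrite big1 // => i _; have := H i I; rewrite -HE /= /ind => ->.
  by rewrite eqxx.
have /existsP [i /negbTE Hi] : [exists i, npts (A i) w != k i].
  apply/contraT; rewrite negb_exists => /forallP K; case: H; apply/mem_set => i _.
  by rewrite -HE /=; apply/eqP; have := K i; rewrite negbK.
by rewrite (bigD1 i) //= /ind Hi mul0r.
Qed.

Let upd (f : 'I_n -> nat -> R) j k : 'I_n -> nat -> R := fun i => if i == j then ind k else f i.

Let factor_step f j : (forall i k, 0 <= f i k) -> (forall i, fin_f i (f i)) ->
  (forall k, factor (upd f j k)) -> factor f.
Proof.
move=> f0 ff H; rewrite /factor.
have c0 : (0 <= \prod_(i | i != j) \int[P]_w (f i (npts (A i) w))%:E)%E.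
  by apply: prode_ge0 => i _; apply: integral_ge0 => w _; rewrite lee_fin.
have cfin : (\prod_(i | i != j) \int[P]_w (f i (npts (A i) w))%:E)%E \is a fin_num.
  by apply: prode_fin_num => i _; exact: ff.
transitivity (\sum_(0 <= k <oo) \int[P]_w (f j k * \prod_i upd f j k i (npts (A i) w))%:E)%E.
  rewrite -integral_nneseries //; last 2 first.
  - move=> k; apply/measurable_EFinP; apply: measurable_funM => //; exact: mprod.
  - move=> k w _; rewrite lee_fin mulr_ge0 // prodr_ge0 // => i _.
    by rewrite /upd; case: ifP => // _; rewrite /ind.
  apply: eq_integral => w _; rewrite (bigD1 j) //= EFinM (sum_ind _ (f0 j)) //.
  rewrite muleC -nneseriesZl => [|k _]; last by rewrite lee_fin mulr_ge0.
  apply: eq_eseriesr => k _; rewrite -EFinM; congr EFin.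
  rewrite [in RHS](bigD1 j) //= {1}/upd eqxx /ind mulrC -mulrA; congr (_ * (_ * _)).
  by apply: eq_bigr => i /negbTE ij; rewrite /upd ij.
rewrite [RHS](bigD1 j) //= muleC -(fineK cfin).
rewrite (expect_npts (hA j) (f0 j)) -nneseriesZl => [|k _]; last first.
  by rewrite lee_fin mulr_ge0 // pois_ge0 // vol_ge0.
apply: eq_eseriesr => k _.
under eq_integral do rewrite EFinM.
rewrite ge0_integralZl ?lee_fin //; last 2 first.
- by apply/measurable_EFinP; exact: mprod.
- move=> w _; rewrite lee_fin prodr_ge0 // => i _.
  by rewrite /upd; case: ifP => // _; rewrite /ind.
rewrite H (bigD1 j) //= {1}/upd eqxx.
have -> : (\int[P]_w (ind k (npts (A j) w))%:E = (pois (vol (A j)) k)%:E)%E.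
  by rewrite -prob_npts // expect_ind.
rewrite fineK // muleA muleC EFinM; congr (_ * _)%E.
by apply: eq_bigr => i /negbTE ij; rewrite /upd ij.
Qed.

(** The process is given by the joint laws of the events that the counts take
prescribed values; replacing one function at a time by the series of its values
times indicators extends independence to functions of the counts. *)
Lemma indep_npts f : (forall i k, 0 <= f i k) -> (forall i, fin_f i (f i)) -> factor f.
Proof.
move=> f0 ff.
suff H m : forall f, (forall i k, 0 <= f i k) -> (forall i, fin_f i (f i)) ->
    (forall i : 'I_n, (m <= i)%N -> exists k, f i = ind k) -> factor f.
  by apply: (H n) => // i; rewrite leqNgt ltn_ord.
elim: m => {f f0 ff} [|m IH] f f0 ff fi.
  have /choice[k fk] : forall i, exists k, f i = ind k by move=> i; exact: fi.
  have -> : f = (fun i => ind (k i)) by apply/funext => i; exact: fk.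
  exact: factor_ind.
have [nm|mn] := leqP n m.
  apply: IH => // i mi; have := leq_trans nm mi; by rewrite leqNgt ltn_ord.
apply: (@factor_step f (Ordinal mn)) => // k; apply: IH.
- by move=> i j; rewrite /upd; case: ifP => // _; rewrite /ind.
- move=> i; rewrite /upd; case: ifP => // _; rewrite /fin_f.
  rewrite expect_npts //.
  rewrite ge0_fin_numE; last by apply: nneseries_ge0 => j _ _; rewrite lee_fin mulr_ge0 ?pois_ge0 ?vol_ge0 // /ind.
  apply: le_lt_trans (ltry 1); rewrite -(sum_pois (vol_ge0 (A i))).
  apply: lee_nneseries => [j _ _|j _]; first by rewrite lee_fin mulr_ge0 ?pois_ge0 ?vol_ge0 // /ind.
  by rewrite lee_fin ler_piMl ?pois_ge0 ?vol_ge0 // /ind; case: eqP.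
move=> i; rewrite leq_eqVlt => /predU1P[mi|mi].
  by exists k; rewrite /upd ifT //; apply/eqP/val_inj.
have [k' E] := fi i mi; exists k'; rewrite /upd ifF // -val_eqE /=.
by rewrite gtn_eqF.
Qed.

End independence.

(** The generating function of the Poisson law. *)
Lemma expect_exp_npts A (u : R) : box_bounded A -> 0 <= u ->
  (\int[P]_w (u ^+ npts A w)%:E = (expR (vol A * (u - 1)))%:E)%E.
Proof.
move=> hA u0; rewrite (expect_npts (f := fun k => u ^+ k)) // => [|k]; last exact: exprn_ge0.
move: (vol A) (vol_ge0 A) => m v0.
transitivity (\sum_(0 <= k <oo) ((expR (m * (u - 1)))%:E * (pois (m * u) k)%:E))%E.
  apply: eq_eseriesr => k _; rewrite -EFinM; congr EFin; rewrite /pois exprMn.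
  rewrite (_ : expR (- m) = expR (m * (u - 1)) * expR (- (m * u))); last first.
    by rewrite -expRD; congr expR; ring.
  by field; rewrite pnatr_eq0 -lt0n fact_gt0.
rewrite nneseriesZl => [|k _]; last by rewrite lee_fin pois_ge0 // mulr_ge0.
by rewrite sum_pois ?mulr_ge0 // mule1.
Qed.

Lemma expect_mul_exp_npts A (u : R) : box_bounded A -> 0 <= u ->
  (\int[P]_w ((npts A w)%:R * u ^+ npts A w)%:E = (vol A * u * expR (vol A * (u - 1)))%:E)%E.
Proof.
move=> hA u0; rewrite (expect_npts (f := fun k => k%:R * u ^+ k)) // => [|k]; last first.
  by rewrite mulr_ge0 // exprn_ge0.
move mE : (vol A) (vol_ge0 A) => m v0.
rewrite nneseries_recl // => [|k _]; last by rewrite lee_fin !mulr_ge0 ?exprn_ge0 ?pois_ge0.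
rewrite !mul0r add0e.
transitivity (\sum_(0 <= k <oo) ((m * u)%:E * (u ^+ k * pois m k)%:E))%E; last first.
  rewrite nneseriesZl => [|k _]; last by rewrite lee_fin mulr_ge0 ?exprn_ge0 ?pois_ge0.
  rewrite -mE -(expect_npts (f := fun k => u ^+ k)) ?expect_exp_npts // => k; exact: exprn_ge0.
rewrite -(nneseries_addn 1) => [|k]; last by rewrite lee_fin !mulr_ge0 ?exprn_ge0 ?pois_ge0.
apply: eq_eseriesr => k _; rewrite -EFinM; congr EFin; rewrite addn1 /pois.
rewrite factS natrM exprS [m ^+ _]exprS; field.
by rewrite pnatr_eq0 -lt0n fact_gt0 /= addrC natr1 pnatr_eq0.
Qed.

End poisson_counts.

(** * Pairs of Poisson points that cross height 1 *)
Lemma card_fset_setI (T : choiceType) (R : realType) (S A : set T) : finite_set S ->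
  (\sum_(z <- fset_set S) \1_A z = #|` fset_set (S `&` A) |%:R :> R).
Proof.
move=> fS; have fSA : finite_set (S `&` A) by apply: sub_finite_set fS => z [].
rewrite -sum1_size natr_sum [RHS](perm_big [seq z <- fset_set S | z \in A]) /=.
  by rewrite big_filter [RHS]big_mkcond; apply: eq_bigr => z _; rewrite indicE; case: ifP.
apply: uniq_perm; [exact: fset_uniq|by rewrite filter_uniq // fset_uniq|].
move=> z; rewrite mem_filter !in_fset_set // in_setI andbC //.
Qed.

Lemma cvg_sum_seq (R : realType) (I : Type) (s : seq I) (f : I -> nat -> R) (l : I -> R) :
  (forall i, f i n @[n --> \oo] --> l i) ->
  (\sum_(i <- s) f i n) @[n --> \oo] --> \sum_(i <- s) l i.
Proof.
move=> fl; elim: s => [|i s IH].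
  by rewrite big_nil; under eq_fun do rewrite big_nil; exact: cvg_cst.
by rewrite big_cons; under eq_fun do rewrite big_cons; exact: cvgD.
Qed.

Section pairs.
Context {R : realType} {d : nat} {disp : measure_display} {Omega : measurableType disp}.
Variables (lambda : R) (P : probability Omega R) (N : {mfun Omega >-> config R d}).
Hypothesis lambda0 : 0 < lambda.
Hypothesis PN : poisson_process lambda P N.
Local Notation point := ('rV[R]_d * R)%type.
Local Notation pt := ('rV[R]_d * measurableTypeR R)%type.
Local Notation nb := (npts N).
Local Notation mean := (@vol R d lambda).

Lemma nptsID A D w : box_bounded A -> measurable D ->
  nb A w = (nb (A `&` D) w + nb (A `\` D) w)%N.
Proof.
move=> hA mD; apply/eqP; rewrite -(eqr_nat R) natrD.
have fA := box_bounded_finite (N w) hA.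
have E B : (nb (A `&` B) w)%:R = \sum_(z <- fset_set (pts (N w) `&` A)) \1_B z :> R.
  by rewrite card_fset_setI // /npts setIA.
rewrite -[in X in X == _](setIT A) setDE !E -big_split /=; apply/eqP.
apply: eq_bigr => z _; rewrite !indicE in_setT in_setC.
by case: (z \in D); rewrite ?addr0 ?add0r.
Qed.

Lemma volID A D : box_bounded A -> measurable D -> mean A = mean (A `&` D) + mean (A `\` D).
Proof.
move=> hA mD; rewrite /vol -mulrDr; congr (_ * _).
have f1 := box_bounded_volume (box_boundedI hA mD).
have f2 := box_bounded_volume (box_boundedD hA mD).
rewrite -fineD ?ge0_fin_numE //; congr fine.
by rewrite addeC -measureDI //; exact: hA.1.
Qed.

Variables (O1 O2 D : set point).
Hypotheses (hO1 : box_bounded O1) (hO2 : box_bounded O2) (hD : box_bounded D).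
Hypothesis O12 : O1 `&` O2 = set0.

Definition pairs (C : set (pt * pt)) (w : Omega) : R :=
  \sum_(z <- fset_set (pts (N w) `&` O1)) \sum_(z' <- fset_set (pts (N w) `&` O2)) \1_C (z, z').

Lemma pairs_ge0 C w : 0 <= pairs C w.
Proof. by apply: sumr_ge0 => z _; apply: sumr_ge0 => z' _. Qed.

Lemma pairsX (A A' : set point) w :
  pairs (A `*` A') w = (nb (O1 `&` A) w)%:R * (nb (O2 `&` A') w)%:R.
Proof.
have f1 := box_bounded_finite (N w) hO1; have f2 := box_bounded_finite (N w) hO2.
rewrite /npts !setIA -!card_fset_setI // mulr_suml; apply: eq_bigr => z _.
rewrite mulr_sumr; apply: eq_bigr => z' _; rewrite -natrM mulnb; congr (nat_of_bool _)%:R.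
by apply/idP/andP => [/set_mem[/= Az A'z]|[/set_mem Az /set_mem A'z]]; [split; exact/mem_set|exact/mem_set].
Qed.

(** For a product set this is a product of counts by [pairsX]; the general case
follows by a lambda-system argument. *)
Lemma measurable_pairs C : measurable C -> measurable_fun setT (pairs C).
Proof.
pose H := [set C : set (pt * pt) | measurable C /\ measurable_fun setT (pairs C)].
pose G := [set C : set (pt * pt) | exists A, measurable A /\ exists B, measurable B /\ C = A `*` B].
have GH : G `<=` H.
  move=> _ [A [mA [B [mB ->]]]]; split; first exact: measurableX.
  have -> : pairs (A `*` B) = (fun w => (nb (O1 `&` A) w)%:R * (nb (O2 `&` B) w)%:R).
    by apply/funext => w; rewrite pairsX.
  apply: measurable_funM.
    exact: (measurable_fun_npts N (fun n => n%:R) (box_boundedI hO1 mA)).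
  exact: (measurable_fun_npts N (fun n => n%:R) (box_boundedI hO2 mB)).
have lH : lambda_system setT H.
  split.
  - by [].
  - apply: GH; exists setT; split; first exact: measurableT.
    by exists setT; split; [exact: measurableT|rewrite setXTT].
  - move=> A B BA [mA fA] [mB fB]; split; first exact: measurableD.
    have -> : pairs (A `\` B) = (fun w => pairs A w - pairs B w).
      apply/funext => w; rewrite /pairs -sumrB; apply: eq_bigr => z _.
      rewrite -sumrB; apply: eq_bigr => z' _; rewrite !indicE.
      rewrite in_setD; case: (boolP (_ \in B)) => [/set_mem /BA /mem_set ->|_].
        by rewrite andbF subrr.
      by rewrite andbT subr0.
    exact: measurable_funB.
  - move=> F ndF FH; split; first by apply: bigcup_measurable => k _; exact: (FH k).1.
    apply: (@measurable_fun_cvg _ _ _ _ (fun k => pairs (F k))) => //.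
      by move=> k; exact: (FH k).2.
    move=> w _; rewrite /pairs.
    apply: cvg_sum_seq => z; apply: cvg_sum_seq => z'.
    apply: (@cvg_near_cst _ _ _ _ _ _).
    have [[k _ Fk]|nF] := pselect ((\bigcup_k F k) (z, z')).
      exists k => // m /= km; rewrite !indicE !mem_set //; first by exists k.
      by move: Fk; exact/subsetPset/ndF.
    exists 0%N => // m _; rewrite !indicE !memNset // => Fm; apply: nF; exists m => //.
move=> mC; suff : H C by case.
have GI : setI_closed G.
  move=> _ _ [X1 [mX1 [X2 [mX2 ->]]]] [Y1 [mY1 [Y2 [mY2 ->]]]].
  rewrite -setXI; exists (X1 `&` Y1); split; first exact: measurableI.
  by exists (X2 `&` Y2); split => //; exact: measurableI.
apply: (lambda_system_subset GI lH GH) => //.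
move: mC; rewrite measurable_prod_measurableType.
rewrite (_ : [set _ `*` _ | _ in _ & _ in _] = G) // predeqE.
split => [[A mA [B mB <-]]|[A [mA [B [mB ->]]]]].
  by exists A; split => //; exists B.
by exists A => //; exists B.
Qed.

Variable u : R.
Hypothesis u0 : 0 <= u.

(** With [u = 1] this is the second factorial moment measure of the process,
restricted to the disjoint sets [O1] and [O2].  The factor [u ^+ npts D]
describes the event that [D] is empty for [u = 0], and exponential moments of its
number of points for [u > 1]. *)
Definition pair_measure (C : set (pt * pt)) : \bar R :=
  (\int[P]_w (pairs C w * u ^+ nb D w)%:E)%E.

Let mY : measurable_fun setT (fun w => u ^+ nb D w).
Proof. exact: (measurable_fun_npts N (fun n => u ^+ n) hD). Qed.

Lemma pair_measureP : is_measure pair_measure.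
Proof.
split.
- rewrite /pair_measure; under eq_integral => w _.
    rewrite (_ : pairs set0 w = 0); last first.
      by apply: big1 => z _; apply: big1 => z' _; rewrite indic0.
    rewrite mul0r; over.
  by rewrite integral0.
- by move=> C; apply: integral_ge0 => w _; rewrite lee_fin mulr_ge0 ?pairs_ge0 ?exprn_ge0.
move=> F mF tF mUF.
rewrite [X in _ --> X](_ : _ = \sum_(n <oo) pair_measure (F n))%E.
  apply/cvg_closeP; split; last by rewrite closeE.
  by apply: is_cvg_nneseries => n _ _; apply: integral_ge0 => w _; rewrite lee_fin mulr_ge0 ?pairs_ge0 ?exprn_ge0.
rewrite /pair_measure -integral_nneseries //; last 2 first.
- move=> n; apply/measurable_EFinP; apply: measurable_funM => //; exact: (measurable_pairs (mF n)).
- by move=> n w _; rewrite lee_fin mulr_ge0 ?pairs_ge0 ?exprn_ge0.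
apply: eq_integral => w _.
under eq_eseriesr => n _.
  rewrite /pairs mulr_suml -sumEFin.
  under eq_bigr do rewrite mulr_suml -sumEFin.
  over.
rewrite /pairs mulr_suml -sumEFin nneseries_sum; last first.
  by move=> z n _; apply: sume_ge0 => z' _; rewrite lee_fin mulr_ge0 // exprn_ge0.
apply: eq_bigr => z _; rewrite mulr_suml -sumEFin nneseries_sum; last first.
  by move=> z' n _; rewrite lee_fin mulr_ge0 // exprn_ge0.
apply: eq_bigr => z' _; under eq_eseriesr do rewrite EFinM muleC.
rewrite nneseriesZl => [|n _]; last by rewrite lee_fin.
rewrite EFinM muleC; congr (_ * _)%E.
rewrite -/(dirac _ _) /=.
have := @measure_semi_bigcup _ _ _ (\d_(z, z')) F mF tF mUF.
by move=> /(_ R) ->; apply: eq_eseriesr => n _.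
Qed.

Let pm : {measure set (pt * pt) -> \bar R} := pack_measure pair_measureP.

(** [O1], [O2] and [D] cut the space into five disjoint pieces with independent
counts; a factor [k * u ^+ k] has mean [u] times the volume, relative to the mean
of [u ^+ k], which explains the weight [u] inside [D]. *)
Lemma pair_measureX (A A' : set point) : measurable A -> measurable A' ->
  pair_measure (A `*` A') =
  (expR (mean D * (u - 1)) * (u * mean (O1 `&` A `&` D) + mean (O1 `&` A `\` D)) *
   (u * mean (O2 `&` A' `&` D) + mean (O2 `&` A' `\` D)))%:E.
Proof.
move=> mA mA'; set E1 := O1 `&` A; set E2 := O2 `&` A'.
have hE1 : box_bounded E1 by exact: box_boundedI.
have hE2 : box_bounded E2 by exact: box_boundedI.
pose S : 'I_5 -> set point := fun i => nth set0 [:: E1 `&` D; E1 `\` D; E2 `&` D; E2 `\` D; D `\` (E1 `|` E2)] i.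
have E12 : E1 `&` E2 = set0.
  by apply/seteqP; split=> // z [[z1 _] [z2 _]]; rewrite -O12.
have hS i : box_bounded (S i).
  have [mE1 mE2 mD] : [/\ measurable E1, measurable E2 & measurable D] by split; [exact: hE1.1|exact: hE2.1|exact: hD.1].
  case: i => -[|[|[|[|[|//]]]]] ? /=; [exact: box_boundedI|exact: box_boundedD|exact: box_boundedI|exact: box_boundedD|].
  by apply: box_boundedD => //; exact: measurableU.
have tS : trivIset setT S.
  have F z : E1 z -> E2 z -> False by move=> z1 z2; have : set0 z by rewrite -E12.
  move=> i j _ _ [z []]; have Fz := F z.
  case: i => -[|[|[|[|[|//]]]]] i5; case: j => -[|[|[|[|[|//]]]]] j5 /=;
    rewrite /S /= => zi zj; (try by apply/val_inj); exfalso; move: zi zj; rewrite /setI /setD /setU /=; tauto.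
pose f (b b' : bool) : 'I_5 -> nat -> R := fun i => nth (fun=> 0)
  [:: (fun k => if b then k%:R * u ^+ k else u ^+ k); (fun k => if b then 1 else k%:R);
      (fun k => if b' then k%:R * u ^+ k else u ^+ k); (fun k => if b' then 1 else k%:R);
      (fun k => u ^+ k)] i.
have f0 b b' i k : 0 <= f b b' i k.
  by case: i => -[|[|[|[|[|//]]]]] ? /=; rewrite /f /=; case: b; case: b' => //; rewrite ?mulr_ge0 ?exprn_ge0.
pose e (b b' : bool) : 'I_5 -> R := fun i => nth 0
  [:: (if b then mean (S i) * u * expR (mean (S i) * (u - 1)) else expR (mean (S i) * (u - 1)));
      (if b then 1 else mean (S i));
      (if b' then mean (S i) * u * expR (mean (S i) * (u - 1)) else expR (mean (S i) * (u - 1)));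
      (if b' then 1 else mean (S i)); expR (mean (S i) * (u - 1))] i.
have Ef b b' i : (\int[P]_w (f b b' i (nb (S i) w))%:E = (e b b' i)%:E)%E.
  have L1 : (\int[P]_w (1 : R)%:E = 1%:E)%E by rewrite (@integral_cst _ _ _ P) // mul1e; exact: probability_setT.
  have L2 X : box_bounded X -> (\int[P]_w ((nb X w)%:R)%:E = (mean X)%:E)%E.
    move=> hX; have := expect_mul_exp_npts lambda0 PN hX ler01.
    under eq_integral do rewrite expr1n mulr1; move=> ->.
    by rewrite subrr mulr0 expR0 !mulr1.
  have L3 X hX := @expect_exp_npts _ _ _ _ _ _ _ lambda0 PN X u hX u0.
  have L4 X hX := @expect_mul_exp_npts _ _ _ _ _ _ _ lambda0 PN X u hX u0.
  have {}hS := hS i.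
  by case: i hS => -[|[|[|[|[|//]]]]] ? hS; rewrite /f /e /=; case: b; case: b'; first [exact: L1|exact: L2|exact: L3|exact: L4].
have nD w : nb D w = (nb (E1 `&` D) w + nb (E2 `&` D) w + nb (D `\` (E1 `|` E2)) w)%N.
  have [mE1 mE2] : measurable E1 /\ measurable E2 by split; [exact: hE1.1|exact: hE2.1].
  rewrite (nptsID w hD mE1) (nptsID w (box_boundedD hD mE1) mE2) addnA; congr (nb _ w + nb _ w + nb _ w)%N.
  - exact: setIC.
  - apply/seteqP; split=> z; rewrite /setI /setD /=; first tauto.
    move=> [z2 zD]; split=> //; split=> // z1; have : set0 z by rewrite -E12.
    by [].
  - by rewrite setDDl.
transitivity (\int[P]_w (\sum_(b : bool) \sum_(b' : bool) (\prod_i f b b' i (nb (S i) w))%:E))%E.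
  apply: eq_integral => w _; rewrite pairsX -/E1 -/E2.
  rewrite (nptsID w hE1 hD.1) (nptsID w hE2 hD.1) nD.
  rewrite !big_bool /= !big_ord_recl !big_ord0 /f /S /= -!EFinD; congr EFin.
  rewrite !natrD !exprD.
  move: ((nb (E1 `&` D) w)%:R) (u ^+ nb (E1 `&` D) w) ((nb (E1 `\` D) w)%:R)
    ((nb (E2 `&` D) w)%:R) (u ^+ nb (E2 `&` D) w) ((nb (E2 `\` D) w)%:R)
    (u ^+ nb (D `\` (E1 `|` E2)) w) => x1 x2 x3 x4 x5 x6 x7.
  ring.
have mf b b' : measurable_fun setT (fun w => (\prod_i f b b' i (nb (S i) w))%:E).
  apply/measurable_EFinP; apply: measurable_prod => i _; exact: measurable_fun_npts.
have If b b' : (\int[P]_w (\prod_i f b b' i (nb (S i) w))%:E = (\prod_i e b b' i)%:E)%E.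
  rewrite (indep_npts lambda0 PN hS tS (f0 b b')) => [|i]; last by rewrite Ef.
  by rewrite -prodEFin; apply: eq_bigr => i _; rewrite Ef.
have pf0 b b' w : (0 <= (\prod_i f b b' i (nb (S i) w))%:E)%E by rewrite lee_fin prodr_ge0.
rewrite ge0_integral_sum //; last 2 first.
- by move=> b; apply: emeasurable_sum => b'.
- by move=> b w _; apply: sume_ge0 => b' _.
under eq_bigr => b _.
  rewrite ge0_integral_sum //; under eq_bigr do rewrite If.
  over.
rewrite !big_bool /= !big_ord_recl !big_ord0 /e /S /= -!EFinD; congr EFin.
have vD : mean D = mean (E1 `&` D) + mean (E2 `&` D) + mean (D `\` (E1 `|` E2)).
  rewrite (volID hD hE1.1) (volID (box_boundedD hD hE1.1) hE2.1) addrA; congr (mean _ + mean _ + mean _).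
  - exact: setIC.
  - apply/seteqP; split=> z; rewrite /setI /setD /=; first tauto.
    move=> [z2 zD]; split=> //; split=> // z1; have : set0 z by rewrite -E12.
    by [].
  - by rewrite setDDl.
rewrite vD !mulrDl !expRD.
move: (expR (mean (E1 `&` D) * _)) (expR (mean (E2 `&` D) * _)) (expR (mean (D `\` (E1 `|` E2)) * _)) => x1 x2 x3.
move: (mean _) (mean _) (mean _) (mean _) => x4 x5 x6 x7.
ring.
Qed.

Hypotheses (a v r : R) (c : 'rV[R]_d).
Hypotheses (a0 : 0 < a) (a1 : a < 1) (v1 : 1 <= v) (r0 : 0 <= r).
Hypotheses (O1E : O1 = cube c r `*` `[a, 1[%classic) (O2E : O2 = cube c r `*` `[1, v[%classic).

Let lebp : {measure set pt -> \bar R} := (@lebesgue_rV R d \x^ @lebesgue_measure R)%E.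

Let lebp1 : lebp O1 = (r ^+ d * (1 - a))%:E.
Proof.
transitivity (lebesgue_rV (cube c r) * @lebesgue_measure R `[a, 1%R[)%E.
  by rewrite O1E; apply: product_measure2E => //; exact: measurable_cube.
by rewrite lebesgue_rV_cube // lebesgue_measure_itv /= lte_fin a1 -EFinD -EFinM.
Qed.

Let lebp2 : lebp O2 = (r ^+ d * (v - 1))%:E.
Proof.
transitivity (lebesgue_rV (cube c r) * @lebesgue_measure R `[1%R, v[)%E.
  by rewrite O2E; apply: product_measure2E => //; exact: measurable_cube.
rewrite lebesgue_rV_cube // lebesgue_measure_itv /= lte_fin.
case: ltrP => [_|vu]; first by rewrite -EFinD -EFinM.
have -> : v = 1 by apply/eqP; rewrite eq_le v1 vu.
by rewrite subrr mulr0 mule0.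
Qed.

Let hypm_is_measure : @is_measure _ pt R (@hyp_measure R d).
Proof.
pose hm : {measure set point -> \bar R} := @hyp_measure R d.
by split; [exact: (measure0 hm)|exact: (measure_ge0 hm)|exact: (@measure_semi_sigma_additive _ _ _ hm)].
Qed.

Let hm : {measure set pt -> \bar R} := pack_measure hypm_is_measure.

(* The factors of [pair_measure]: the intensity, multiplied by [u] inside [D]. *)
Let tilted (k : R) (O : set point) (A : set pt) : \bar R :=
  (k * (u * mean (O `&` A `&` D) + mean (O `&` A `\` D)))%:E.

Let tilted_measure (O : set point) (k : R) : box_bounded O -> 0 <= k ->
  @is_sigma_finite_measure _ pt R (tilted k O).
Proof.
move=> hO k0; have mO := hO.1; have mD := hD.1.
have mOD : measurable (O `&` D : set pt) by exact: (measurableI _ _ mO mD).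
have mOD' : measurable (O `\` D : set pt) by exact: (measurableD mO mD).
have kl0 : 0 <= k * lambda by rewrite mulr_ge0 // ltW.
pose Ma := measure_add (mscale (NngNum u0) (mrestr hm mOD)) (mrestr hm mOD').
pose M := mscale (NngNum kl0) Ma.
have ME A : measurable A -> M A = tilted k O A.
  move=> mA; have mA' : measurable (A : set point) by exact: mA.
  have f1 := box_bounded_volume (box_boundedI (box_boundedI hO mA') mD).
  have f2 := box_bounded_volume (box_boundedD (box_boundedI hO mA') mD).
  transitivity ((k * lambda)%:E * Ma A)%E; first by [].
  rewrite [Ma A]measure_addE.
  transitivity ((k * lambda)%:E * (u%:E * hm (A `&` (O `&` D)) + hm (A `&` (O `\` D))))%E; first by [].
  have -> : A `&` (O `&` D) = O `&` A `&` D by rewrite setIA [A `&` O]setIC.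
  have -> : A `&` (O `\` D) = O `&` A `\` D by rewrite !setDE setIA [A `&` O]setIC.
  have -> : hm (O `&` A `&` D) = (fine (hyp_measure (O `&` A `&` D)))%:E.
    by rewrite fineK // ge0_fin_numE.
  have -> : hm (O `&` A `\` D) = (fine (hyp_measure (O `&` A `\` D)))%:E.
    by rewrite fineK // ge0_fin_numE.
  transitivity (k * lambda * (u * fine (hyp_measure (O `&` A `&` D)) + fine (hyp_measure (O `&` A `\` D))))%:E.
    by rewrite [in RHS]EFinM [in RHS]EFinD [in RHS](EFinM u).
  by rewrite /tilted /vol; congr EFin; ring.
split.
- by rewrite -ME // measure0.
- have l0 : 0 <= lambda by exact: ltW.
  move=> A; rewrite lee_fin; apply: mulr_ge0 => //.
  by apply: addr_ge0; [apply: mulr_ge0 => //|]; exact: vol_ge0.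
- move=> F mF tF mUF; rewrite -ME //.
  have -> : (fun n => \sum_(0 <= i < n) tilted k O (F i))%E = (fun n => \sum_(0 <= i < n) M (F i))%E.
    by apply/funext => n; apply: eq_bigr => i _; rewrite ME.
  exact: (@measure_semi_sigma_additive _ _ _ M).
- apply: (@fin_num_fun_sigma_finite _ _ _ (tilted k O)) => //.
  by rewrite /tilted ltry.
Qed.

Let e0 : 0 <= expR (mean D * (u - 1)). Proof. exact: expR_ge0. Qed.
Let m1 := sf_measure (tilted_measure hO1 e0).
Let m2 := sf_measure (tilted_measure hO2 (@ler01 R)).

Let pairsE C : measurable C -> pair_measure C = (m1 \x m2)%E C.
Proof.
move=> mC; apply/esym; apply: (@product_measure_unique _ _ _ _ _ m1 m2 pm) => // A A' mA mA'.
transitivity (pair_measure (A `*` A')); first by [].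
rewrite pair_measureX // /m1 /m2 /= /sigma_finite_carrier /tilted -EFinM mul1r; congr EFin.
Qed.

Let mrestr_leb (O : set point) (hO : box_bounded O) : lebp O \is a fin_num ->
  @is_sigma_finite_measure _ pt R (fun A : set pt => lebp (A `&` O)).
Proof.
move=> fO; have mO : measurable (O : set pt) by exact: hO.1.
pose M := mrestr lebp mO.
split; [exact: (measure0 M)|exact: (measure_ge0 M)|exact: (@measure_semi_sigma_additive _ _ _ M)|].
apply: (@fin_num_fun_sigma_finite _ _ _ M); first by rewrite [X in (X < _)%E](measure0 M).
move=> A mA; rewrite ge0_fin_numE // /M /mrestr.
apply: le_lt_trans (_ : lebp O < +oo)%E; last by rewrite -ge0_fin_numE.
apply: le_measure; [apply: mem_set; exact: measurableI|exact: mem_set|by move=> z []].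
Qed.

Let l1fin : lebp O1 \is a fin_num. Proof. by rewrite lebp1. Qed.
Let l2fin : lebp O2 \is a fin_num. Proof. by rewrite lebp2. Qed.
Let n1 := sf_measure (mrestr_leb hO1 l1fin).
Let n2 := sf_measure (mrestr_leb hO2 l2fin).

Let tilted_le (O : set point) (k b : R) : box_bounded O -> 0 <= k -> 0 < b ->
  (forall z, O z -> b <= z.2) -> lebp O \is a fin_num ->
  forall A, measurable A -> (tilted k O A <= (k * (1 + u) * lambda * b ^- d.+1)%:E * lebp (A `&` O))%E.
Proof.
move=> hO k0 b0 Ob fO A mA; have mA' : measurable (A : set point) by exact: mA.
have hOA := box_boundedI hO mA'.
have H := hyp_measure_le hOA.1 b0 (fun z (h : (O `&` A) z) => Ob z h.1).
have fA : lebp (A `&` O) \is a fin_num.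
  rewrite ge0_fin_numE //; apply: le_lt_trans (_ : lebp O < +oo)%E; last by rewrite -ge0_fin_numE.
  apply: le_measure; [apply: mem_set; apply: measurableI => //; exact: hO.1|apply: mem_set; exact: hO.1|by move=> z []].
rewrite -(fineK fA) -EFinM lee_fin.
have f1 := box_bounded_volume hOA.
have {}H : fine (hyp_measure (O `&` A)) <= b ^- d.+1 * fine (lebp (A `&` O)).
  rewrite -lee_fin fineK ?ge0_fin_numE // EFinM fineK //.
  by rewrite [A `&` O]setIC.
have v0 B : 0 <= mean B by exact: vol_ge0.
apply: (@le_trans _ _ (k * ((1 + u) * mean (O `&` A)))).
  apply: ler_wpM2l => //; rewrite (volID hOA hD.1) mulrDl mul1r mulrDr.
  have := v0 (O `&` A `&` D); have := mulr_ge0 u0 (v0 (O `&` A `\` D)); lra.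
rewrite -!mulrA; apply: ler_wpM2l => //; apply: ler_wpM2l; first by rewrite addr_ge0.
by rewrite /vol; apply: ler_wpM2l => //; exact: ltW.
Qed.

Let K1 := expR (mean D * (u - 1)) * (1 + u) * lambda * a ^- d.+1.
Let K2 := (1 + u) * lambda.
Let K1_ge0 : 0 <= K1.
Proof.
rewrite /K1 divr_ge0 ?exprn_ge0 ?(ltW a0) //; apply: mulr_ge0; last exact: ltW.
by rewrite mulr_ge0 ?expR_ge0 ?addr_ge0.
Qed.
Let K2_ge0 : 0 <= K2. Proof. by rewrite mulr_ge0 ?addr_ge0 // ltW. Qed.

(* The density of the volume is at most [a ^- d.+1] on [O1] and at most 1 on
[O2]. *)
Let pairs_le_leb C : measurable C -> (pair_measure C <= (K1 * K2)%:E * (n1 \x n2) C)%E.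
Proof.
move=> mC; rewrite pairsE //.
have m1n A : measurable A -> (m1 A <= mscale (NngNum K1_ge0) n1 A)%E.
  move=> mA; apply: (tilted_le hO1 e0 a0 _ l1fin mA) => z; rewrite O1E => -[_ /=].
  by rewrite in_itv /= => /andP[].
have m2n A : measurable A -> (m2 A <= K2%:E * n2 A)%E.
  move=> mA; have := tilted_le hO2 (@ler01 R) (@ltr01 R) _ l2fin mA.
  rewrite expr1n invr1 mulr1 mul1r; apply => z; rewrite O2E => -[_ /=].
  by rewrite in_itv /= => /andP[].
have mx x : measurable (xsection C x) by exact: measurable_xsection.
apply: (@le_trans _ _ (\int[mscale (NngNum K1_ge0) n1]_x (m2 (xsection C x)))%E).
  apply: ge0_le_measure_integral => //; exact: measurable_fun_xsection.
apply: (@le_trans _ _ (\int[mscale (NngNum K1_ge0) n1]_x (K2%:E * n2 (xsection C x)))%E).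
  by apply: le_integral_ge0 => x _ //; exact: m2n.
have mn2 : measurable_fun setT (fun x => n2 (xsection C x)) by exact: measurable_fun_xsection.
rewrite ge0_integral_mscale //; last 2 first.
- exact: measurable_funeM.
- by move=> x _; rewrite mule_ge0 // lee_fin.
rewrite ge0_integralZl ?lee_fin // muleA -EFinM.
exact: lexx.
Qed.

(** The point at height 1 on the line through the pair.  The inverse of the height
difference is written as [expR (- ln _)], for which measurability is immediate. *)
Definition crossing (p : pt * pt) : 'rV[R]_d :=
  ((1 - p.1.2) * expR (- ln (p.2.2 - p.1.2))) *: (p.2.1 - p.1.1) + p.1.1.

Lemma measurable_crossing : measurable_fun setT crossing.
Proof.
have m11 : measurable_fun setT (fun p : pt * pt => p.1.1) by apply: (measurableT_comp measurable_fst); exact: measurable_fst.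
have m21 : measurable_fun setT (fun p : pt * pt => p.2.1) by apply: (measurableT_comp measurable_fst); exact: measurable_snd.
have m12 : measurable_fun setT (fun p : pt * pt => p.1.2 : R) by apply: (measurableT_comp measurable_snd); exact: measurable_fst.
have m22 : measurable_fun setT (fun p : pt * pt => p.2.2 : R) by apply: (measurableT_comp measurable_snd); exact: measurable_snd.
apply: measurable_fun_rV => j; rewrite /crossing; under eq_fun do rewrite !mxE.
apply: measurable_funD; last exact: (measurableT_comp (measurable_coord j) m11).
apply: measurable_funM.
  apply: measurable_funM; first exact: measurable_funB.
  apply: measurableT_comp => //; apply: measurableT_comp => //.
  by apply: measurableT_comp => //; exact: measurable_funB.
apply: measurable_funB; first exact: (measurableT_comp (measurable_coord j) m21).
exact: (measurableT_comp (measurable_coord j) m11).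
Qed.

Variables (B : set 'rV[R]_d) (b : R).
Hypotheses (mB : measurable B) (Bb : lebesgue_rV B = b%:E).

Definition crossing_pairs : set (pt * pt) := (O1 `*` O2) `&` crossing @^-1` B.

Lemma measurable_crossing_pairs : measurable crossing_pairs.
Proof.
apply: measurableI; first by apply: measurableX; [exact: hO1.1|exact: hO2.1].
rewrite -[X in measurable X]setTI; exact: measurable_crossing.
Qed.

Let steep : set (pt * pt) := [set p | p.2.2 - p.1.2 <= 2 * (1 - p.1.2)].

Let msteep : measurable steep.
Proof.
have m12 : measurable_fun setT (fun p : pt * pt => p.1.2 : R) by apply: (measurableT_comp measurable_snd); exact: measurable_fst.
have m22 : measurable_fun setT (fun p : pt * pt => p.2.2 : R) by apply: (measurableT_comp measurable_snd); exact: measurable_snd.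
have := @measurable_fun_le _ _ _ setT (fun p : pt * pt => p.2.2 - p.1.2 : R) (fun p => 2 * (1 - p.1.2) : R) measurableT.
move=> H; rewrite /steep -[X in measurable X]setTI; apply: H.
  exact: measurable_funB.
by apply: measurable_funM => //; exact: measurable_funB.
Qed.

Let b0 : 0 <= b. Proof. by rewrite -lee_fin -Bb. Qed.

Let affine_le (al : R) (x0 : 'rV[R]_d) : 2^-1 <= al ->
  (lebesgue_rV ((fun x => (al *: x + x0)%R) @^-1` B) <= (2 ^+ d * b)%:E)%E.
Proof.
move=> al2; have al0 : 0 < al by apply: lt_le_trans al2; rewrite invr_gt0.
rewrite lebesgue_rV_affine // Bb -EFinM lee_fin ler_wpM2r //.
rewrite lerXn2r ?nnegrE ?invr_ge0 ?(ltW al0) //.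
by rewrite -[leRHS]invrK lef_pV2 ?posrE ?invr_gt0.
Qed.

Let slice_le (S : set pt) (s t : R) : s <= t -> (forall y, ~ (s <= y < t) -> ysection S y = set0) ->
  (forall y, s <= y < t -> (lebesgue_rV (ysection S y) <= (2 ^+ d * b)%:E)%E) ->
  (lebp S <= (2 ^+ d * b * (t - s))%:E)%E.
Proof.
move=> st S0 Sy; rewrite /lebp /product_measure2 /=.
pose c0 : \bar R := (2 ^+ d * b)%:E.
have c00 : (0 <= c0)%E by rewrite lee_fin mulr_ge0 // exprn_ge0.
apply: (@le_trans _ _ (\int[@lebesgue_measure R]_y ((cst c0) \_ `[s, t[%classic) y)%E).
  apply: le_integral_ge0 => y _; first exact: measure_ge0.
  rewrite /= patchE; case: ifPn => [|/negP] yst; first by apply: Sy; move/set_mem: yst; rewrite /= in_itv.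
  by rewrite S0 ?measure0 // => H; apply: yst; apply/mem_set; rewrite /= in_itv.
rewrite -integral_mkcond integral_cst //= lebesgue_measure_itv /= lte_fin.
case: ltrP => [_|ts]; first by rewrite -EFinD -EFinM.
by rewrite mule0 lee_fin mulr_ge0 ?subr_ge0 // mulr_ge0 // exprn_ge0.
Qed.

(** Let [t] be the relative position of height 1 on the edge.  The crossing point
is affine in the upper end point with factor [t] and in the lower one with factor
[1 - t].  One of them is at least 1/2, and integrating over that end point gives
a bound linear in [b]; [steep] is the case [t >= 1/2]. *)
Lemma leb_crossing_pairs :
  ((n1 \x n2) crossing_pairs <= (2 ^+ d.+1 * b * v * r ^+ d)%:E)%E.
Proof.
have mC := measurable_crossing_pairs.
set C := crossing_pairs in mC *.
have mC1 : measurable (C `&` steep) by exact: measurableI.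
have mC2 : measurable (C `\` steep) by exact: measurableD.
rewrite (@measureDI _ _ _ (n1 \x n2)%E C steep) //.
have rd0 : 0 <= r ^+ d by rewrite exprn_ge0.
have db0 : 0 <= 2 ^+ d * b by rewrite mulr_ge0 // exprn_ge0.
have n1T : n1 setT = (r ^+ d * (1 - a))%:E by rewrite /n1 /= /sigma_finite_carrier setTI.
have n2T : n2 setT = (r ^+ d * (v - 1))%:E by rewrite /n2 /= /sigma_finite_carrier setTI.
have CO p : C p -> O1 p.1 /\ O2 p.2 by move=> [].
have H1 z : O1 z -> a <= z.2 < 1 by rewrite O1E => -[_ /=]; rewrite in_itv.
have H2 z : O2 z -> 1 <= z.2 < v by rewrite O2E => -[_ /=]; rewrite in_itv.
have I1 : ((n1 \x n2) (C `&` steep) <= (2 ^+ d * b * (v - 1))%:E * (r ^+ d * (1 - a))%:E)%E.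
  rewrite -n1T -(@integral_cst _ _ _ n1) //.
  apply: le_integral_ge0 => z _; first exact: measure_ge0.
  rewrite /= /n2 /= /sigma_finite_carrier.
  apply: (@slice_le _ 1 v) => // [y ny|y /andP[y1 yv]].
    apply/seteqP; split=> // x; rewrite ysectionE /= => -[].
    by rewrite xsectionE /= => -[/CO [_ /H2]].
  have [z1|z1] := pselect (a <= z.2 < 1); last first.
    rewrite (_ : ysection _ y = set0) ?measure0 ?lee_fin //.
    apply/seteqP; split=> // x; rewrite ysectionE /= => -[].
    by rewrite xsectionE /= => -[/CO [/H1]].
  have [st|nst] := pselect (y - z.2 <= 2 * (1 - z.2)); last first.
    rewrite (_ : ysection _ y = set0) ?measure0 ?lee_fin //.
    apply/seteqP; split=> // x; rewrite ysectionE /= => -[].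
    by rewrite xsectionE /= => -[].
  pose t := (1 - z.2) * expR (- ln (y - z.2)).
  have yz : 0 < y - z.2 by case/andP: z1 => _; lra.
  have tE : t = (1 - z.2) / (y - z.2) by rewrite /t expRN lnK.
  have t2 : 2^-1 <= t by rewrite tE ler_pdivlMr //; lra.
  apply: le_trans (affine_le (z.1 - t *: z.1) t2).
  apply: le_measure.
  - apply: mem_set; apply: measurable_ysection.
    by apply: measurableI; [exact: measurable_xsection|exact: hO2.1].
  - apply: mem_set; rewrite -[X in measurable X]setTI; exact: measurable_affine.
  move=> x; rewrite ysectionE /= => -[].
  rewrite xsectionE /= => -[[_ Bx] _] _; move: Bx.
  rewrite /crossing /= -/t (_ : _ + _ = t *: x + (z.1 - t *: z.1)) //.
  by rewrite scalerBr addrA addrAC.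
have I2 : ((n1 \x n2) (C `\` steep) <= (2 ^+ d * b * (1 - a))%:E * (r ^+ d * (v - 1))%:E)%E.
  rewrite (@product_measure_unique _ _ _ _ _ n1 n2 (n1 \x^ n2)%E) //; last first.
    by move=> A A' mA mA'; exact: product_measure2E.
  rewrite -n2T -(@integral_cst _ _ _ n2) //.
  apply: le_integral_ge0 => z _; first exact: measure_ge0.
  rewrite /= /n1 /= /sigma_finite_carrier.
  apply: (@slice_le _ a 1) => // [|y ny|y /andP[ya y1]]; first exact: ltW.
    apply/seteqP; split=> // x; rewrite ysectionE /= => -[].
    by rewrite ysectionE /= => -[/CO [/H1]].
  have [z1|z1] := pselect (1 <= z.2 < v); last first.
    rewrite (_ : ysection _ y = set0) ?measure0 ?lee_fin //.
    apply/seteqP; split=> // x; rewrite ysectionE /= => -[].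
    by rewrite ysectionE /= => -[/CO [_ /H2]].
  have [st|nst] := pselect (z.2 - y <= 2 * (1 - y)).
    rewrite (_ : ysection _ y = set0) ?measure0 ?lee_fin //.
    apply/seteqP; split=> // x; rewrite ysectionE /= => -[].
    by rewrite ysectionE /= => -[].
  pose t := (1 - y) * expR (- ln (z.2 - y)).
  have yz : 0 < z.2 - y by case/andP: z1 => ? _; lra.
  have tE : t = (1 - y) / (z.2 - y) by rewrite /t expRN lnK.
  have t2 : 2^-1 <= 1 - t.
    by rewrite lerBrDl -lerBrDr tE ler_pdivrMr //; move/negP: nst; rewrite -ltNge; lra.
  apply: le_trans (affine_le (t *: z.1) t2).
  apply: le_measure.
  - apply: mem_set; apply: measurable_ysection.
    by apply: measurableI; [exact: measurable_ysection|exact: hO1.1].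
  - apply: mem_set; rewrite -[X in measurable X]setTI; exact: measurable_affine.
  move=> x; rewrite ysectionE /= => -[].
  rewrite ysectionE /= => -[[_ Bx] _] _; move: Bx.
  rewrite /crossing /= -/t (_ : _ + _ = (1 - t) *: x + t *: z.1) //.
  by rewrite scalerBr scalerBl scale1r addrC addrA addrAC.
apply: le_trans (leeD I2 I1) _; rewrite -!EFinM -EFinD lee_fin.
have -> : 2 ^+ d * b * (1 - a) * (r ^+ d * (v - 1)) + 2 ^+ d * b * (v - 1) * (r ^+ d * (1 - a)) =
   2 ^+ d.+1 * b * r ^+ d * ((1 - a) * (v - 1)) by rewrite exprS; ring.
rewrite (_ : 2 ^+ d.+1 * b * v * r ^+ d = 2 ^+ d.+1 * b * r ^+ d * v); last by ring.
apply: ler_wpM2l.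
  by rewrite mulr_ge0 // mulr_ge0 // exprn_ge0.
apply: (@le_trans _ _ (v - 1)); last by rewrite gerBl.
by rewrite ler_piMl ?subr_ge0 // gerBl ltW.
Qed.

Lemma expect_crossing_pairs :
  (\int[P]_w (pairs crossing_pairs w * u ^+ nb D w)%:E <=
   (expR (mean D * (u - 1)) * (1 + u) ^+ 2 * lambda ^+ 2 * a ^- d.+1 *
    (2 ^+ d.+1 * b * v * r ^+ d))%:E)%E.
Proof.
apply: le_trans (pairs_le_leb measurable_crossing_pairs) _.
apply: le_trans (lee_wpmul2l _ leb_crossing_pairs) _; first by rewrite lee_fin mulr_ge0.
by rewrite -EFinM lee_fin /K1 /K2 le_eqVlt; apply/orP; left; apply/eqP; ring.
Qed.

End pairs.

(** * Trajectories and their cumulative deviation *)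
Section edges.
Context {R : realType} {d : nat}.
Local Notation point := ('rV[R]_d * R)%type.

Definition edge_at (z z' : point) (v : R) : 'rV[R]_d :=
  ((v - z.2) / (z'.2 - z.2)) *: (z'.1 - z.1) + z.1.

Lemma eucl_segment_coP (z z' p : point) : z.2 < z'.2 ->
  eucl_segment_co z z' p <-> z.2 <= p.2 < z'.2 /\ p.1 = edge_at z z' p.2.
Proof.
move=> zz'; have D0 : 0 < z'.2 - z.2 by rewrite subr_gt0.
split.
  move=> [t]; rewrite /= in_itv /= => /andP[t0 t1] <-; rewrite /segment_at /=.
  have E : (1 - t) * z.2 + t * z'.2 = z.2 + t * (z'.2 - z.2) by ring.
  split.
    rewrite E lerDl (mulr_ge0 t0 (ltW D0)) /=.
    by rewrite -ltrBrDl gtr_pMl.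
  rewrite /edge_at E (_ : (z.2 + t * (z'.2 - z.2) - z.2) / _ = t); last by field; lra.
  by apply/matrixP => i j; rewrite !mxE; ring.
move=> [/andP[zp pz'] pE]; exists ((p.2 - z.2) / (z'.2 - z.2)).
  by rewrite /= in_itv /= divr_ge0 ?subr_ge0 ?(ltW zz') //= ltr_pdivrMr // mul1r ltrD2r.
rewrite /segment_at [p in RHS]surjective_pairing; congr pair.
  by rewrite pE /edge_at scalerBr scalerBl scale1r [in RHS]addrC addrA addrAC.
by field; lra.
Qed.

Lemma edge_at_sub (z z' p : point) (v : R) : z.2 < z'.2 -> p.2 < z'.2 ->
  p.1 = edge_at z z' p.2 -> edge_at p z' v = edge_at z z' v.
Proof.
move=> zz' pz'; rewrite /edge_at => ->; apply/matrixP => i j; rewrite !mxE.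
by field; lra.
Qed.

Lemma eucl_segment_co_left (z z' : point) : eucl_segment_co z z' z.
Proof.
exists 0; first by rewrite /= in_itv /= lexx ltr01.
by rewrite /segment_at subr0 !scale0r !mul0r scale1r mul1r !addr0 -surjective_pairing.
Qed.

Lemma eucl_segment_co_const (z p : point) : eucl_segment_co z z p -> p = z.
Proof.
move=> [t _ <-]; rewrite /segment_at -scalerDl -mulrDl subrK scale1r mul1r.
by rewrite -surjective_pairing.
Qed.

Lemma eucl_segment_co_sub (z z' p q : point) : z.2 < z'.2 -> eucl_segment_co z z' p ->
  eucl_segment_co p z' q <-> p.2 <= q.2 < z'.2 /\ q.1 = edge_at z z' q.2.
Proof.
move=> zz' /(eucl_segment_coP _ zz')[/andP[zp pz'] pE].
by rewrite (eucl_segment_coP _ pz') (edge_at_sub _ zz' pz' pE).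
Qed.

End edges.

Section paths.
Context {R : realType} {d : nat} (eta : config R d).
Local Notation point := ('rV[R]_d * R)%type.

Lemma parentP (z : point) : parent eta z = z \/ is_parent eta z (parent eta z).
Proof.
by rewrite /parent; case: xgetP => [z' -> ?|_]; [right|left].
Qed.

Lemma parent_pts (z : point) : pts eta z -> pts eta (parent eta z).
Proof. by case: (parentP z) => [->|[]]. Qed.

Lemma parent_le (z : point) : z.2 <= (parent eta z).2.
Proof. by case: (parentP z) => [->|[_ /ltW]]. Qed.

(** The upper end of an edge is itself a vertex, and the lower end of its own
half-open edge. *)
Lemma level_eucl_segment_co (t : R) (x : 'rV[R]_d) : level eta t x ->
  exists z, pts eta z /\ eucl_segment_co z (parent eta z) (x, expR t).
Proof.
case=> z ez [s]; rewrite /= in_itv /= => /andP[s0].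
rewrite le_eqVlt => /predU1P[->|s1] E; last by exists z; split=> //; exists s => //=; rewrite in_itv /= s0.
exists (x, expR t).
suff -> : (x, expR t) = parent eta z by split; [exact: parent_pts|exact: eucl_segment_co_left].
by rewrite -E /segment_at subrr !scale0r !mul0r scale1r mul1r !add0r -surjective_pairing.
Qed.

Variables (t1 t2 : R) (x' x : 'rV[R]_d).
Hypothesis level_x' : level eta t1 x'.
Hypothesis no_vertex : forall z, pts eta z -> z.2 != expR t2.
Hypothesis anc_x : ancestor eta t1 t2 x' = Some x.

Let p0 : point := (x', expR t1).
Let z0 : point := xget p0 [set z | pts eta z /\ eucl_segment_co z (parent eta z) p0].
Let z (l : nat) : point := iter l (parent eta) z0.

Let z0P : pts eta z0 /\ eucl_segment_co z0 (z 1) p0.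
Proof. exact: (xgetPex p0 (level_eucl_segment_co level_x')). Qed.

Let ez l : pts eta (z l).
Proof. by elim: l => [|l IH]; [have [] := z0P|exact: parent_pts]. Qed.

Let z_le l k : (l <= k)%N -> (z l).2 <= (z k).2.
Proof.
elim: k => [|k IH]; first by rewrite leqn0 => /eqP->.
rewrite leq_eqVlt => /predU1P[->//|lk].
by apply: le_trans (IH lk) _; exact: parent_le.
Qed.

Let z_gt0 l : 0 < (z l).2.
Proof. by have := pts_half_space (ez l). Qed.

Let z_stuck l k : z l.+1 = z l -> z (l + k)%N = z l.
Proof. by move=> E; elim: k => [|k IH]; rewrite ?addn0 // addnS /z iterS -/(z _) IH. Qed.

Let z_next l : z l.+1 = z l \/ is_parent eta (z l) (z l.+1).
Proof. exact: parentP. Qed.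

Let trajP (q : point) : trajectory eta p0 q <->
  eucl_segment_co p0 (z 1) q \/ exists l, eucl_segment_co (z l.+1) (z l.+2) q.
Proof.
have upE : up eta p0 = z 1 by [].
have zS k : iter k (parent eta) (z 1) = z k.+1 by rewrite /z -iterSr.
split; rewrite /trajectory upE.
  move=> [?|[k _]]; first by left.
  by rewrite !zS => ?; right; exists k.
by case=> [?|[k H]]; [left|right; exists k => //; rewrite !zS].
Qed.

(** The edge of the trajectory that passes through height [expR t2] is
non-degenerate, since its lower end would otherwise be a vertex at that height. *)
Let top_edge : exists m, [/\ forall l, (l <= m)%N -> is_parent eta (z l) (z l.+1),
  (z m).2 < expR t2 < (z m.+1).2 & x = edge_at (z m) (z m.+1) (expR t2)].
Proof.
have T : trajectory eta p0 (x, expR t2).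
  move: anc_x; rewrite /ancestor; case: xgetP => // o -> [x2 Hx2 <-] [].
  by move=> <-.
have moving m : ~ (z m.+1 = z m) -> forall l, (l <= m)%N -> is_parent eta (z l) (z l.+1).
  move=> nm l lm; case: (z_next l) => // E; case: nm.
  have e1 := z_stuck (m - l) E; have e2 := z_stuck (m - l).+1 E.
  by move: e1 e2; rewrite addnS subnKC // => -> ->.
have step m : eucl_segment_co (z m) (z m.+1) (x, expR t2) -> exists m, [/\ forall l, (l <= m)%N -> is_parent eta (z l) (z l.+1),
  (z m).2 < expR t2 < (z m.+1).2 & x = edge_at (z m) (z m.+1) (expR t2)].
  move=> H; exists m.
  have nm : ~ (z m.+1 = z m).
    move=> E; rewrite E in H; have := eucl_segment_co_const H => e.
    by have := no_vertex (ez m); rewrite -e /= eqxx.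
  have mv := moving m nm; split=> //; have [_ lt _] := mv m (leqnn m).
    have [/andP[/= le2 ->] _] := (proj1 (eucl_segment_coP _ lt)) H.
    by rewrite lt_neqAle le2 no_vertex.
  by have [_] := (proj1 (eucl_segment_coP _ lt)) H.
case: (proj1 (trajP _) T) => [H|[k H]]; last exact: step H.
have [_ H0] := z0P; case: (z_next 0) => [E|[_ lt _]].
  have e0 : p0 = z0 by move: H0; rewrite E => /eucl_segment_co_const.
  by apply: (step 0%N); rewrite -[z 0]/z0 -e0.
apply: (step 0%N); apply/(eucl_segment_coP _ lt).
have [/andP[le2 ->] ->] := proj1 (eucl_segment_co_sub _ lt H0) H; split=> //.
have [/andP[le1 _] _] := proj1 (eucl_segment_coP _ lt) H0.
by rewrite (le_trans le1 le2).
Qed.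

Section integral_bound.
Variable m : nat.
Hypothesis mv : forall l, (l <= m)%N -> is_parent eta (z l) (z l.+1).
Hypothesis top : expR t2 < (z m.+1).2.

Let z_lt l : (l <= m)%N -> (z l).2 < (z l.+1).2.
Proof. by move=> /mv[]. Qed.

Let ancestorE l s : (l <= m)%N -> t1 <= s -> (z l).2 <= expR s < (z l.+1).2 ->
  ancestor eta t1 s x' = Some (edge_at (z l) (z l.+1) (expR s)).
Proof.
move=> lm ts /andP[ls sl]; have [_ H0] := z0P; have lt0 := z_lt (leq0n m).
have E0 q := eucl_segment_co_sub q lt0 H0.
apply: xget_unique.
  exists (edge_at (z l) (z l.+1) (expR s)) => //; apply/trajP.
  case: l lm ls sl => [|l] lm ls sl; first by left; apply/E0; rewrite /= ler_expR ts.
  by right; exists l; apply/(eucl_segment_coP _ (z_lt lm)); rewrite /= ls.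
move=> _ [x2 /trajP T <-]; congr Some; case: T => [/E0 /= [/andP[_ s1] ->]|[k]].
  case: l lm ls sl => // l lm ls sl.
  by have := le_lt_trans (le_trans (z_le (ltn0Sn l)) ls) s1; rewrite ltxx.
case: (z_next k.+1) => [E|[_ lt _]].
  (* a degenerate edge can only occur above the vertex [z m.+1] *)
  rewrite E => /eucl_segment_co_const e; have e2 : expR s = (z k.+1).2 by rewrite -e.
  have [km|km] := ltnP k m; first by have := z_lt km; rewrite E ltxx.
  by have := lt_le_trans sl (z_le (leq_trans lm km : (l.+1 <= k.+1)%N)); rewrite e2 ltxx.
move=> /(eucl_segment_coP _ lt)[/= /andP[ks sk] ->].
suff -> : l = k.+1 by [].
apply/eqP; rewrite eqn_leq; apply/andP; split; rewrite leqNgt; apply/negP => lk.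
  by have := le_lt_trans (le_trans (z_le lk) ls) sk; rewrite ltxx.
by have := le_lt_trans (le_trans (z_le lk) ks) sl; rewrite ltxx.
Qed.

Let bracket v : (z 0).2 <= v < (z m.+1).2 -> exists2 l, (l <= m)%N & (z l).2 <= v < (z l.+1).2.
Proof.
elim: m => [|k IH] /andP[v0 vk]; first by exists 0%N; rewrite ?v0.
have [vk'|kv] := ltP v (z k.+1).2; last by exists k.+1; rewrite ?kv.
by have [|l lk Hl] := IH; [rewrite v0|exists l => //; exact: leqW].
Qed.

Let start : (z 0).2 <= expR t1.
Proof.
by have [_ H0] := z0P; have [/andP[]] := proj1 (eucl_segment_coP _ (z_lt (leq0n m))) H0.
Qed.

Let bracket_s s : t1 <= s <= t2 -> exists2 l, (l <= m)%N & (z l).2 <= expR s < (z l.+1).2.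
Proof.
move=> /andP[ts st]; apply: bracket; rewrite (le_trans start) ?ler_expR //=.
by apply: le_lt_trans top; rewrite ler_expR.
Qed.

Let slope l : R := eucl_norm ((z l.+1).1 - (z l).1) / ((z l.+1).2 - (z l).2).

Let slope_ge0 l : 0 <= slope l.
Proof. by rewrite divr_ge0 ?eucl_norm_ge0 // subr_ge0 z_le. Qed.

Let speedE l (s : R) : (l <= m)%N -> t1 < s -> (z l).2 < expR s < (z l.+1).2 ->
  eucl_norm (derive1 (fun u => odflt 0 (ancestor eta t1 u x')) s) = slope l * expR s.
Proof.
move=> lm ts /andP[ls sl].
have D0 : 0 < (z l.+1).2 - (z l).2 by rewrite subr_gt0 z_lt.
have -> : derive1 (fun u => odflt 0 (ancestor eta t1 u x')) s =
   (expR s / ((z l.+1).2 - (z l).2)) *: ((z l.+1).1 - (z l).1).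
  rewrite derive1E (@near_eq_derive _ _ _ _ (fun u => edge_at (z l) (z l.+1) (expR u))); last first.
    have c := @continuous_expR R s.
    near=> u; rewrite (ancestorE lm) //.
      by apply/ltW; near: u; exact: (lt_nbhsr ts).
    apply/andP; split; last by near: u; exact: (c _ (lt_nbhsl sl)).
    by apply/ltW; near: u; exact: (c _ (lt_nbhsr ls)).
  have dc i j : is_derive (s : R) (1 : R) (fun u => edge_at (z l) (z l.+1) (expR u) i j)
     (expR s / ((z l.+1).2 - (z l).2) * ((z l.+1).1 - (z l).1) i j).
    have -> : (fun u => edge_at (z l) (z l.+1) (expR u) i j) = (fun u => (((z l.+1).1 - (z l).1) i j / ((z l.+1).2 - (z l).2)) * expR u + ((z l).1 i j - (z l).2 * (((z l.+1).1 - (z l).1) i j / ((z l.+1).2 - (z l).2)))).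
      by apply/funext => u; rewrite !mxE; field; lra.
    by apply: is_derive_eq; rewrite /GRing.scale /=; ring.
  rewrite derive_mx; last by apply/derivable_mxP => i j; have [] := dc i j.
  by apply/matrixP => i j; rewrite !mxE; have := dc i j => ?; rewrite derive_val !mxE.
rewrite eucl_normZ ger0_norm ?divr_ge0 ?expR_ge0 ?(ltW D0) //.
by rewrite /slope; ring.
Unshelve. all: by end_near. Qed.

Let leb := @lebesgue_measure R.
Let I l : set R := `[ln (z l).2, ln (z l.+1).2]%classic.
Let I_in l (s : R) : (z l).2 <= expR s < (z l.+1).2 -> I l s.
Proof.
move=> /andP[ls /ltW sl]; rewrite /I /= in_itv /=; apply/andP; split.
  by rewrite -ler_expR lnK ?posrE // z_gt0.
by rewrite -ler_expR lnK // posrE (z_gt0 l.+1).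
Qed.

Let F : set R := (fun l => ln (z l).2) @` `I_m.+2 `|` [set t1].

Let F_ln k : (k <= m.+1)%N -> F (ln (z k).2).
Proof. by move=> km; left; exists k. Qed.

Let leb_F : leb F = 0%E.
Proof.
apply: countable_lebesgue_measure0; apply: finite_set_countable.
by rewrite finite_setU; split=> //; exact/finite_image/finite_II.
Qed.

Let mF : measurable F.
Proof.
apply: countable_measurable => //; apply: finite_set_countable.
by rewrite finite_setU; split=> //; exact/finite_image/finite_II.
Qed.

Let int_I l : (l <= m)%N ->
  (\int[leb]_(s in I l) (slope l * expR s)%:E = (eucl_norm ((z l.+1).1 - (z l).1))%:E)%E.
Proof.
move=> lm; have zl := z_lt lm.
rewrite (@continuous_FTC2 _ _ (fun s => slope l * expR s)) //.
- rewrite !lnK ?posrE // -EFinB /slope; congr EFin; field.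
  by rewrite subr_eq0 gt_eqF.
- by rewrite ltr_ln ?posrE.
- apply: continuous_subspaceT => s; apply: cvgM; [exact: cvg_cst|exact: continuous_expR].
- have c s : (fun s => slope l * expR s) t @[t --> s] --> slope l * expR s.
    apply: cvgM; [exact: cvg_cst|exact: continuous_expR].
  split; first by move=> s _; exact: ex_derive.
  + exact: cvg_at_right_filter.
  + exact: cvg_at_left_filter.
- move=> s _; rewrite derive1E.
  have : is_derive (s : R) (1 : R) (fun s => slope l * expR s) (slope l * expR s).
    by apply: is_derive_eq; rewrite /GRing.scale /=; ring.
  by move=> ?; exact: derive_val.
Qed.

Let g l : R -> \bar R := (fun s => (slope l * expR s)%:E) \_ (I l).
Let gF : R -> \bar R := (fun s => +oo%E) \_ F.

Lemma CFD_le_edges : (CFD eta t1 t2 x' <= (\sum_(l < m.+1) eucl_norm ((z l.+1).1 - (z l).1))%:E)%E.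
Proof.
rewrite /CFD asboolF; last first.
  move=> [s]; rewrite in_itv /= => st.
  have [l lm Hl] := bracket_s st.
  by rewrite (ancestorE lm) //; case/andP: st.
have g0 l s : (0 <= g l s)%E.
  by rewrite /g patchE; case: ifP => // _; rewrite lee_fin mulr_ge0 ?expR_ge0.
have gF0 s : (0 <= gF s)%E by rewrite /gF patchE; case: ifP.
have mg l : measurable_fun setT (g l).
  rewrite /g; apply/(measurable_restrictT _ _).1; first exact: measurable_itv.
  apply/measurable_EFinP; apply: measurable_funM => //.
  by apply: measurable_funTS; exact: measurable_expR.
have mgF : measurable_fun setT gF.
  exact: (proj1 (measurable_restrictT _ mF) (measurable_cst _)).
have msum : measurable_fun setT (fun s => \sum_(l < m.+1) g l s)%E.
  by apply: emeasurable_sum => l _; exact: mg.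
apply: (@le_trans _ _ (\int[leb]_(s in `[t1, t2]) (\sum_(l < m.+1) g l s + gF s))%E).
  apply: le_integral_ge0 => s /=; first by rewrite lee_fin eucl_norm_ge0.
  rewrite in_itv /= => st.
  have [sF|nF] := pselect (F s).
    rewrite {1}/gF patchE mem_set // addey ?leey //.
    by rewrite gt_eqF // (lt_le_trans (ltNy0)) // sume_ge0.
  have [l lm /andP[ls sl]] := bracket_s st.
  have neq k : (k <= m.+1)%N -> (z k).2 != expR s.
    move=> km; apply/eqP => E; apply: nF; rewrite -[s]expRK -E; exact: F_ln.
  have s1 : t1 < s.
    by case/andP: st => ts _; rewrite lt_neqAle ts andbT; apply/eqP => E; apply: nF; right.
  have ls' : (z l).2 < expR s by rewrite lt_neqAle ls neq // leqW.
  rewrite (speedE lm s1); last by rewrite ls'.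
  apply: (@le_trans _ _ (g l s)).
    by rewrite /g patchE mem_set //; apply: I_in; rewrite ls.
  rewrite (bigD1 (Ordinal (lm : (l < m.+1)%N))) //= -addeA leeDl // adde_ge0 // sume_ge0 //.
apply: (@le_trans _ _ (\int[leb]_s (\sum_(l < m.+1) g l s + gF s))%E).
  have mtot : measurable_fun setT (fun s => \sum_(l < m.+1) g l s + gF s)%E.
    exact: emeasurable_funD.
  apply: (@ge0_subset_integral _ _ _ leb `[t1, t2]%classic setT _ _ _ mtot) => //.
  by move=> s _; rewrite adde_ge0 // sume_ge0.
rewrite ge0_integralD //; last by move=> s _; rewrite sume_ge0.
have igF : (\int[leb]_s gF s = 0)%E.
  rewrite -integral_mkcond; apply: etrans (integral_cst leb mF +oo%E) _.
  by apply: etrans (congr1 (mule +oo) leb_F) _; rewrite mule0.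
rewrite igF adde0 ge0_integral_sum //; last by move=> l; exact: mg.
apply: (@le_trans _ _ (\sum_(l < m.+1) (eucl_norm ((z l.+1).1 - (z l).1))%:E)%E); last by rewrite sumEFin.
apply: lee_sum => l _.
by rewrite -integral_mkcond int_I // -ltnS.
Qed.

End integral_bound.

(** On the logarithmic height interval of one edge, the ancestor moves along a
straight segment in a constant direction, so the integral of its speed is the
horizontal length of the edge. *)
Lemma CFD_le_chain : exists m (c : nat -> point), [/\
  forall l, (l <= m)%N -> pts eta (c l) /\ is_parent eta (c l) (c l.+1),
  (c m).2 < expR t2 < (c m.+1).2,
  x = edge_at (c m) (c m.+1) (expR t2) &
  (CFD eta t1 t2 x' <= (\sum_(l < m.+1) eucl_norm ((c l.+1).1 - (c l).1))%:E)%E].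
Proof.
have [m [mv top xE]] := top_edge; exists m, z; split=> //.
- by move=> l lm; split; [exact: ez|exact: mv].
- by apply: CFD_le_edges => //; case/andP: top.
Qed.

End paths.

(** * Chains of parents between good scales *)

(** In the increasing list of the elements below [m], the last of the first [K]
exceeds the first by at least [K.-1], and convexity fills the gap. *)
Lemma consecutive_run (Q : pred nat) (m K : nat) : (0 < K)%N ->
  (forall l1 l2 l3, (l1 <= l2 <= l3)%N -> Q l1 -> Q l3 -> Q l2) ->
  (K <= count Q (iota 0 m.+1))%N ->
  exists l1, (l1 + K <= m.+1)%N /\ forall l, (l1 <= l < l1 + K)%N -> Q l.
Proof.
move=> K0 cQ; rewrite -size_filter; set s := seq.filter _ _ => Ks.
have ss : sorted ltn s by apply: sorted_filter; [exact: ltn_trans|exact: iota_ltn_sorted].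
have sQ i : (i < size s)%N -> Q (nth 0%N s i) /\ (nth 0%N s i <= m)%N.
  by move=> /(mem_nth 0%N); rewrite mem_filter mem_iota add0n ltnS => /andP[-> /= ->].
have ge i : (i < size s)%N -> (nth 0 s 0 + i <= nth 0 s i)%N.
  elim: i => [|i IH] si; first by rewrite addn0.
  rewrite addnS; apply: leq_ltn_trans (IH (ltnW si)) _.
  by apply: (sortedP 0%N ss).
have K1 : (K.-1 < size s)%N by rewrite prednK.
have [QK mK] := sQ _ K1; have [Q0 _] := sQ 0%N (leq_trans K0 Ks).
exists (nth 0 s 0)%N; split.
  by have := ge _ K1; rewrite -ltnS -addnS prednK // => H; apply: leq_trans H _.
move=> l /andP[l1 l2]; apply: (cQ _ _ _ _ Q0 QK); rewrite l1 /=.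
apply: leq_trans (ge _ K1); rewrite -ltnS -addnS prednK //.
Qed.

Lemma natX_bound (R : realType) (c : R) : exists n0 : nat, forall n, (n0 <= n)%N ->
  c * n.+1%:R ^+ 3 <= 2 ^+ n.
Proof.
exists (Num.bound (256 * `|c|)) => n n0.
have cn : 256 * `|c| <= n.+1%:R.
  apply/ltW; apply: lt_le_trans (archi_boundP _) _; first exact: mulr_ge0 (ler0n _ _) (normr_ge0 _).
  by rewrite ler_nat leqW.
have n4 : n.+1%:R ^+ 4 <= 256 * 2 ^+ n :> R.
  rewrite -[256]/(256%:R) -!natrX -natrM ler_nat.
  have q : (n.+1 <= 4 * 2 ^ (n %/ 4))%N.
    have := ltn_expl (n %/ 4) (ltnSn 1); have := divn_eq n 4; have := ltn_pmod n (ltn0Sn 3); lia.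
  apply: (@leq_trans ((4 * 2 ^ (n %/ 4)) ^ 4)); first by rewrite leq_exp2r.
  by rewrite expnMn -expnM leq_mul // leq_exp2l // leq_divM.
have n1 : 0 < n.+1%:R :> R by [].
rewrite -(ler_pM2l n1) (@le_trans _ _ (`|c| * n.+1%:R ^+ 4)) //.
  by rewrite mulrCA -exprS ler_wpM2r ?exprn_ge0 // ler_norm.
apply: le_trans (ler_wpM2l (normr_ge0 c) n4) _.
by rewrite mulrA [X in X * _]mulrC ler_wpM2r // exprn_ge0.
Qed.

Section multiscale.
Context {R : realType} {d : nat}.
Local Notation point := ('rV[R]_d * R)%type.
Variables (C K n0 : nat).

(** One factor 2 more than the [2 ^+ d.+2] of [total_variation], so that the
contributions of the layers [scale k.+1 <= y < scale k] sum geometrically. *)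
Definition base : nat := 2 ^ d.+3.
Local Notation A := (base%:R : R).
Definition scale (k : nat) : R := A ^- k.
Definition hole_width (n : nat) : R := (C * n.+1)%:R.
Definition cell_index (n : nat) := {ffun 'I_d -> 'I_(2 * base ^ n)}.
Definition corner (a : 'rV[R]_d) (i n : nat) (L : R) (m : cell_index n) : 'rV[R]_d :=
  \row_j (a ord0 j - A ^+ i + L * (m j)%:R).
Definition hole_cell a k i (m : cell_index (k + i)) : set point :=
  cube (corner a i (scale k * hole_width (k + i)) m) (scale k * hole_width (k + i))
  `*` `[scale k, 2 * scale k[%classic.
Definition cluster_width k i : R := K%:R * 2 ^+ (k + i) * scale k.
Definition cluster_height k i : R := scale k / 2 ^+ (d.+1 * (k + i)).
(** Three times as wide as the grid, so that it contains every set of vertices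
within distance [cluster_width] of a vertex in the cell of the grid. *)
Definition cluster_cell a k i (m : cell_index (k + i)) (j : 'I_(2 ^ (d.+1 * (k + i)))) : set point :=
  cube (corner a i (cluster_width k i) m - const_mx (cluster_width k i)) (3 * cluster_width k i)
  `*` `[scale k.+1 + cluster_height k i * j%:R, scale k.+1 + cluster_height k i * j.+1%:R[%classic.

Definition hole (eta : config R d) a k i := exists m : cell_index (k + i), pts eta `&` hole_cell a m = set0.
Definition cluster (eta : config R d) a k i := exists (m : cell_index (k + i)) j,
  (K <= #|` fset_set (pts eta `&` cluster_cell a m j) |)%N.
(** The pair [(k, i)] concerns the layer [k] inside the window of half-width
[base ^ i]; the number of cells, and hence the rarity of bad events, is governed
by [k + i].  Scales below [n0], where the estimates do not hold yet, count as
bad. *)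
Definition bad (eta : config R d) a n := (n < n0)%N \/
  exists k : 'I_n.+1, hole eta a k (n - k) \/ cluster eta a k (n - k).

Lemma base_gt0 : 0 < A. Proof. by rewrite ltr0n expn_gt0. Qed.
Lemma base_ge8 : 8 <= A.
Proof. by rewrite -[8]/(8%:R) ler_nat (@leq_pexp2l 2 3 d.+3). Qed.
Lemma scale_gt0 k : 0 < scale k. Proof. by rewrite invr_gt0 exprn_gt0 // base_gt0. Qed.
Lemma scaleS k : scale k.+1 * A = scale k.
Proof. by rewrite /scale exprS invfM mulrAC mulVf ?mul1r // gt_eqF ?base_gt0. Qed.
Lemma scale0 : scale 0 = 1. Proof. by rewrite /scale expr0 invr1. Qed.

Lemma scaleX k i : A ^+ i = A ^+ (k + i) * scale k.
Proof. by rewrite exprD mulrAC divff ?mul1r // expf_neq0 // gt_eqF ?base_gt0. Qed.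

Lemma two_baseX n : A ^+ n = 2 ^+ (d.+3 * n).
Proof. by rewrite /base natrX exprM. Qed.

Hypothesis d0 : (0 < d)%N.
Hypotheses (C0 : (0 < C)%N) (K0 : (0 < K)%N).
Hypothesis n0P : forall n, (n0 <= n)%N ->
  2 * (2 * d%:R * A * hole_width n + 2) ^+ 3 <= 2 ^+ n :> R /\ 8 * K%:R * A <= 2 ^+ n :> R.
Hypothesis n02 : (1 < n0)%N.

Lemma hole_width_ge1 n : 1 <= hole_width n.
Proof. by rewrite ler1n muln_gt0 C0. Qed.

Lemma cluster_width_ge k i : scale k * 2 ^+ (k + i) <= cluster_width k i.
Proof.
rewrite /cluster_width mulrC -mulrA ler_peMl ?ler1n //.
by rewrite mulr_ge0 ?exprn_ge0 ?ltW ?scale_gt0.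
Qed.

Lemma cluster_width_gt0 k i : 0 < cluster_width k i.
Proof. by apply: lt_le_trans (cluster_width_ge k i); rewrite mulr_gt0 ?scale_gt0 ?exprn_gt0. Qed.

Lemma cluster_height_gt0 k i : 0 < cluster_height k i.
Proof. by rewrite divr_gt0 ?scale_gt0 ?exprn_gt0. Qed.

Lemma cell_cover (a x : 'rV[R]_d) k i (L : R) : scale k <= L ->
  (forall j, `|x ord0 j - a ord0 j| < A ^+ i) ->
  exists m : cell_index (k + i), cube (corner a i L m) L x.
Proof.
move=> kL xa; have L0 : 0 < L by apply: lt_le_trans kL; exact: scale_gt0.
pose t j := (x ord0 j - a ord0 j + A ^+ i) / L.
have t0 j : 0 <= t j.
  rewrite divr_ge0 ?(ltW L0) //; have := xa j; rewrite ltr_norml => /andP[h _].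
  by rewrite -lerBlDr sub0r ltW.
have tlt j : t j < (2 * base ^ (k + i))%:R.
  rewrite ltr_pdivrMr //; have := xa j; rewrite ltr_norml => /andP[_ h].
  apply: (@lt_le_trans _ _ (2 * A ^+ i)); first by rewrite mulr_natl mulr2n ltrD2r.
  rewrite (scaleX k i) natrM natrX -mulrA ler_wpM2l // ler_wpM2l //.
have tn j : (Num.truncn (t j) < 2 * base ^ (k + i))%N.
  rewrite -(ltr_nat R); apply: le_lt_trans (tlt j).
  by have /andP[] := truncn_itv (t0 j).
exists [ffun j => Ordinal (tn j)] => j; rewrite mxE ffunE /=.
have /andP[h1 h2] := truncn_itv (t0 j).
have xE : x ord0 j = a ord0 j - A ^+ i + L * t j by rewrite /t mulrC divfK ?gt_eqF //; ring.
rewrite xE lerD2l ler_wpM2l ?(ltW L0) //= -[ltRHS]addrA ltrD2l -[X in _ + X]mulr1 -mulrDr.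
by rewrite ltr_pM2l // natr1.
Qed.

Variables (eta : config R d) (a : 'rV[R]_d).
Local Notation in_window i z := (forall j, `|z.1 ord0 j - a ord0 j| < A ^+ i)%R.
Local Notation in_layer k z := (scale k.+1 <= z.2 < scale k)%R.

(** If the boxes above the layer contain points, the parent cannot be further
away than such a point; [hyp_dist_ge] turns this into Euclidean bounds. *)
Lemma parent_edge_le k i z z' : (n0 <= k + i)%N -> ~ hole eta a k i -> pts eta z ->
  in_layer k z -> in_window i z -> is_parent eta z z' ->
  (forall j, `|z'.1 ord0 j - z.1 ord0 j| <= scale k * 2 ^+ (k + i)) /\ z'.2 <= scale k * 2 ^+ (k + i).
Proof.
move=> ki nh ez /andP[kz zk] wz [ez' zz' min].
have k0 := scale_gt0 k; have z0 : 0 < z.2 by apply: lt_le_trans kz; exact: scale_gt0.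
pose L := scale k * hole_width (k + i).
have kL : scale k <= L by rewrite ler_peMr ?(ltW k0) // hole_width_ge1.
have [m zm] := cell_cover kL wz.
have [w [ew [wm]]] : (pts eta `&` hole_cell a m) !=set0 by apply/set0P/eqP => E; apply: nh; exists m.
rewrite /= in_itv /= => /andP[kw wk].
have zw : z.2 < w.2 by apply: lt_le_trans kw.
pose S := 2 * d%:R * A * hole_width (k + i) + 2 : R.
have dA0 : 0 <= d%:R * A * hole_width (k + i).
  by rewrite !mulr_ge0 // ?(ltW base_gt0) // (le_trans ler01) // hole_width_ge1.
have S1 : 1 < S by rewrite /S -!mulrA mulrA; lra.
have dist_w : eucl_norm (w.1 - z.1) <= z.2 * ((S - S^-1) / 2).
  apply: (@le_trans _ _ (d%:R * L)).
    apply: eucl_norm_le => [|j]; first exact: le_trans (ltW k0) kL.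
    rewrite !mxE ler_norml; have /andP[] := zm j; have /andP[] := wm j; rewrite -/L; lra.
  apply: (@le_trans _ _ (z.2 * (d%:R * A * hole_width (k + i)))).
    rewrite /L -scaleS; rewrite [leLHS](_ : _ = scale k.+1 * (d%:R * A * hole_width (k + i))); last by ring.
    by rewrite ler_wpM2r.
  rewrite ler_pM2l // ler_pdivlMr // /S.
  have : S^-1 <= 1 by rewrite invf_le1 ?(ltW S1) // (lt_trans ltr01).
  rewrite /S -!mulrA mulrA; lra.
have S0 : 0 < S by exact: lt_trans S1.
have z'0 : 0 < z'.2 by exact: lt_trans zz'.
have w0 : 0 < w.2 by exact: lt_trans zw.
have G j : (z'.1 ord0 j - z.1 ord0 j) ^+ 2 + z'.2 ^+ 2 <= (scale k * 2 ^+ (k + i)) ^+ 2.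
  apply: (@le_trans _ _ ((S ^+ 3 * w.2) ^+ 2)).
    exact: (closer_bound j z0 (ltW zw) S1 dist_w z'0 (min w ew zw)).
  have p0 : 0 <= S ^+ 3 by rewrite exprn_ge0 // ltW.
  rewrite lerXn2r ?nnegrE ?mulr_ge0 ?exprn_ge0 ?(ltW w0) ?(ltW k0) ?(ltW S0) //.
  have [h _] := n0P ki; have {}h : 2 * S ^+ 3 <= 2 ^+ (k + i) by [].
  apply: (@le_trans _ _ (S ^+ 3 * (2 * scale k))); first by rewrite ler_wpM2l // ltW.
  rewrite [leLHS](_ : _ = scale k * (2 * S ^+ 3)); last by ring.
  by rewrite ler_pM2l.
have b0 : 0 <= scale k * 2 ^+ (k + i) by rewrite mulr_ge0 ?exprn_ge0 // ltW.
split=> [j|].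
  rewrite -ler_sqr ?nnegrE // real_normK ?num_real //; apply: le_trans (G j).
  by rewrite lerDl sqr_ge0.
rewrite -ler_sqr ?nnegrE ?(ltW z'0) //; apply: le_trans (G (Ordinal d0)).
by rewrite lerDr sqr_ge0.
Qed.

Section chain.
Variables (m : nat) (c : nat -> point).
Hypothesis chain : forall l, (l <= m)%N -> pts eta (c l) /\ is_parent eta (c l) (c l.+1).
Hypothesis below : (c m).2 < 1.

Lemma chain_lt l1 l2 : (l1 < l2)%N -> (l2 <= m.+1)%N -> (c l1).2 < (c l2).2.
Proof.
elim: l2 => // l2 IH; rewrite ltnS leq_eqVlt => /predU1P[->|l12] l2m.
  by have [_ []] := chain l2m.
by apply: lt_trans (IH l12 (leqW l2m)) _; have [_ []] := chain l2m.
Qed.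

Lemma chain_le l1 l2 : (l1 <= l2)%N -> (l2 <= m.+1)%N -> (c l1).2 <= (c l2).2.
Proof.
by rewrite leq_eqVlt => /predU1P[->//|l12] l2m; apply/ltW/chain_lt.
Qed.

Lemma chain_gt0 l : (l <= m)%N -> 0 < (c l).2.
Proof. by move=> /chain[/(@pts_half_space _ _ eta)]. Qed.

Lemma chain_lt1 l : (l <= m)%N -> (c l).2 < 1.
Proof. by move=> lm; apply: le_lt_trans below; apply: chain_le => //; exact: leqW. Qed.

Variables (i : nat).
Hypothesis in_w : forall l, (l <= m)%N -> in_window i (c l).
Hypothesis n0i : (n0 <= i)%N.

Lemma chain_step_le k l : ~ hole eta a k i -> (l <= m)%N -> in_layer k (c l) ->
  (forall j, `|(c l.+1).1 ord0 j - (c l).1 ord0 j| <= scale k * 2 ^+ (k + i)) /\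
  (c l.+1).2 <= scale k * 2 ^+ (k + i).
Proof.
move=> nh lm lk; have [ec pc] := chain lm.
by apply: parent_edge_le => //; [exact: leq_trans (leq_addl _ _)|exact: in_w].
Qed.

(** A run of [K] vertices within one slab would stay within a box of
[cluster_cell], because each step is at most [scale k * 2 ^+ (k + i)]. *)
Lemma slab_count k (j : nat) : ~ hole eta a k i -> ~ cluster eta a k i ->
  (j < 2 ^ (d.+1 * (k + i)))%N ->
  (count (fun l => `[< in_layer k (c l) /\
     (scale k.+1 + cluster_height k i * j%:R <= (c l).2 < scale k.+1 + cluster_height k i * j.+1%:R)%R >])
     (iota 0 m.+1) < K)%N.
Proof.
move=> nh nc jJ; rewrite ltnNge; apply/negP => H; apply: nc.
pose Q l := (l <= m)%N && `[< in_layer k (c l) /\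
  (scale k.+1 + cluster_height k i * j%:R <= (c l).2 < scale k.+1 + cluster_height k i * j.+1%:R)%R >].
have [l1 [l1m run]] : exists l1, (l1 + K <= m.+1)%N /\ forall l, (l1 <= l < l1 + K)%N -> Q l.
  apply: consecutive_run => //.
  - move=> l1 l2 l3 /andP[l12 l23] /andP[l1m /asboolP[/andP[a1 a2] /andP[a3 a4]]] /andP[l3m /asboolP[/andP[b1 b2] /andP[b3 b4]]].
    have l2m := leq_trans l23 l3m; rewrite /Q l2m /=; apply/asboolP.
    have h1 := chain_le l12 (leqW l2m); have h2 := chain_le l23 (leqW l3m).
    by rewrite (le_trans a1 h1) (le_trans a3 h1) (le_lt_trans h2 b2) (le_lt_trans h2 b4).
  - apply: leq_trans H _; rewrite -!size_filter; apply: eq_leq; congr size.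
    by apply: eq_in_filter => l; rewrite mem_iota /Q add0n ltnS => /andP[_ ->].
have inr t : (t < K)%N -> [/\ (l1 + t <= m)%N, in_layer k (c (l1 + t)%N) &
    scale k.+1 + cluster_height k i * j%:R <= (c (l1 + t)%N).2 < scale k.+1 + cluster_height k i * j.+1%:R].
  move=> tK; have /run /andP[h /asboolP[? ?]] : (l1 <= l1 + t < l1 + K)%N by rewrite leq_addr ltn_add2l.
  by split.
have [l1m' _ _] := inr 0%N K0; rewrite addn0 in l1m'.
have s0 : 0 <= scale k * 2 ^+ (k + i) by rewrite mulr_ge0 ?exprn_ge0 // ltW // scale_gt0.
have kL : scale k <= cluster_width k i.
  apply: le_trans (cluster_width_ge k i); rewrite ler_peMr ?(ltW (scale_gt0 k)) //.
  by rewrite exprn_ege1 // ler1n.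
have [q cq] := cell_cover kL (in_w l1m').
exists q, (Ordinal jJ).
have dist t j' : (t < K)%N -> `|(c (l1 + t)%N).1 ord0 j' - (c l1).1 ord0 j'| <= t%:R * (scale k * 2 ^+ (k + i)).
  elim: t => [|t IH] tK; first by rewrite addn0 subrr normr0 mul0r.
  have [tm tl _] := inr t (ltnW tK); have [/(_ j') st _] := chain_step_le nh tm tl.
  rewrite addnS -natr1 mulrDl mul1r.
  have := IH (ltnW tK); move: st; set x1 := _ * _; set x2 := _ * _; set x3 := fun_of_matrix _ _ _; set x4 := fun_of_matrix _ _ _.
  move=> h1 h2; apply: le_trans (ler_distD x4 _ _) _; rewrite addrC; exact: lerD.
have inC t : (t < K)%N -> (pts eta `&` cluster_cell a q (Ordinal jJ)) (c (l1 + t)%N).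
  move=> tK; have [tm tl th] := inr t tK; split; first by have [] := chain tm.
  split; last by rewrite /= in_itv.
  move=> j'; have := dist t j' tK; have := cq j'; rewrite !mxE.
  have : t%:R * (scale k * 2 ^+ (k + i)) <= cluster_width k i.
    rewrite /cluster_width -mulrA [2 ^+ _ * _]mulrC ler_wpM2r // ler_nat; exact: ltnW.
  set W := cluster_width k i; set x1 := fun_of_matrix _ _ _; set x2 := fun_of_matrix _ _ _.
  have W0 : 0 < W by exact: cluster_width_gt0.
  move: (a ord0 j' - A ^+ i + W * _) => y; move: (t%:R * _) => e h1 /andP[h2 h3].
  rewrite ler_norml => /andP[h4 h5]; apply/andP; split; lra.
have fin : finite_set (pts eta `&` cluster_cell a q (Ordinal jJ)).
  apply: box_bounded_finite; apply: box_bounded_box.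
  by rewrite ltr_pwDl ?scale_gt0 // mulr_ge0 // ltW // cluster_height_gt0.
have us : uniq [seq c (l1 + t)%N | t <- iota 0 K].
  rewrite map_inj_in_uniq ?iota_uniq // => t1 t2; rewrite !mem_iota !add0n /= => t1K t2K E.
  apply/eqP; rewrite eqn_leq; apply/andP; split; rewrite leqNgt; apply/negP => lt.
    have [h _ _] := inr _ t1K; have := @chain_lt (l1 + t2)%N (l1 + t1)%N.
    by rewrite ltn_add2l lt (leqW h) E ltxx => /(_ isT isT).
  have [h _ _] := inr _ t2K; have := @chain_lt (l1 + t1)%N (l1 + t2)%N.
  by rewrite ltn_add2l lt (leqW h) E ltxx => /(_ isT isT).
have := uniq_leq_size us (s2 := fset_set (pts eta `&` cluster_cell a q (Ordinal jJ))).
rewrite size_map size_iota; apply => z /mapP[t]; rewrite mem_iota /= add0n => tK ->.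
by rewrite in_fset_set //; apply/mem_set; exact: inC.
Qed.

Lemma layer_count k : ~ hole eta a k i -> ~ cluster eta a k i ->
  (count (fun l => `[< in_layer k (c l) >]) (iota 0 m.+1) <= 2 ^ (d.+1 * (k + i)) * K)%N.
Proof.
move=> nh nc; pose J := (2 ^ (d.+1 * (k + i)))%N.
pose Q (j : 'I_J) l := `[< in_layer k (c l) /\
     (scale k.+1 + cluster_height k i * j%:R <= (c l).2 < scale k.+1 + cluster_height k i * j.+1%:R)%R >].
have h0 := cluster_height_gt0 k i.
apply: (@leq_trans (\sum_(j < J) count (Q j) (iota 0 m.+1))); last first.
  rewrite -[J in (_ <= J * _)%N]card_ord -sum_nat_const.
  by apply: leq_sum => j _; apply: ltnW; exact: slab_count.
under eq_bigr do rewrite -sum1_count big_mkcond /=.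
rewrite -sum1_count big_mkcond exchange_big /=; apply: leq_sum => l _.
case: asboolP => // /andP[l1 l2].
pose t := ((c l).2 - scale k.+1) / cluster_height k i.
have t0 : 0 <= t by rewrite divr_ge0 ?subr_ge0 // ltW.
have /andP[t1 t2] := truncn_itv t0.
have lt : t < J%:R.
  rewrite ltr_pdivrMr // (_ : J%:R * _ = scale k).
    by apply: le_lt_trans l2; rewrite gerBl // ltW // scale_gt0.
  by rewrite /J natrX /cluster_height mulrC divfK // expf_neq0.
have jJ : (Num.truncn t < J)%N by rewrite -(ltr_nat R); exact: le_lt_trans lt.
rewrite (bigD1 (Ordinal jJ)) //= (_ : Q _ l = true) //; apply/asboolP.
have E : (c l).2 = scale k.+1 + cluster_height k i * t by rewrite /t mulrC divfK ?gt_eqF //; ring.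
by rewrite l1 l2 E /= lerD2l ltrD2l ler_pM2l // ltr_pM2l // t1 t2.
Qed.

Lemma layer_exists (y : R) : 0 < y < 1 -> exists k, scale k.+1 <= y < scale k.
Proof.
move=> /andP[y0 y1].
have ex : exists k, scale k <= y.
  exists (Num.bound y^-1); rewrite -[leRHS]invrK /scale lef_pV2 ?posrE ?invr_gt0 ?exprn_gt0 ?base_gt0 //.
  apply/ltW; apply: lt_le_trans (upper_nthrootP (leqnn _)) _.
  by rewrite lerXn2r ?nnegrE ?(ltW base_gt0) //; apply: le_trans base_ge8; lra.
case: (ex_minnP ex) => -[|k] ky mk.
  by move: ky; rewrite scale0 => /(lt_le_trans y1); rewrite ltxx.
by exists k; rewrite ky /= ltNge; apply/negP => /mk; rewrite ltnn.
Qed.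

(** The layer at height [scale k] contributes at most
[2 ^ (d.+1 * (k + i)) * K] steps of length [scale k * 2 ^+ (k + i)], and the
choice of [base] makes the sum over [k] geometric. *)
Lemma total_variation : (forall k, ~ hole eta a k i /\ ~ cluster eta a k i) ->
  exists e : nat -> R,
  [/\ forall l, 0 <= e l,
   forall l, (l <= m)%N -> forall j, `|(c l.+1).1 ord0 j - (c l).1 ord0 j| <= e l &
   \sum_(l < m.+1) e l <= 2 * K%:R * 2 ^+ (d.+2 * i)].
Proof.
move=> good.
have /choice[k kP] l : exists k, (l <= m)%N -> in_layer k (c l).
  have [lm|ml] := leqP l m; last by exists 0%N.
  have [|k ?] := @layer_exists (c l).2; first by rewrite chain_gt0 ?chain_lt1.
  by exists k.
pose step q : R := scale q * 2 ^+ (q + i).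
have step0 q : 0 <= step q by rewrite mulr_ge0 ?exprn_ge0 // ltW // scale_gt0.
exists (fun l => step (k l)); split=> // [l lm|].
  by have [nh _] := good (k l); have [] := chain_step_le nh lm (kP l lm).
pose kmax := (\max_(l < m.+1) k l)%N.
apply: (@le_trans _ _ (\sum_(q < kmax.+1) step q * (2 ^ (d.+1 * (q + i)) * K)%:R)).
  apply: (@le_trans _ _ (\sum_(q < kmax.+1) \sum_(l < m.+1) step q * (k l == q)%:R)).
    rewrite exchange_big /=; apply: ler_sum => l _.
    have kl : (k l < kmax.+1)%N by rewrite ltnS /kmax (leq_bigmax l).
    rewrite (bigD1 (Ordinal kl)) //= eqxx mulr1 lerDl.
    by apply: sumr_ge0 => q _; rewrite mulr_ge0.
  apply: ler_sum => q _; rewrite -mulr_sumr ler_wpM2l // -natr_sum ler_nat.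
  have [nh nc] := good q; apply: leq_trans (layer_count nh nc).
  rewrite -sum1_count big_mkcond -(big_mkord xpredT (fun l => (k l == q) : nat)) /index_iota subn0.
  rewrite [leqRHS]big_mkcond big_seq [leqRHS]big_seq; apply: leq_sum => l; rewrite mem_iota add0n ltnS /= => lm.
  by case: eqP => // <-; rewrite asboolT //; exact: kP.
have E q : step q * (2 ^ (d.+1 * (q + i)) * K)%:R = K%:R * 2 ^+ (d.+2 * i) * 2 ^- q.
  rewrite /step /scale two_baseX natrM natrX.
  have -> : 2 ^+ (d.+3 * q) = 2 ^+ q * 2 ^+ q * 2 ^+ (d.+1 * q) :> R.
    by rewrite -!exprD; congr (_ ^+ _); lia.
  have -> : 2 ^+ (d.+1 * (q + i)) = 2 ^+ (d.+1 * q) * 2 ^+ (d.+1 * i) :> R.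
    by rewrite -exprD; congr (_ ^+ _); lia.
  have -> : 2 ^+ (d.+2 * i) = 2 ^+ i * 2 ^+ (d.+1 * i) :> R.
    by rewrite -exprD; congr (_ ^+ _); lia.
  by rewrite exprD; field; rewrite !expf_neq0.
under eq_bigr do rewrite E; rewrite -mulr_sumr.
have geo n : \sum_(q < n) 2 ^- q <= 2 - 2 ^- n *+ 2 :> R.
  elim: n => [|n IH]; first by rewrite big_ord0 expr0 invr1 subrr.
  rewrite big_ord_recr /= exprS invfM.
  by move: IH; move: (2 ^- n) (\sum_(_ < n) _) => x y; lra.
rewrite -[leRHS]mulrA [leRHS]mulrC ler_wpM2l ?mulr_ge0 ?exprn_ge0 //.
by apply: le_trans (geo _) _; rewrite gerBl // mulrn_wge0 // invr_ge0 exprn_ge0.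
Qed.

End chain.

(** Let [i] be the smallest window, from [i0] on, that contains the chain.  The
total variation is smaller than a quarter of the next smaller window, which
therefore also contains the chain unless [i = i0]. *)
Lemma good_chain (i0 m : nat) (c : nat -> point) (x : 'rV[R]_d) :
  (forall n, (i0 <= n)%N -> ~ bad eta a n) ->
  (forall l, (l <= m)%N -> pts eta (c l) /\ is_parent eta (c l) (c l.+1)) ->
  (c m).2 < 1 < (c m.+1).2 -> x = edge_at (c m) (c m.+1) 1 ->
  (forall j, `|x ord0 j - a ord0 j| <= 1) ->
  [/\ \sum_(l < m.+1) eucl_norm ((c l.+1).1 - (c l).1) <= d%:R * A ^+ i0,
    in_window i0 (c m), forall j, `|(c m.+1).1 ord0 j - a ord0 j| < 2 * A ^+ i0,
    A ^- i0 <= (c m).2 & (c m.+1).2 < A ^+ i0].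
Proof.
move=> good chain /andP[below above] xE xa.
have n0i0 : (n0 <= i0)%N by rewrite leqNgt; apply/negP => h; apply: (good i0 (leqnn _)); left.
have A1 : 1 <= A by apply: le_trans base_ge8; lra.
have good_k i k : (i0 <= i)%N -> ~ hole eta a k i /\ ~ cluster eta a k i.
  move=> i0i; have ki : (k < (k + i).+1)%N by rewrite ltnS leq_addr.
  have := good (k + i)%N (leq_trans i0i (leq_addl _ _)).
  by move=> H0; split=> H; apply: H0; right; exists (Ordinal ki) => /=; rewrite addKn; [left|right].
pose W i := (i0 <= i)%N && `[< forall l, (l <= m)%N -> in_window i (c l) >].
have exW : exists i, W i.
  pose M := \sum_(l < m.+1) \sum_j `|(c l).1 ord0 j - a ord0 j|.
  exists (maxn i0 (Num.bound M)); rewrite /W leq_maxl; apply/asboolP => l lm j.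
  apply: (@le_lt_trans _ _ M).
    rewrite /M (bigD1 (Ordinal (lm : (l < m.+1)%N))) //= (bigD1 j) //= -addrA lerDl.
    by rewrite addr_ge0 ?sumr_ge0 // => ? _; exact: sumr_ge0.
  apply: lt_le_trans (upper_nthrootP (leq_maxr i0 _)) _.
  by rewrite lerXn2r ?nnegrE ?(ltW base_gt0) //; apply: le_trans base_ge8; lra.
case: (ex_minnP exW) => i /andP[i0i /asboolP in_w] mini.
have n0i := leq_trans n0i0 i0i.
have [e [e0 ce eT]] := total_variation chain below in_w n0i (fun k => good_k i k i0i).
pose T := \sum_(l < m.+1) e l.
have T0 : 0 <= T by apply: sumr_ge0.
have TA : T * (4 * A) <= A ^+ i.
  apply: le_trans (ler_wpM2r _ eT) _; first by rewrite mulr_ge0 // ltW // base_gt0.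
  have [_ h] := n0P n0i; rewrite two_baseX.
  rewrite (_ : 2 ^+ (d.+3 * i) = 2 ^+ i * 2 ^+ (d.+2 * i)); last by rewrite -exprD; congr (_ ^+ _); lia.
  rewrite [leLHS](_ : _ = 8 * K%:R * A * 2 ^+ (d.+2 * i)); last by ring.
  by rewrite ler_wpM2r // exprn_ge0.
have dist l j : (l <= m)%N -> `|(c m).1 ord0 j - (c l).1 ord0 j| + e m <= T.
  move=> lm; rewrite /T big_ord_recr /= lerD2r.
  have H l2 : (l <= l2 <= m)%N -> `|(c l2).1 ord0 j - (c l).1 ord0 j| <= \sum_(t < l2) e t.
    elim: l2 => [|l2 IH] /andP[].
      by rewrite leqn0 => /eqP -> _; rewrite subrr normr0 big_ord0.
    rewrite leq_eqVlt => /predU1P[<- _|l1 l2m]; first by rewrite subrr normr0 sumr_ge0.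
    rewrite big_ord_recr /= addrC; apply: le_trans (ler_distD ((c l2).1 ord0 j) _ _) _.
    by apply: lerD; [exact: ce (ltnW l2m) j|apply: IH; rewrite -ltnS l1 ltnW].
  by apply: H; rewrite lm leqnn.
have em : e m <= T by rewrite /T big_ord_recr /= lerDr sumr_ge0.
have xm j : `|x ord0 j - (c m).1 ord0 j| <= e m.
  apply: le_trans (ce m (leqnn m) j); rewrite xE !mxE addrK normrM ler_piMl //.
  by rewrite ger0_norm ?divr_ge0 ?ler_pdivrMr ?mul1r ?subr_ge0 ?subr_gt0 ?lerD2r ?ltW // (lt_trans below).
have near l j : (l <= m)%N -> `|(c l).1 ord0 j - a ord0 j| <= T + 1.
  move=> lm; have := dist l j lm; have := xm j; have := xa j.
  move: (x ord0 j) ((c m).1 ord0 j) ((c l).1 ord0 j) (a ord0 j) (e m) => x1 x2 x3 x4 x5 {}h1 h2 h3.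
  apply: le_trans (ler_distD x1 _ _) _; apply: lerD => //.
  apply: le_trans (ler_distD x2 _ _) _; rewrite distrC; apply: le_trans h3; rewrite lerD2l.
  by rewrite distrC.
have ii0 : i = i0.
  apply/eqP; rewrite eqn_leq i0i andbT leqNgt; apply/negP => lt.
  case: i lt in_w mini TA {i0i n0i eT} => // i lt in_w mini TA.
  have /mini : W i; last by rewrite ltnn.
  rewrite /W -ltnS lt; apply/asboolP => l lm j; apply: le_lt_trans (near l j lm) _.
  have T4 : T * 4 <= A ^+ i by rewrite -(ler_pM2r base_gt0) -mulrA -exprSr.
  have A8 : 8 <= A ^+ i.
    apply: le_trans base_ge8 _; rewrite -[leLHS]expr1 ler_weXn2l //.
    by move: lt n02 n0i0; lia.
  lra.
subst i; have TA0 : T <= A ^+ i0.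
  by apply: le_trans TA; rewrite ler_peMr //; lra.
have [k kP] : exists k, in_layer k (c m).
  by apply: layer_exists; rewrite below andbT; apply: chain_gt0 chain _ _.
have [nh _] := good_k i0 k (leqnn _).
have [_ up] := chain_step_le chain in_w n0i nh (leqnn m) kP.
have ki : (k < i0)%N.
  have := lt_le_trans above up; rewrite mulrC /scale ltr_pdivlMr ?exprn_gt0 ?base_gt0 // mul1r two_baseX.
  by rewrite ltr_eXn2l ?ltr1n // !mulSn; clear; lia.
split=> //.
- apply: (@le_trans _ _ (\sum_(l < m.+1) d%:R * e l)).
    apply: ler_sum => l _; apply: eucl_norm_le => // j.
    by rewrite !mxE; apply: ce; rewrite -ltnS.
  by rewrite -mulr_sumr ler_wpM2l.
- exact: in_w.
- move=> j; rewrite mulr_natl mulr2n.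
  have := in_w m (leqnn m) j; have := ce m (leqnn m) j.
  move=> h1 h2; apply: le_lt_trans (ler_distD ((c m).1 ord0 j) _ _) _.
  by rewrite addrC; apply: ltr_leD => //; apply: le_trans TA0; exact: le_trans em.
- apply: le_trans (proj1 (andP kP)); rewrite /scale lef_pV2 ?posrE ?exprn_gt0 ?base_gt0 //.
  by rewrite ler_weXn2l.
- apply: le_lt_trans up _; apply: (@le_lt_trans _ _ (2 ^+ (k + i0))).
  by rewrite ler_piMl ?exprn_ge0 // /scale invf_le1 ?exprn_gt0 ?base_gt0 // exprn_ege1.
  by rewrite two_baseX ltr_eXn2l ?ltr1n // !mulSn; move: ki; clear; lia.
Qed.

End multiscale.

(** * Bad scales are rare *)
Section bad_weight.
Context {R : realType} {d : nat} {disp : measure_display} {Omega : measurableType disp}.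
Variables (lambda : R) (P : probability Omega R) (N : {mfun Omega >-> config R d}).
Hypothesis lambda0 : 0 < lambda.
Hypothesis PN : poisson_process lambda P N.
Hypothesis d0 : (0 < d)%N.
Local Notation point := ('rV[R]_d * R)%type.
Local Notation A := ((@base d)%:R : R).
Local Notation mean := (@vol R d lambda).
Local Notation nb := (npts N).
Local Notation scale := (@scale R d).
Local Notation cwidth := (@cluster_width R d).
Local Notation cheight := (@cluster_height R d).
Local Notation cell_index := (@cell_index d).

(** Twice the window of [good_chain], whose vertices below height 1 lie in the
window while the one above may leave it. *)
Definition window_cube (a : 'rV[R]_d) (t : nat) := cube (a - const_mx (2 * A ^+ t)) (4 * A ^+ t).
Definition below_box a t : set point := window_cube a t `*` `[A ^- t, 1[%classic.
Definition above_box a t : set point := window_cube a t `*` `[1, A ^+ t[%classic.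
Definition edges a t B := pairs N (below_box a t) (above_box a t)
  (crossing_pairs (below_box a t) (above_box a t) B).

Lemma below_box_bounded a t : box_bounded (below_box a t).
Proof. by apply: box_bounded_box; rewrite invr_gt0 exprn_gt0 // base_gt0. Qed.

Lemma above_box_bounded a t : box_bounded (above_box a t).
Proof. by apply: box_bounded_box. Qed.

Lemma measurable_edges a t B : measurable B -> measurable_fun setT (edges a t B).
Proof.
move=> mB; have h1 := below_box_bounded a t; have h2 := above_box_bounded a t.
exact: (measurable_pairs N h1 h2 (measurable_crossing_pairs h1 h2 mB)).
Qed.

Lemma edges_ge0 a t B w : 0 <= edges a t B w.
Proof. exact: pairs_ge0. Qed.

Definition edges_bound (t : nat) : R :=
  lambda ^+ 2 * (A ^+ t) ^+ d.+1 * 2 ^+ d.+1 * A ^+ t * (4 * A ^+ t) ^+ d.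

Lemma edges_bound_ge0 t : 0 <= edges_bound t.
Proof. by rewrite /edges_bound !mulr_ge0 ?exprn_ge0 ?mulr_ge0 ?exprn_ge0 ?ltW ?base_gt0. Qed.

Variables (a : 'rV[R]_d) (B : set 'rV[R]_d) (b : R) (t : nat).
Hypotheses (t0 : (0 < t)%N) (mB : measurable B) (Bb : lebesgue_rV B = b%:E).

Let b0 : 0 <= b.
Proof. by rewrite -lee_fin -Bb; exact: measure_ge0. Qed.

(** The mean of [f] when each sample is weighted by the number of pairs that
cross height 1 inside [B]; the factor [edges_bound t * b] is common to all
estimates, and only [c] depends on [f]. *)
Definition edge_expect (f : Omega -> R) (c : R) :=
  [/\ measurable_fun setT f, forall w, 0 <= f w &
    (\int[P]_w (edges a t B w * f w)%:E <= (c * (edges_bound t * b))%:E)%E].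

Lemma edge_expect_npts D u : box_bounded D -> 0 <= u ->
  edge_expect (fun w => u ^+ nb D w) (expR (mean D * (u - 1)) * (1 + u) ^+ 2).
Proof.
move=> hD u0; split=> [|w|]; first exact: (measurable_fun_npts N (fun k => u ^+ k) hD).
  exact: exprn_ge0.
have h1 := below_box_bounded a t; have h2 := above_box_bounded a t.
have disj : below_box a t `&` above_box a t = set0.
  apply/seteqP; split=> // z [[_ /=]]; rewrite in_itv /= => /andP[_ z1] [_ /=].
  by rewrite in_itv /= => /andP[/(lt_le_trans z1)]; rewrite ltxx.
have At : 0 < A ^+ t by rewrite exprn_gt0 // base_gt0.
have At1 : 1 < A ^+ t by rewrite exprn_egt1 ?gtn_eqF //; apply: lt_le_trans base_ge8; lra.
have aI : 0 < A ^- t by rewrite invr_gt0.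
have aI1 : A ^- t < 1 by rewrite invf_lt1.
have r0 : 0 <= 4 * A ^+ t by rewrite mulr_ge0 // ltW.
apply: le_trans (expect_crossing_pairs lambda0 PN h1 h2 hD disj u0 aI aI1 (ltW At1) r0 erefl erefl mB Bb) _.
rewrite lee_fin /edges_bound -exprVn invrK le_eqVlt; apply/orP; left; apply/eqP; ring.
Qed.

Lemma edge_expect_sum (T : finType) (f : T -> Omega -> R) (c : T -> R) :
  (forall i, edge_expect (f i) (c i)) -> edge_expect (fun w => \sum_i f i w) (\sum_i c i).
Proof.
move=> fc; split=> [|w|].
- by apply: measurable_sum => i; have [] := fc i.
- by apply: sumr_ge0 => i _; have [_ ->] := fc i.
under eq_integral do rewrite mulr_sumr -sumEFin.
rewrite ge0_integral_sum //; last 2 first.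
- move=> i; apply/measurable_EFinP; apply: measurable_funM; first exact: measurable_edges.
  by have [] := fc i.
- by move=> i w _; rewrite lee_fin mulr_ge0 ?edges_ge0 //; have [_ ->] := fc i.
rewrite mulr_suml -sumEFin; apply: lee_sum => i _; by have [] := fc i.
Qed.

Lemma edge_expectZ (f : Omega -> R) (c k : R) : 0 <= k -> edge_expect f c ->
  edge_expect (fun w => k * f w) (k * c).
Proof.
move=> k0 [mf f0 fc]; split=> [|w|]; first exact: measurable_funM.
  by rewrite mulr_ge0.
under eq_integral do rewrite mulrCA EFinM.
rewrite ge0_integralZl //; last 2 first.
- by apply/measurable_EFinP; apply: measurable_funM => //; exact: measurable_edges.
- by move=> w _; rewrite lee_fin mulr_ge0 // edges_ge0.
by rewrite -mulrA EFinM; apply: lee_wpmul2l.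
Qed.

Lemma edge_expectD (f g : Omega -> R) (c e : R) : edge_expect f c -> edge_expect g e ->
  edge_expect (fun w => f w + g w) (c + e).
Proof.
move=> hf hg.
have := @edge_expect_sum bool (fun i => if i then f else g) (fun i => if i then c else e).
rewrite big_bool /= => H.
have -> : (fun w => f w + g w) = (fun w => \sum_i (if i then f else g) w).
  by apply/funext => w; rewrite big_bool.
by apply: H; case.
Qed.

Variables (C K n0 : nat).
Hypotheses (C0 : (0 < C)%N) (K0 : (0 < K)%N).

Definition bad_weight n w : R := (n < n0)%:R +
  \sum_(k < n.+1) (\sum_m 0 ^+ nb (@hole_cell R d C a k (n - k) m) w +
    \sum_m \sum_j (2 ^+ n) ^+ nb (@cluster_cell R d K a k (n - k) m j) w / (2 ^+ n) ^+ K).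

Lemma hole_cell_bounded k i m : box_bounded (@hole_cell R d C a k i m).
Proof. by apply: box_bounded_box; exact: scale_gt0. Qed.

Lemma cluster_cell_bounded k i m j : box_bounded (@cluster_cell R d K a k i m j).
Proof.
apply: box_bounded_box; rewrite ltr_pwDl ?scale_gt0 // mulr_ge0 // ltW //.
exact: cluster_height_gt0.
Qed.

(** For a count [X], the indicator of [K <= X] is at most [u ^ X / u ^ K] for
every [u >= 1], here [u = 2 ^ n], and [0 ^ X] is the indicator of [X = 0]. *)
Lemma bad_weight_ge1 n w : bad C K n0 (N w) a n -> 1 <= bad_weight n w.
Proof.
have s0 k : 0 <= \sum_m 0 ^+ nb (@hole_cell R d C a k (n - k) m) w :> R.
  by apply: sumr_ge0 => m _; exact: exprn_ge0.
have s1 k : 0 <= \sum_m \sum_j (2 ^+ n) ^+ nb (@cluster_cell R d K a k (n - k) m j) w / (2 ^+ n) ^+ K :> R.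
  by apply: sumr_ge0 => m _; apply: sumr_ge0 => j _; rewrite divr_ge0 ?exprn_ge0.
case=> [nn0|[k H]]; rewrite /bad_weight.
  by rewrite nn0 lerDl sumr_ge0 // => k _; rewrite addr_ge0.
rewrite ler_wpDl // (bigD1 k) //= ler_wpDr //.
  by apply: sumr_ge0 => q _; exact: addr_ge0 (s0 q) (s1 q).
case: H => [[m E]|[m [j E]]].
  have E0 : nb (hole_cell C a m) w = 0%N by rewrite /npts E fset_set0 cardfs0.
  apply: ler_wpDr; first exact: s1.
  apply: (@le_trans _ _ (0 ^+ nb (hole_cell C a m) w)); first by rewrite E0.
  by rewrite (bigD1 m) //= lerDl sumr_ge0 // => q _; exact: exprn_ge0.
apply: ler_wpDl; first exact: s0.
rewrite (bigD1 m) //=; apply: ler_wpDr.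
  by apply: sumr_ge0 => q _; apply: sumr_ge0 => ? _; rewrite divr_ge0 ?exprn_ge0.
rewrite (bigD1 j) //=; apply: ler_wpDr; first by apply: sumr_ge0 => q _; rewrite divr_ge0 ?exprn_ge0.
rewrite ler_pdivlMr ?exprn_gt0 // mul1r; apply: ler_weXn2l; last exact: E.
by rewrite exprn_ege1 // ler1n.
Qed.

Lemma vol_hole_cell k i m : lambda * C%:R * (k + i).+1%:R / 2 ^+ d.+1 <= mean (@hole_cell R d C a k i m).
Proof.
have sk := @scale_gt0 R d k.
have hw := hole_width_ge1 (R := R) C0 (k + i).
have w0 : 0 <= scale k * hole_width C (k + i) :> R by rewrite mulr_ge0 ?(ltW sk) // (le_trans ler01).
have s2 : scale k <= 2 * scale k :> R by rewrite mulr_natl mulr2n lerDl ltW.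
have := hyp_box_ge (corner a i (scale k * hole_width C (k + i)) m) w0 sk s2.
rewrite -/(hole_cell C a m) => H.
rewrite /vol -!mulrA ler_pM2l //.
have fin := box_bounded_volume (hole_cell_bounded m).
rewrite -lee_fin fineK ?ge0_fin_numE //; apply: le_trans H; rewrite lee_fin.
have -> : (scale k * hole_width C (k + i)) ^+ d * (2 * scale k - scale k) / (2 * scale k) ^+ d.+1 =
   hole_width C (k + i) ^+ d / 2 ^+ d.+1 :> R.
  by rewrite !exprMn exprS [scale k ^+ d.+1]exprS; field; rewrite ?expf_neq0 ?gt_eqF // exprn_gt0.
rewrite mulrA ler_pM2r ?invr_gt0 ?exprn_gt0 // -natrM -/(hole_width C (k + i)).
by rewrite -[leLHS]expr1 ler_weXn2l.
Qed.

Definition cluster_volume : R := lambda * (3 * K%:R) ^+ d * A ^+ d.+1.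

(** The height of the slabs is chosen such that the volume stays bounded when
multiplied by [2 ^ n], the base of the exponential moment in [bad_weight]. *)
Lemma vol_cluster_cell k i m j : mean (@cluster_cell R d K a k i m j) <= cluster_volume / 2 ^+ (k + i).
Proof.
have sk := @scale_gt0 R d k; have sk1 := @scale_gt0 R d k.+1.
have cw := cluster_width_gt0 (R := R) (d := d) K0 k i.
have ch := @cluster_height_gt0 R d k i.
have w0 : 0 <= 3 * cwidth K k i :> R by rewrite mulr_ge0 // ltW.
have u0 : 0 < scale k.+1 + cheight k i * j%:R :> R.
  by rewrite ltr_pwDl // mulr_ge0 // ltW.
have uv : scale k.+1 + cheight k i * j%:R <= scale k.+1 + cheight k i * j.+1%:R :> R.
  by rewrite lerD2l ler_pM2l // ler_nat.
have := hyp_box_le (corner a i (cwidth K k i) m - const_mx (cwidth K k i)) w0 u0 uv.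
rewrite -/(cluster_cell K a m j) => H.
rewrite /vol /cluster_volume -!mulrA ler_pM2l //.
have fin := box_bounded_volume (cluster_cell_bounded m j).
rewrite -lee_fin fineK ?ge0_fin_numE //; apply: le_trans H _; rewrite lee_fin.
rewrite opprD addrACA subrr add0r -mulrBr -natrB // subSnn mulr1.
apply: (@le_trans _ _ ((3 * cwidth K k i) ^+ d * cheight k i / scale k.+1 ^+ d.+1)).
  apply: ler_wpM2l; first by rewrite mulr_ge0 ?exprn_ge0 ?(ltW ch).
  rewrite lef_pV2 ?posrE ?exprn_gt0 //.
  by rewrite lerXn2r ?nnegrE ?(ltW u0) ?(ltW sk1) // lerDl mulr_ge0 // ltW.
rewrite /cluster_width /cluster_height -(scaleS (R := R) (d := d) k).
move: (k + i)%N => n; rewrite [(d.+1 * n)%N]mulnC exprM.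
have y0 : 0 < 2 ^+ n :> R by exact: exprn_gt0.
move: (2 ^+ n) y0 => y y0.
have -> : (3 * (K%:R * y * (scale k.+1 * A))) ^+ d =
   (3 * K%:R) ^+ d * y ^+ d * scale k.+1 ^+ d * A ^+ d by rewrite -!exprMn; congr (_ ^+ _); ring.
rewrite [A ^+ d.+1]exprS [scale k.+1 ^+ d.+1]exprS [y ^+ d.+1]exprS le_eqVlt; apply/orP; left; apply/eqP.
by field; rewrite !expf_neq0 ?gt_eqF.
Qed.

Lemma edge_expect_bad_weight n : edge_expect (bad_weight n)
  (4 * (n < n0)%:R + n.+1%:R * (2 * A ^+ n) ^+ d * (expR (- (lambda * C%:R * n.+1%:R / 2 ^+ d.+1)) +
     2 ^+ (d.+1 * n) * (expR cluster_volume * 4 * (2 ^+ n) ^+ 2 / (2 ^+ n) ^+ K))).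
Proof.
have lec f c e : c <= e -> edge_expect f c -> edge_expect f e.
  move=> ce [mf f0 fc]; split=> //; apply: le_trans fc _.
  by rewrite lee_fin ler_wpM2r // mulr_ge0 // edges_bound_ge0.
have cst : edge_expect (fun=> (n < n0)%:R) (4 * (n < n0)%:R).
  have -> : (fun _ : Omega => (n < n0)%:R) = (fun w => (n < n0)%:R * 1 ^+ nb (below_box a t) w) :> (Omega -> R).
    by apply/funext => w; rewrite expr1n mulr1.
  rewrite mulrC; apply: edge_expectZ => //; apply: (lec _ _ _ _ (edge_expect_npts (below_box_bounded a t) ler01)).
  by rewrite subrr mulr0 expR0 mul1r; lra.
apply: edge_expectD => //.
have card (k : 'I_n.+1) : #|{: cell_index (k + (n - k))}|%:R = (2 * A ^+ n) ^+ d :> R.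
  by rewrite card_ffun !card_ord subnKC -1?ltnS // natrX natrM natrX.
apply: (lec _ _ _ _ (edge_expect_sum (c := fun k : 'I_n.+1 => \sum_(m : cell_index (k + (n - k)))
   expR (- (lambda * C%:R * n.+1%:R / 2 ^+ d.+1)) + \sum_(m : cell_index (k + (n - k))) \sum_(j < 2 ^ (d.+1 * (k + (n - k))))
   expR cluster_volume * 4 * (2 ^+ n) ^+ 2 / (2 ^+ n) ^+ K) _)).
  under eq_bigr => k _.
    rewrite !sumr_const -[X in X + _]mulr_natl -[X in _ + X]mulr_natl card card_ord.
    rewrite -[X in _ + _ * X]mulr_natl subnKC -1?ltnS // -mulrDr natrX.
    over.
  by rewrite /= sumr_const card_ord -[leLHS]mulr_natl mulrA lexx.
move=> k; have kn : (k + (n - k) = n)%N by rewrite subnKC // -ltnS.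
apply: edge_expectD; apply: edge_expect_sum => m.
  apply: (lec _ _ _ _ (edge_expect_npts (hole_cell_bounded m) (lexx (0 : R)))).
  rewrite addr0 expr1n mulr1 sub0r mulrN1 ler_expR lerN2.
  by have := vol_hole_cell m; rewrite kn.
apply: edge_expect_sum => j.
have n2 : 0 <= 2 ^+ n :> R by exact: exprn_ge0.
have n21 : 1 <= 2 ^+ n :> R by rewrite exprn_ege1 // ler1n.
have n20 : 0 < 2 ^+ n :> R by exact: exprn_gt0.
have -> : (fun w => (2 ^+ n) ^+ nb (@cluster_cell R d K a k (n - k) m j) w / (2 ^+ n) ^+ K) =
   (fun w => ((2 ^+ n) ^+ K)^-1 * (2 ^+ n) ^+ nb (cluster_cell K a m j) w) :> (Omega -> R).
  by apply/funext => w; rewrite mulrC.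
rewrite [X in edge_expect _ X]mulrC; apply: edge_expectZ; first by rewrite invr_ge0 exprn_ge0.
apply: (lec _ _ _ _ (edge_expect_npts (cluster_cell_bounded m j) n2)).
rewrite -mulrA; apply: ler_pM; rewrite ?expR_ge0 ?sqr_ge0 //.
  rewrite ler_expR; apply: (@le_trans _ _ (mean (cluster_cell K a m j) * 2 ^+ n)).
    by rewrite ler_wpM2l ?vol_ge0 // gerBl.
  by rewrite -ler_pdivlMr //; have := vol_cluster_cell m j; rewrite kn.
rewrite (_ : 4 * (2 ^+ n) ^+ 2 = (2 * 2 ^+ n) ^+ 2); last by rewrite exprMn; congr (_ * _); ring.
by rewrite lerXn2r ?nnegrE ?addr_ge0 ?mulr_ge0 // mulr_natl mulr2n lerD2r.
Qed.

End bad_weight.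

Section parameters.
Context {R : realType} {d : nat}.
Variables (lambda : R) (p : nat).
Hypothesis lambda0 : 0 < lambda.
Local Notation A := ((@base d)%:R : R).
Local Notation bound := (@edges_bound R d lambda).
Local Notation volume := (@cluster_volume R d lambda).

Let rate : nat := d.+3 * (2 * d + 2 + p).
Let cst : R := lambda ^+ 2 * 2 ^+ d.+1 * 4 ^+ d * d%:R ^+ p.

Let edges_boundE n : bound n.+1 * (d%:R * A ^+ n.+1) ^+ p = cst * 2 ^+ (rate * n.+1).
Proof.
rewrite /edges_bound /cst /rate two_baseX !exprMn -!exprM.
have -> : 2 ^+ (d.+3 * (2 * d + 2 + p) * n.+1) =
   2 ^+ (d.+3 * n.+1 * d.+1) * 2 ^+ (d.+3 * n.+1) * 2 ^+ (d.+3 * n.+1 * d) * 2 ^+ (d.+3 * n.+1 * p) :> R.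
  by rewrite -!exprD; congr (_ ^+ _); ring.
ring.
Qed.

Let cst0 : 0 <= cst.
Proof. by rewrite /cst !mulr_ge0 ?exprn_ge0 // ltW. Qed.

Variables (C n0 : nat).
Let X : nat := rate + d.+3 * d + 2.
(** Each unit divides the contribution of the clusters by [2 ^ n]; the sum
collects the exponents of the factors that it has to outweigh in [term3]. *)
Definition cluster_size : nat := 1 + d.+3 * d + d.+1 + 2 + rate + 1.
Let K := cluster_size.
Hypothesis CX : X%:R <= lambda * C%:R / 2 ^+ d.+1.
Definition edge_constant : R := cst * (4 * 2 ^+ (rate * n0 + n0) + 2 ^+ d + 2 ^+ d * 4 * expR (volume K) * 2 ^+ rate).

Let M := edge_constant.

Let succ_le n : n.+1%:R <= 2 ^+ n :> R.
Proof. by rewrite -natrX ler_nat ltn_expl. Qed.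

Let cells n : (2 * A ^+ n) ^+ d = 2 ^+ d * 2 ^+ (d.+3 * d * n) :> R.
Proof. by rewrite exprMn two_baseX -exprM; congr (_ * _ ^+ _); ring. Qed.

Let exp2_le n : expR (- (lambda * C%:R * n.+1%:R / 2 ^+ d.+1)) <= 2 ^- (X * n.+1).
Proof.
rewrite expRN lef_pV2 ?posrE ?expR_gt0 ?exprn_gt0 //.
have e2 : 2 <= expR 1 :> R by exact: (le_trans _ (expR_ge1Dx 1)).
apply: (@le_trans _ _ (expR 1 ^+ (X * n.+1))); first by rewrite lerXn2r ?nnegrE ?expR_ge0.
rewrite -expRM_natl mulr1 ler_expR natrM [leRHS](_ : _ = lambda * C%:R / 2 ^+ d.+1 * n.+1%:R); last by ring.
by rewrite ler_wpM2r.
Qed.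

Let term1 n : 4 * (n < n0)%:R * 2 ^+ (rate * n.+1) <= 4 * 2 ^+ (rate * n0 + n0) / 2 ^+ n :> R.
Proof.
case: (ltnP n n0) => nn0; last by rewrite mulr0 mul0r !mulr_ge0 ?exprn_ge0 ?invr_ge0 ?exprn_ge0.
rewrite mulr1 -!mulrA ler_pM2l // ler_pdivlMr ?exprn_gt0 // -exprD ler_weXn2l ?ler1n //.
by rewrite leq_add // ?(ltnW nn0) // leq_mul2l nn0 orbT.
Qed.

Let term2 n : n.+1%:R * (2 * A ^+ n) ^+ d * expR (- (lambda * C%:R * n.+1%:R / 2 ^+ d.+1)) * 2 ^+ (rate * n.+1)
   <= 2 ^+ d / 2 ^+ n :> R.
Proof.
rewrite ler_pdivlMr ?exprn_gt0 // cells.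
apply: (@le_trans _ _ (2 ^+ n * (2 ^+ d * 2 ^+ (d.+3 * d * n)) * 2 ^- (X * n.+1) * 2 ^+ (rate * n.+1) * 2 ^+ n)).
  have w0 x : 0 <= 2 ^+ x :> R by exact: exprn_ge0.
  apply: ler_wpM2r => //; apply: ler_wpM2r => //; apply: ler_pM.
  - by rewrite !mulr_ge0.
  - exact: expR_ge0.
  - by apply: ler_wpM2r; rewrite ?mulr_ge0.
  - exact: exp2_le.
rewrite [leLHS](_ : _ = 2 ^+ d * (2 ^+ (n + d.+3 * d * n + rate * n.+1 + n) / 2 ^+ (X * n.+1))); last first.
  by rewrite !exprD; ring.
rewrite ler_piMr ?exprn_ge0 // ler_pdivrMr ?exprn_gt0 // mul1r ler_weXn2l ?ler1n //.
by rewrite /X; move: rate => r; nia.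
Qed.

Let term3 n : n.+1%:R * (2 * A ^+ n) ^+ d *
   (2 ^+ (d.+1 * n) * (expR (volume K) * 4 * (2 ^+ n) ^+ 2 / (2 ^+ n) ^+ K)) * 2 ^+ (rate * n.+1)
   <= 2 ^+ d * 4 * expR (volume K) * 2 ^+ rate / 2 ^+ n :> R.
Proof.
rewrite ler_pdivlMr ?exprn_gt0 // cells.
have e0 := expR_ge0 (volume K); move: (expR _) e0 => e e0.
rewrite -!exprM; apply: (@le_trans _ _ (2 ^+ n * (2 ^+ d * 2 ^+ (d.+3 * d * n)) *
   (2 ^+ (d.+1 * n) * (e * 4 * 2 ^+ (n * 2) / 2 ^+ (n * K))) * 2 ^+ (rate * n.+1) * 2 ^+ n)).
  by rewrite !ler_wpM2r ?exprn_ge0 // !mulr_ge0 ?exprn_ge0 ?invr_ge0 ?exprn_ge0.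
rewrite [leLHS](_ : _ = 2 ^+ d * 4 * e * 2 ^+ rate *
  (2 ^+ (n + d.+3 * d * n + d.+1 * n + n * 2 + rate * n + n) / 2 ^+ (n * K))); last first.
  by rewrite [(rate * n.+1)%N]mulnS !exprD; ring.
rewrite ler_piMr ?mulr_ge0 ?exprn_ge0 // ler_pdivrMr ?exprn_gt0 // mul1r ler_weXn2l ?ler1n //.
by rewrite /K /cluster_size; move: rate => r; nia.
Qed.

Lemma weight_bound n :
  (4 * (n < n0)%:R + n.+1%:R * (2 * A ^+ n) ^+ d * (expR (- (lambda * C%:R * n.+1%:R / 2 ^+ d.+1)) +
     2 ^+ (d.+1 * n) * (expR (volume K) * 4 * (2 ^+ n) ^+ 2 / (2 ^+ n) ^+ K))) *
  (bound n.+1 * (d%:R * A ^+ n.+1) ^+ p) <= M / 2 ^+ n.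
Proof.
rewrite edges_boundE [leLHS](_ : _ = cst *
  (4 * (n < n0)%:R * 2 ^+ (rate * n.+1) +
   n.+1%:R * (2 * A ^+ n) ^+ d * expR (- (lambda * C%:R * n.+1%:R / 2 ^+ d.+1)) * 2 ^+ (rate * n.+1) +
   n.+1%:R * (2 * A ^+ n) ^+ d *
   (2 ^+ (d.+1 * n) * (expR (volume K) * 4 * (2 ^+ n) ^+ 2 / (2 ^+ n) ^+ K)) * 2 ^+ (rate * n.+1))); last by ring.
rewrite /M /edge_constant -[leRHS]mulrA; apply: ler_wpM2l => //.
rewrite [leRHS](_ : _ = 4 * 2 ^+ (rate * n0 + n0) / 2 ^+ n + 2 ^+ d / 2 ^+ n +
  2 ^+ d * 4 * expR (volume K) * 2 ^+ rate / 2 ^+ n); last by ring.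
apply: lerD; last exact: term3.
by apply: lerD; [exact: term1|exact: term2].
Qed.

Lemma edge_constant_ge0 : 0 <= edge_constant.
Proof. by rewrite mulr_ge0 // !addr_ge0 // !mulr_ge0 ?exprn_ge0 ?expR_ge0. Qed.

End parameters.

Section edge_estimate.
Context {R : realType} {d : nat} {disp : measure_display} {Omega : measurableType disp}.
Variables (lambda : R) (P : probability Omega R) (N : {mfun Omega >-> config R d}).
Hypothesis lambda0 : 0 < lambda.
Hypothesis PN : poisson_process lambda P N.
Hypothesis d0 : (0 < d)%N.
Local Notation A := ((@base d)%:R : R).

(** Every factor in [weight_bound] is a power of 2.  The width factor [C] of the
hole cells and the cluster size [K] make the bad events rarer than any given power of
[2 ^ n], and [n0] is chosen last because its conditions involve both. *)
Lemma exists_parameters (p : nat) : exists C K n0 (M : R),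
  [/\ [/\ (0 < C)%N, (0 < K)%N & (1 < n0)%N],
    forall n, (n0 <= n)%N ->
      2 * (2 * d%:R * A * hole_width C n + 2) ^+ 3 <= 2 ^+ n :> R /\ 8 * K%:R * A <= 2 ^+ n :> R,
    0 <= M &
    forall (a : 'rV[R]_d) (B : set 'rV[R]_d) (b : R) n, measurable B -> lebesgue_rV B = b%:E ->
    (\int[P]_w (edges N a n.+1 B w * bad_weight N a C K n0 n w * (d%:R * A ^+ n.+1) ^+ p)%:E <=
      (M * b / 2 ^+ n)%:E)%E].
Proof.
pose K := @cluster_size d p.
pose rate := (d.+3 * (2 * d + 2 + p) + d.+3 * d + 2)%N.
have [C C0 HC] : exists2 C : nat, (0 < C)%N & rate%:R <= lambda * C%:R / 2 ^+ d.+1.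
  exists (Num.bound (rate%:R * 2 ^+ d.+1 / lambda)).+1 => //.
  rewrite ler_pdivlMr ?exprn_gt0 // [leRHS]mulrC -ler_pdivrMr //; apply/ltW; apply: lt_le_trans (archi_boundP _) _.
    by rewrite !mulr_ge0 ?exprn_ge0 // invr_ge0 ltW.
  by rewrite ler_nat.
have A0 := @base_gt0 R d.
pose q := 2 * d%:R * A * C%:R + 2 : R.
have q0 : 0 <= q by rewrite addr_ge0 // !mulr_ge0 // ltW.
have [n1 Hn] := natX_bound (2 * q ^+ 3 + 8 * K%:R * A).
exists C, K, n1.+2, (@edge_constant R d lambda p n1.+2); split=> //.
- move=> n /ltnW/ltnW/Hn; rewrite mulrDl => H.
  have n1p : 1 <= n.+1%:R ^+ 3 :> R by rewrite exprn_ege1 // ler1n.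
  have k0 : 0 <= 8 * K%:R * A by rewrite !mulr_ge0 // ltW.
  have q3 : 0 <= 2 * q ^+ 3 by rewrite mulr_ge0 // exprn_ge0.
  have p1 : 0 <= 8 * K%:R * A * n.+1%:R ^+ 3 by rewrite mulr_ge0 // exprn_ge0.
  have p2 : 0 <= 2 * q ^+ 3 * n.+1%:R ^+ 3 by rewrite mulr_ge0 // exprn_ge0.
  split; last by apply: le_trans H; apply: (@le_trans _ _ (8 * K%:R * A * n.+1%:R ^+ 3));
    [rewrite ler_peMr|rewrite lerDr].
  apply: le_trans H; apply: (@le_trans _ _ (2 * q ^+ 3 * n.+1%:R ^+ 3)); last by rewrite lerDl.
  rewrite -[leRHS]mulrA -exprMn ler_pM2l // /hole_width natrM.
  have t0 : 0 <= 2 * d%:R * A * (C%:R * n.+1%:R) by rewrite !mulr_ge0 // ltW.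
  rewrite lerXn2r ?nnegrE ?addr_ge0 ?mulr_ge0 //.
  rewrite [leRHS](_ : _ = 2 * d%:R * A * (C%:R * n.+1%:R) + 2 * n.+1%:R); last by rewrite /q; ring.
  by apply: lerD => //; rewrite ler_peMr // ler1n.
- exact: edge_constant_ge0.
move=> a B b n mB Bb.
have b0 : 0 <= b by rewrite -lee_fin -Bb; exact: measure_ge0.
have [mw w0 H] := edge_expect_bad_weight lambda0 PN d0 a (ltn0Sn n) mB Bb n1.+2 C0 (ltn0Sn _ : (0 < K)%N) n.
have y0 : 0 <= (d%:R * A ^+ n.+1) ^+ p by rewrite exprn_ge0 // mulr_ge0 // exprn_ge0 // ltW.
under eq_integral do rewrite EFinM muleC.
rewrite ge0_integralZl //; last 2 first.
- by apply/measurable_EFinP; apply: measurable_funM => //; exact: measurable_edges.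
- by move=> w _; rewrite lee_fin mulr_ge0 // edges_ge0.
apply: le_trans (lee_wpmul2l _ H) _; first by rewrite lee_fin.
rewrite -EFinM lee_fin.
have := weight_bound lambda0 n1.+2 HC n.
move=> /(ler_wpM2r b0); set c := (4 * _ + _) => H2.
rewrite [leLHS](_ : _ = c * (@edges_bound R d lambda n.+1 * (d%:R * A ^+ n.+1) ^+ p) * b); last by ring.
by apply: le_trans H2 _; rewrite mulrAC.
Qed.

End edge_estimate.

(** * Positive intensity of the level sets *)
Lemma exists_min (R : realType) (T : eqType) (s : seq T) (f : T -> \bar R) : s != [::] ->
  exists2 x, x \in s & forall y, y \in s -> (f x <= f y)%E.
Proof.
elim: s => // y s IH _; case: (eqVneq s [::]) => [->|/IH[x xs xmin]].
  by exists y; rewrite ?mem_head // => z; rewrite inE => /eqP->.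
have [yx|xy] := leP (f y) (f x).
  exists y; rewrite ?mem_head // => z; rewrite inE => /predU1P[->//|/xmin]; exact: le_trans.
exists x; first by rewrite inE xs orbT.
by move=> z; rewrite inE => /predU1P[->|/xmin //]; exact: ltW.
Qed.

Section intensity.
Context {R : realType} {d : nat} {disp : measure_display} {Omega : measurableType disp}.
Variables (lambda : R) (P : probability Omega R) (N : {mfun Omega >-> config R d}).
Hypothesis lambda0 : 0 < lambda.
Hypothesis PN : poisson_process lambda P N.
Hypothesis d0 : (0 < d)%N.
Local Notation point := ('rV[R]_d * R)%type.

Variable e : R.
(* [e8] limits the horizontal displacement in [hyp_dist_small] to 1/4. *)
Hypotheses (e0 : 0 < e) (e1 : e < 4^-1) (e8 : ((1 + e) ^+ 4) ^+ 2 <= (1 - e) ^+ 2 + 16^-1).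

Let delta : R := e / (4 * d%:R).
Let low : set point := cube (const_mx 2^-1) delta `*` `[1 - e, 1[%classic.
Let high : set point := cube (const_mx 2^-1) delta `*` `[1, 1 + e[%classic.
Let slab : set point := cube 0 1 `*` `[1 - e, 1[%classic.

Let dpos : 0 < d%:R :> R. Proof. by rewrite ltr0n. Qed.

Let delta0 : 0 < delta. Proof. by rewrite divr_gt0 // mulr_gt0. Qed.

Let ddelta : d%:R * delta = e / 4.
Proof. by rewrite /delta; field; rewrite gt_eqF. Qed.

Let delta4 : delta <= e / 4.
Proof. by rewrite -ddelta ler_peMl ?ler1n // ltW. Qed.

Let b0 : 0 < 1 - e.
Proof. by rewrite subr_gt0 (lt_trans e1) // invf_lt1 // ltr1n. Qed.

Let hlow : box_bounded low. Proof. exact: box_bounded_box. Qed.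
Let hhigh : box_bounded high. Proof. exact: box_bounded_box. Qed.

Let hslab : box_bounded (slab `\` low).
Proof. by apply: box_boundedD; [exact: box_bounded_box|exact: hlow.1]. Qed.

Let vol_pos (a b : R) : 0 < a -> a < b ->
  0 < vol lambda (cube (const_mx 2^-1 : 'rV[R]_d) delta `*` `[a, b[%classic).
Proof.
move=> a0 ab; rewrite mulr_gt0 // -lte_fin fineK.
  apply: lt_le_trans (hyp_box_ge _ (ltW delta0) a0 (ltW ab)).
  by rewrite lte_fin !mulr_gt0 ?subr_gt0 ?invr_gt0 ?exprn_gt0 // (lt_trans a0).
by rewrite ge0_fin_numE //; apply: box_bounded_volume; exact: box_bounded_box.
Qed.

Lemma hyp_dist_small (z w v : point) : 1 - e <= z.2 < 1 -> 1 <= w.2 < 1 + e ->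
  (forall j, `|w.1 ord0 j - z.1 ord0 j| <= delta) -> z.2 < v.2 ->
  (hyp_dist z v <= hyp_dist z w)%E ->
  (forall j, `|v.1 ord0 j - z.1 ord0 j| <= 4^-1) /\ v.2 < 2.
Proof.
move=> /andP[z1 z2] /andP[w1 w2] wz zv vw.
have z0 : 0 < z.2 by exact: lt_le_trans z1.
have v0 : 0 < v.2 by exact: lt_trans zv.
have S1 : 1 < 1 + e by rewrite ltrDl.
have S0 : 0 < 1 + e by rewrite addr_gt0.
have dw : eucl_norm (w.1 - z.1) <= z.2 * ((1 + e - (1 + e)^-1) / 2).
  apply: (@le_trans _ _ (d%:R * delta)); first by apply: eucl_norm_le => [|j]; [exact: ltW|rewrite !mxE].
  rewrite ddelta (_ : (1 + e - (1 + e)^-1) / 2 = e * ((2 + e) / (2 * (1 + e)))); last by field; rewrite gt_eqF.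
  rewrite mulrCA ler_pM2l //; apply: (@le_trans _ _ ((1 - e) * ((2 + e) / (2 * (1 + e))))).
    rewrite mulrA ler_pdivlMr ?mulr_gt0 //; have := e0; have := e1; nra.
  by rewrite ler_wpM2r // divr_ge0 ?mulr_ge0 ?addr_ge0 // ltW.
have w0 : 0 < w.2 by exact: lt_le_trans w1.
have G j : (v.1 ord0 j - z.1 ord0 j) ^+ 2 + v.2 ^+ 2 <= (1 - e) ^+ 2 + 16^-1.
  apply: le_trans (closer_bound j z0 (le_trans (ltW z2) w1) S1 dw v0 vw) _.
  apply: le_trans e8; rewrite lerXn2r ?nnegrE ?mulr_ge0 ?exprn_ge0 ?(ltW w0) ?(ltW S0) //.
  by rewrite [leRHS]exprSr; apply: ler_wpM2l; [exact/exprn_ge0/ltW|exact: ltW].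
have ev : (1 - e) ^+ 2 <= v.2 ^+ 2.
  by rewrite lerXn2r ?nnegrE ?(ltW b0) ?(ltW v0) // (le_trans z1) // ltW.
split=> [j|].
  rewrite -ler_sqr ?nnegrE // real_normK ?num_real //; have := G j.
  rewrite (_ : 4^-1 ^+ 2 = 16^-1); last by field.
  by move: ev; move: ((_ - _) ^+ 2) (v.2 ^+ 2) ((1 - e) ^+ 2) => x y t; lra.
rewrite -ltr_sqr ?nnegrE ?(ltW v0) //.
have := G (Ordinal d0); have := sqr_ge0 (v.1 ord0 (Ordinal d0) - z.1 ord0 (Ordinal d0)).
have : (1 - e) ^+ 2 <= 1 by rewrite exprn_ile1 ?(ltW b0) // gerBl ltW.
move: ((_ - _) ^+ 2) (v.2 ^+ 2) ((1 - e) ^+ 2) => x y t; lra.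
Qed.

(** The point of [high] keeps the parent of the point of [low] within horizontal
distance 1/4, and since [slab] contains no other point, the parent lies above
height 1: the edge crosses this height inside the unit cube. *)
Lemma level_nonempty (eta : config R d) : (exists2 z, pts eta z & low z) ->
  (exists2 w, pts eta w & high w) -> pts eta `&` (slab `\` low) = set0 ->
  (forall z z', (pts eta `&` low) z -> (pts eta `&` low) z' -> z = z') ->
  (level eta 0 `&` [set x | forall i, x ord0 i \in `[0%R, 1%R]]) !=set0.
Proof.
move=> [z ez lz] [w ew hw] empty single.
have [cz /=] := lz; rewrite in_itv /= => z12.
have [cw /=] := hw; rewrite in_itv /= => w12.
have zw : z.2 < w.2 by case/andP: z12 => _ ?; case/andP: w12 => ? _; lra.
have wz j : `|w.1 ord0 j - z.1 ord0 j| <= delta.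
  by have := cz j; have := cw j; rewrite !mxE ler_norml => /andP[? ?] /andP[? ?]; apply/andP; split; lra.
have small v := @hyp_dist_small z w v z12 w12 wz.
pose K : set point := cube (z.1 - const_mx 1) 2 `*` `[1 - e, 3[%classic.
have hK : box_bounded K by exact: box_bounded_box.
have e0' := e0; have e1' := e1.
have fin := box_bounded_finite eta hK.
have inK v : z.2 < v.2 -> (hyp_dist z v <= hyp_dist z w)%E -> K v.
  move=> zv vw; have [h1 h2] := small v zv vw; split.
    move=> j; have := h1 j; rewrite !mxE ler_norml => /andP[? ?]; apply/andP; split; lra.
  by rewrite /= in_itv /=; case/andP: z12 => ? _; apply/andP; split; lra.
pose s := [seq v <- fset_set (pts eta `&` K) | z.2 < v.2].
have ws : w \in s.
  by rewrite mem_filter zw in_fset_set //; apply/mem_set; split => //; exact: inK.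
have [|v vs vmin] := @exists_min R _ s (hyp_dist z); first by apply/eqP => E; rewrite E in ws.
have {vs}[zv ev Kv] : [/\ z.2 < v.2, pts eta v & K v].
  by move: vs; rewrite mem_filter in_fset_set // => /andP[? /set_mem[]].
have : is_parent eta z v.
  split=> // u eu zu; have [uw|wu] := leP (hyp_dist z u) (hyp_dist z w).
    apply: vmin; rewrite mem_filter zu in_fset_set //; apply/mem_set; split=> //; exact: inK.
  by apply: le_trans (vmin w ws) (ltW wu).
move=> pv; have := xgetPex z (ex_intro _ _ pv); rewrite -/(parent eta z).
set u := parent eta z => -[eu zu umin].
have [h1 h2] := small u zu (umin w ew zw).
have czj j : 2^-1 <= z.1 ord0 j < 2^-1 + e / 4.
  have := cz j; rewrite !mxE => /andP[-> h] /=; apply: lt_le_trans h _.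
  by rewrite lerD2l.
have u1 : 1 <= u.2.
  rewrite leNgt; apply/negP => u1.
  have su : slab u.
    split.
      move=> j; rewrite !mxE; have := h1 j; have := czj j; rewrite ler_norml => /andP[? ?] /andP[? ?].
      by apply/andP; split; lra.
    by rewrite /= in_itv /=; case/andP: z12 => ? _; apply/andP; split; lra.
  have [lu|nlu] := pselect (low u).
    by have := single z u (conj ez lz) (conj eu lu) => E; rewrite E ltxx in zu.
  by have : set0 u by rewrite -empty.
have z1 : z.2 < 1 by case/andP: z12.
have D0 : 0 < u.2 - z.2 by lra.
pose th := (1 - z.2) / (u.2 - z.2).
have th01 : 0 <= th <= 1.
  apply/andP; split; first by apply: divr_ge0; lra.
  by rewrite ler_pdivrMr // mul1r; lra.
exists ((1 - th) *: z.1 + th *: u.1); split.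
  exists z => //; exists th; first by rewrite /= in_itv.
  rewrite /segment_at expR0; congr pair.
  by rewrite -/u; have := lt0r_neq0 D0 => Dn; rewrite /th; field.
move=> j; rewrite in_itv /= !mxE; have := h1 j; have := czj j.
rewrite ler_norml; move: (z.1 ord0 j) (u.1 ord0 j) => x y /andP[a1 a2] /andP[b1 b2].
rewrite (_ : (1 - th) * x + th * y = x + th * (y - x)); last by ring.
case/andP: th01 => t0 t1; apply/andP; split; nra.
Qed.

(** The three counts required by [level_nonempty] are independent, and each has
positive probability. *)
Lemma alpha0_gt0_small_box : (0 < alpha0 P N)%E.
Proof.
pose S : 'I_3 -> set point := fun i => nth set0 [:: low; high; slab `\` low] i.
pose k : 'I_3 -> nat := fun i => nth 0%N [:: 1%N; 1%N; 0%N] i.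
have hS i : box_bounded (S i) by case: i => -[|[|[|//]]] ? /=.
have hv i : [/\ measurable (S i), S i `<=` @half_space R d & (hyp_volume (S i) < +oo)%E].
  have sH := box_bounded_half_space (hS i); split=> //; first exact: (hS i).1.
  by rewrite -hyp_measureE //; exact: box_bounded_volume.
have tS : trivIset setT S.
  have F (z : point) a b c b' : (cube a b `*` `[1 - e, 1[%classic) z ->
      (cube c b' `*` `[1, 1 + e[%classic) z -> False.
    by move=> [_ /=]; rewrite in_itv /= => /andP[_ h] [_ /=]; rewrite in_itv /= => /andP[h' _]; have := lt_le_trans h h'; rewrite ltxx.
  move=> i j _ _ [z []]; case: i => -[|[|[|//]]] i3; case: j => -[|[|[|//]]] j3; rewrite /S /=;
    (try by move=> *; apply/val_inj).
  - by move=> h1 h2; case: (F _ _ _ _ _ h1 h2).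
  - by move=> h1 [].
  - by move=> h1 h2; case: (F _ _ _ _ _ h2 h1).
  - by move=> h1 [h2 _]; case: (F _ _ _ _ _ h2 h1).
  - by move=> [].
  - by move=> [h2 _] h1; case: (F _ _ _ _ _ h2 h1).
pose E := \bigcap_i [set w | count_in (S i) (N w) = (k i)%:R%:E].
have PE : (0 < P E)%E.
  rewrite PN.2 //.
  have -> : (\prod_i P [set w | count_in (S i) (N w) = (k i)%:R%:E] = (\prod_i pois (vol lambda (S i)) (k i))%:E)%E.
    rewrite -prodEFin; apply: eq_bigr => i _.
    by rewrite -(prob_npts lambda0 PN (k i) (hS i)) npts_eqE.
  rewrite lte_fin prodr_gt0 // => i _; rewrite /pois mulr_gt0 ?expR_gt0 // divr_gt0 //.
  case: i => -[|[|[|//]]] ? /=; rewrite /S /k /= ?expr0 // expr1; apply: vol_pos => //; rewrite ?gtrBl ?ltrDl //.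
have mE : measurable E.
  by apply: fin_bigcap_measurable => // i _; rewrite -npts_eqE //; exact: measurable_npts_eq.
apply: lt_le_trans PE _; rewrite -[X in (X <= _)%E]mul1e -(setIT E) -integral_indic //.
rewrite mul1e /alpha0; apply: le_integral_ge0 => w _; first by rewrite lee_fin.
rewrite indicE; case: (boolP (w \in E)) => [/set_mem Ew|_]; last first.
  by rewrite /counting; case: asboolP => _; [rewrite lee_fin|rewrite leey].
have nE i : npts N (S i) w = k i.
  by have := Ew i I; rewrite -npts_eqE.
have pick (A : set point) : box_bounded A -> npts N A w = 1%N ->
    exists z, (pts (N w) `&` A) = [set z].
  move=> hA; rewrite /npts => /eqP/cardfs1P[z zE]; exists z.
  rewrite -[LHS]fset_setK; last exact: box_bounded_finite.
  by rewrite zE; apply/seteqP; split=> x /=; rewrite inE; [move/eqP|move=> ->].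
have [z zE] := pick _ hlow (nE (Ordinal (isT : (0 < 3)%N))).
have [v vE] := pick _ hhigh (nE (Ordinal (isT : (1 < 3)%N))).
have [ez lz] : (pts (N w) `&` low) z by rewrite zE.
have [ev hv'] : (pts (N w) `&` high) v by rewrite vE.
have ne : (level (N w) 0 `&` [set x | forall i, x ord0 i \in `[0%R, 1%R]]) !=set0.
  apply: level_nonempty; [by exists z|by exists v| |].
    have := nE (Ordinal (isT : (2 < 3)%N)); rewrite /npts /= => /eqP; rewrite cardfs_eq0 => /eqP E0.
    rewrite -[LHS]fset_setK; last exact: box_bounded_finite.
    by rewrite E0; apply/seteqP; split=> x //=; rewrite inE.
  by rewrite zE => x y /= -> ->.
rewrite /counting; case: asboolP => [fin|_]; last by rewrite leey.
rewrite lee_fin ler1n cardfs_gt0; case: ne => x xE; apply/fset0Pn; exists x.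
by rewrite in_fset_set //; exact/mem_set.
Qed.

End intensity.

Lemma alpha0_gt0 (R : realType) (d : nat) (disp : measure_display) (Omega : measurableType disp)
    (lambda : R) (P : probability Omega R) (N : {mfun Omega >-> config R d}) :
  0 < lambda -> poisson_process lambda P N -> (0 < d)%N -> (0 < alpha0 P N)%E.
Proof.
move=> lambda0 PN d0; apply: (@alpha0_gt0_small_box R d disp Omega lambda P N lambda0 PN d0 (256^-1)).
- lra.
- lra.
- lra.
Qed.

Import HBNNSimple.

(** * Integration against the Palm measure *)
Section lower_integrals.
Context d (T : measurableType d) (R : realType) (mu : {measure set T -> \bar R}).
Local Open Scope ereal_scope.

(** The integral of a nonnegative function is a supremum over simple functions
below it; it is attained by the supremum of a maximizing sequence.  Hence such
integrals are superadditive without any measurability. *)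
Lemma measurable_minorant (f : T -> \bar R) : (forall x, 0 <= f x) ->
  exists g : T -> \bar R, [/\ measurable_fun setT g, forall x, 0 <= g x <= f x &
    \int[mu]_x f x = \int[mu]_x g x].
Proof.
move=> f0.
pose S := [set sintegral mu h | h in [set h : {nnsfun T >-> R} | forall x, (h x)%:E <= f x]].
have SE : \int[mu]_x f x = ereal_sup S by rewrite ge0_integralTE.
have S0 : S != set0.
  by apply/set0P; exists (sintegral mu (nnsfun0 : {nnsfun T >-> R})); exists nnsfun0.
have [u Su uS] := ereal_sup_seq S0.
have /choice[h hP] : forall i, exists h : {nnsfun T >-> R}, (forall x, (h x)%:E <= f x) /\ sintegral mu h = u i.
  by move=> i; have [h ? ?] := Su i; exists h.
pose g x := esups (fun i => (h i x)%:E) 0%N.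
have hg i x : (h i x)%:E <= g x by apply: ereal_sup_ubound; exists i.
have gf x : g x <= f x by apply: ge_ereal_sup => _ [i _ <-]; have [] := hP i.
have g0 x : 0 <= g x by apply: le_trans (hg 0%N x); rewrite lee_fin.
exists g; split=> [|x|]; last 2 first.
- by rewrite g0 gf.
- apply/eqP; rewrite eq_le; apply/andP; split; last exact: le_integral_ge0.
  rewrite SE -(cvg_lim _ uS) //; apply: lime_le; first by apply/cvg_ex; exists (ereal_sup S).
  near=> i; have [_ <-] := hP i; rewrite -integralT_nnsfun.
  by apply: le_integral_ge0 => x _; [rewrite lee_fin|exact: hg].
have mh i : measurable_fun setT (fun x => (h i x)%:E).
  by apply/measurable_EFinP; exact: measurable_funPT.
exact: (measurable_fun_esups mh 0%N).
Unshelve. all: by end_near. Qed.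

End lower_integrals.

Lemma mule_esum_le (R : realType) (T : choiceType) (I : set T) (a : T -> \bar R) (r : R) :
  0 <= r -> (forall x, 0 <= a x)%E ->
  (r%:E * (\esum_(i in I) a i) <= \esum_(i in I) (r%:E * a i))%E.
Proof.
move=> r0 a0; move: r0; rewrite le_eqVlt => /predU1P[<-|r0].
  by rewrite mul0e; apply: esum_ge0 => i _; rewrite mul0e.
rewrite /esum -ereal_sup_pZl //; apply: ge_ereal_sup => _ [_ [A AI <-] <-].
apply: ereal_sup_ubound; exists A => //.
by rewrite ge0_mule_fsumr.
Qed.

Section palm_integral.
Context {R : realType} {d : nat} {disp : measure_display} {Omega : measurableType disp}.
Variables (P : probability Omega R) (N : {mfun Omega >-> config R d}).
Variables (t : R) (B : set 'rV[R]_d) (c : R).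
Hypothesis c0 : 0 <= c.
Hypothesis cE : ((alpha0 P N * (expR (- (d%:R * t)))%:E * lebesgue_rV B)^-1 = c%:E)%E.
Local Open Scope ereal_scope.

Let count (G : set (config R d)) w : \bar R :=
  \esum_(s in level (N w) t `&` B) (\1_G (translate (- s) (N w)))%:E.

Let count_ge0 G w : 0 <= count G w.
Proof. by apply: esum_ge0 => s _; rewrite lee_fin. Qed.

Let palmE G : palm P N t B G = c%:E * \int[P]_w count G w.
Proof. by rewrite /palm cE. Qed.

Let palm0 : palm P N t B set0 = 0.
Proof.
rewrite palmE (_ : count set0 = cst 0) ?integral0 ?mule0 //.
by apply/funext => w; apply: esum1 => s _; rewrite indic0.
Qed.

Let sintegral_palm (h : {nnsfun config R d >-> R}) :
  sintegral (palm P N t B) h =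
  \sum_(x <- fset_set (range h)) x%:E * palm P N t B (h @^-1` [set x]).
Proof.
rewrite /sintegral; apply: fsbigTE => x; rewrite in_fset_set; last exact: fimfunP.
move=> xh; rewrite (_ : _ @^-1` _ = set0) ?palm0 ?mule0 //.
by apply/seteqP; split=> // eta /= E; move/negP: xh; apply; apply/mem_set; exists eta.
Qed.

(** [palm] is only a set function, so its integral is a supremum over simple
functions below [G].  For each of them, the counts of its level sets, weighted by
its values, add up to at most [Psi], and the lower integrals that define [palm]
are superadditive. *)
Lemma palm_integral_le (G : config R d -> \bar R) (Psi : Omega -> \bar R) :
  (forall eta, 0 <= G eta) ->
  (forall w, (\esum_(s in level (N w) t `&` B) G (translate (- s) (N w))) <= Psi w) ->
  \int[palm P N t B]_eta G eta <= c%:E * \int[P]_w Psi w.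
Proof.
move=> G0 GPsi; rewrite /integral patch_setT.
have nn : 0 <= ereal_sup [set sintegral (palm P N t B) h | h in
    [set h : {nnsfun config R d >-> R} | forall x, (h x)%:E <= (G ^\-) x]].
  apply: ereal_sup_ubound; exists nnsfun0 => //.
    by move=> eta; rewrite funenegE le_max lexx orbT.
  rewrite sintegral_palm big1_seq // => x /andP[_].
  rewrite in_fset_set; last exact: fimfunP.
  by move=> /set_mem [eta _ <-]; rewrite mul0e.
apply: le_trans (geeDl _ _) _; first by rewrite oppe_le0.
apply: ge_ereal_sup => _ [h hG <-]; rewrite sintegral_palm.
have {}hG eta : (h eta)%:E <= G eta.
  by apply: le_trans (hG eta) _; rewrite funeposE ge_max lexx G0.
set X := fset_set _.
have X0 x : x \in X -> (0 <= x)%R.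
  by rewrite in_fset_set; [move=> /set_mem [eta _ <-]|exact: fimfunP].
have /choice[g gP] : forall x, exists g : Omega -> \bar R, [/\ measurable_fun setT g,
    forall w, 0 <= g w <= count (h @^-1` [set x]) w &
    \int[P]_w count (h @^-1` [set x]) w = \int[P]_w g w].
  by move=> x; apply: measurable_minorant => w; exact: count_ge0.
have g0 x w : 0 <= g x w by have [_ /(_ w)/andP[]] := gP x.
have gc x w : g x w <= count (h @^-1` [set x]) w by have [_ /(_ w)/andP[]] := gP x.
have mg x : measurable_fun setT (g x) by have [] := gP x.
have -> : \sum_(x <- X) x%:E * palm P N t B (h @^-1` [set x]) =
    c%:E * (\int[P]_w (\sum_(x <- X) `|x|%:E * g x w)).
  rewrite ge0_integral_sum //; last 2 first.
  - by move=> x; apply: measurable_funeM.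
  - by move=> x w _; rewrite mule_ge0.
  rewrite ge0_sume_distrr => [|x _]; last by apply: integral_ge0 => w _; rewrite mule_ge0.
  rewrite big_seq [RHS]big_seq; apply: eq_bigr => x xX.
  have [_ _ cg] := gP x.
  by rewrite palmE cg ge0_integralZl // ger0_norm ?X0 // muleCA.
apply: lee_wpmul2l; first by rewrite lee_fin.
apply: le_integral_ge0 => w _; first by apply: sume_ge0 => x _; rewrite mule_ge0.
apply: le_trans (GPsi w).
apply: (@le_trans _ _ (\sum_(x <- X) \esum_(s in level (N w) t `&` B)
    (`|x|%:E * (\1_(h @^-1` [set x]) (translate (- s) (N w)))%:E))).
  apply: lee_sum => x _; apply: le_trans (mule_esum_le _ _ _) => //.
  by apply: lee_wpmul2l.
rewrite -esum_sum => [|s x _ _]; last by rewrite mule_ge0.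
apply: le_esum => s _; apply: le_trans (hG _); set eta := translate _ _.
have hX : h eta \in X by rewrite in_fset_set; [apply/mem_set; exists eta|exact: fimfunP].
rewrite (big_fsetD1 (h eta)) //= big1_seq ?adde0.
  by rewrite indicE mem_set //= mule1 ger0_norm.
move=> x /andP[_]; rewrite !inE => /andP[/eqP xh _].
by rewrite indicE memNset ?mule0 //= => E; apply: xh.
Qed.

End palm_integral.

(** * Domination of the backward deviation *)
Section translation.
Context {R : realType} {d : nat}.
Local Notation point := ('rV[R]_d * R)%type.
Variables (eta : config R d) (a s : 'rV[R]_d).

Lemma cube_shift (b x : 'rV[R]_d) (r : R) : cube (b - s) r (x - s) <-> cube b r x.
Proof. by split=> H j; have := H j; rewrite !mxE; lra. Qed.

Lemma corner_shift i n L (m : @cell_index d n) : corner (a - s) i L m = corner a i L m - s.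
Proof. by apply/rowP => j; rewrite !mxE; ring. Qed.

Let cell_shift (b : 'rV[R]_d) r (I : set R) :
  pts (translate (- s) eta) `&` (cube (b - s) r `*` I) =
  Defs.shift (- s) @` (pts eta `&` (cube b r `*` I)).
Proof.
apply/seteqP; split=> [z [[z0 ez <-] [/= Cz Iz]]|_ [z [ez [Cz Iz]] <-]].
  by exists z0 => //; split=> //; split=> //; exact/cube_shift.
by split; [exists z|split=> //=; exact/cube_shift].
Qed.

(** Recentring the cells makes the bad scales of a translated configuration those
of the original one, so that one environment serves all points of a cube. *)
Lemma bad_translate C K n0 n : bad C K n0 (translate (- s) eta) (a - s) n -> bad C K n0 eta a n.
Proof.
case=> [nn0|[k H]]; [by left|right; exists k].
case: H => [[m H]|[m [j H]]]; [left; exists m|right; exists m, j].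
  move: H; rewrite /hole_cell corner_shift cell_shift => E.
  apply/seteqP; split=> // z Ez; have : set0 (Defs.shift (- s) z) by rewrite -E; exists z.
  by [].
move: H; rewrite /cluster_cell corner_shift addrAC cell_shift => H.
have fin : finite_set (pts eta `&` cluster_cell K a m j).
  apply: box_bounded_finite; apply: box_bounded_box.
  by rewrite ltr_pwDl ?scale_gt0 // mulr_ge0 // ltW // cluster_height_gt0.
by apply: leq_trans H _; rewrite fset_set_image //; exact: leq_imfset_card.
Qed.

End translation.

Section domination.
Context {R : realType} {d : nat} {disp : measure_display} {Omega : measurableType disp}.
Variable N : {mfun Omega >-> config R d}.
Local Notation point := ('rV[R]_d * R)%type.
Local Notation A := ((@base d)%:R : R).
Variables (C K n0 : nat).
Hypothesis d0 : (0 < d)%N.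
Hypotheses (C0 : (0 < C)%N) (K0 : (0 < K)%N).
Hypothesis n0P : forall n, (n0 <= n)%N ->
  2 * (2 * d%:R * A * hole_width C n + 2) ^+ 3 <= 2 ^+ n :> R /\ 8 * K%:R * A <= 2 ^+ n :> R.
Hypothesis n02 : (1 < n0)%N.

Lemma edges_ge1 (w : Omega) a t (z z' : point) s : pts (N w) z -> pts (N w) z' ->
  below_box a t z -> above_box a t z' -> s = edge_at z z' 1 -> z.2 < z'.2 ->
  1 <= edges N a t [set s] w.
Proof.
move=> ez ez' bz az sE zz'.
have f1 := box_bounded_finite (N w) (below_box_bounded a t).
have f2 := box_bounded_finite (N w) (above_box_bounded a t).
have i1 : z \in fset_set (pts (N w) `&` below_box a t) by rewrite in_fset_set //; exact/mem_set.
have i2 : z' \in fset_set (pts (N w) `&` above_box a t) by rewrite in_fset_set //; exact/mem_set.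
rewrite /edges /pairs (big_fsetD1 z) //= (big_fsetD1 z') //= indicE mem_set.
  rewrite -!addrA lerDl addr_ge0 // ?sumr_ge0 // => *; exact: sumr_ge0.
split; first by split.
by rewrite /= /crossing /= expRN lnK ?posrE ?subr_gt0.
Qed.

(** A pair has only one crossing point. *)
Lemma edges_sum_le (w : Omega) a t (B : set 'rV[R]_d) (r : seq 'rV[R]_d) : uniq r ->
  (forall s, s \in r -> B s) ->
  \sum_(s <- r) edges N a t [set s] w <= edges N a t B w.
Proof.
move=> ur rB; rewrite /edges /pairs exchange_big; apply: ler_sum => z _ /=.
rewrite exchange_big; apply: ler_sum => z' _ /=.
set x := crossing (z, z').
have [xr|xr] := boolP (x \in r); last first.
  rewrite big1_seq // => s /andP[_ sr]; rewrite indicE memNset // => -[_ /= E].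
  by move/negP: xr; apply; rewrite /x E.
rewrite (bigD1_seq x) //= big1_seq ?addr0.
  rewrite !indicE ler_nat; case: (boolP (_ \in _)) => // /set_mem[H _].
  by rewrite mem_set //; split=> //; exact: rB.
by move=> s /andP[sx _]; rewrite indicE memNset // => -[_ /= E]; move/eqP: sx; apply.
Qed.

Variables (p : R) (q : nat).
Hypotheses (p1 : 1 <= p) (pq : p <= q%:R).

Definition edge_cost a n B w : \bar R :=
  (edges N a n.+1 B w * bad_weight N a C K n0 n w * (d%:R * A ^+ n.+1) ^+ q)%:E.

Let dA1 n : 1 <= d%:R * A ^+ n :> R.
Proof.
have A1 : 1 <= A by apply: le_trans (@base_ge8 R d); lra.
have h := exprn_ege1 n A1; apply: (le_trans h).
by rewrite ler_peMl ?ler1n // (le_trans ler01).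
Qed.

Let dA0 n : 0 <= d%:R * A ^+ n :> R.
Proof. exact: le_trans (dA1 n). Qed.

Let bad_weight_ge0 a n w : 0 <= bad_weight N a C K n0 n w.
Proof.
rewrite /bad_weight addr_ge0 // sumr_ge0 // => k _; rewrite addr_ge0 //.
  by apply: sumr_ge0 => m _; exact: exprn_ge0.
by apply: sumr_ge0 => m _; apply: sumr_ge0 => j _; rewrite divr_ge0 ?exprn_ge0.
Qed.

Lemma edge_cost_ge0 a n B w : (0 <= edge_cost a n B w)%E.
Proof.
apply: mulr_ge0; last exact: exprn_ge0.
by apply: mulr_ge0; [exact: edges_ge0|exact: bad_weight_ge0].
Qed.

Let cost_ge a n B w : 1 <= edges N a n.+1 B w -> bad C K n0 (N w) a n ->
  (((d%:R * A ^+ n.+1) ^+ q)%:E <= edge_cost a n B w)%E.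
Proof.
move=> e1 /bad_weight_ge1 b1; rewrite lee_fin ler_peMl ?exprn_ge0 //.
by rewrite -[1]mulr1; exact: ler_pM.
Qed.

(** Let [n.+1] be the first index from which on no scale is bad.  Then scale [n]
is bad, [good_chain] bounds every descending trajectory at window [n.+1], and the
term of index [n] alone dominates; without such an index the series diverges. *)
Lemma MBD_le_edge_cost (w : Omega) (a s : 'rV[R]_d) (h : R) : 0 < h ->
  (forall z, pts (N w) z -> z.2 != 1) ->
  (forall j, `|s ord0 j - a ord0 j| <= 1) ->
  (MBD (translate (- s) (N w)) (- h) 0 0 `^ p <= \sum_(0 <= n <oo) edge_cost a n [set s] w)%E.
Proof.
move=> h0 no1 sa; have p0 : 0 < p by exact: lt_le_trans p1.
have sum0 : (0 <= \sum_(0 <= n <oo) edge_cost a n [set s] w)%E.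
  by apply: nneseries_ge0 => n _ _; exact: edge_cost_ge0.
rewrite /MBD; case: asboolP => [[x0 dx0]|_]; last by rewrite poweR0r // gt_eqF.
set eta := translate (- s) (N w).
have chain x' : descendants eta (- h) 0 0 x' -> exists m (c : nat -> point), [/\
  forall l, (l <= m)%N -> pts eta (c l) /\ is_parent eta (c l) (c l.+1),
  (c m).2 < 1 < (c m.+1).2, 0 = edge_at (c m) (c m.+1) 1 &
  (CFD eta (- h) 0 x' <= (\sum_(l < m.+1) eucl_norm ((c l.+1).1 - (c l).1))%:E)%E].
  move=> [lx ax]; have := CFD_le_chain lx _ ax.
  by rewrite expR0; apply => _ [z ez <-] /=; exact: no1.
have s0 j : `|(0 : 'rV[R]_d) ord0 j - (a - s) ord0 j| <= 1.
  by have := sa j; rewrite !mxE sub0r opprB.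
have back (z : point) : pts eta z -> pts (N w) (z.1 + s, z.2).
  by move=> [z0 ez0 <-]; rewrite /= subrK -surjective_pairing.
have [m0 [c0 [ch0 cross0 edge0 _]]] := chain _ dx0.
have edges1 t : (forall j, `|(c0 m0).1 ord0 j - (a - s) ord0 j| < 2 * A ^+ t) ->
    (forall j, `|(c0 m0.+1).1 ord0 j - (a - s) ord0 j| < 2 * A ^+ t) ->
    A ^- t <= (c0 m0).2 -> (c0 m0.+1).2 < A ^+ t -> 1 <= edges N a t [set s] w.
  move=> h1 h2 h3 h4; have [ez [ez' lt _]] := ch0 m0 (leqnn _).
  have win (z : point) : (forall j, `|z.1 ord0 j - (a - s) ord0 j| < 2 * A ^+ t) -> window_cube a t (z.1 + s).
    move=> H j; have := H j; rewrite !mxE ltr_norml; move: (z.1 ord0 j) (a ord0 j) (s ord0 j) (A ^+ t) => x1 x2 x3 x4.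
    by move=> /andP[u1 u2]; apply/andP; split; lra.
  case/andP: cross0 => lt1 gt1.
  apply: (@edges_ge1 w a t ((c0 m0).1 + s, (c0 m0).2) ((c0 m0.+1).1 + s, (c0 m0.+1).2)) => //.
  - exact: back.
  - exact: back.
  - by split; [exact: win|rewrite /= in_itv /= h3].
  - by split; [exact: win|rewrite /= in_itv /= (ltW gt1)].
  - move: edge0; rewrite /edge_at /= => e0; rewrite [X in _ *: X](_ : _ = (c0 m0.+1).1 - (c0 m0).1).
      by rewrite addrA -e0 add0r.
    by apply/rowP => j; rewrite !mxE; ring.
have [[i1 Hi1]|inf] := pselect (exists i0, forall n, (i0 <= n)%N -> ~ bad C K n0 (N w) a n).
  have ex : exists i0, `[< forall n, (i0 <= n)%N -> ~ bad C K n0 (N w) a n >] by exists i1; apply/asboolP.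
  case: (ex_minnP ex) => i0 /asboolP good mini.
  have good' n : (i0 <= n)%N -> ~ bad C K n0 eta (a - s) n by move=> /good H /bad_translate.
  have gc := good_chain d0 C0 K0 n0P n02 good'.
  case: i0 good mini good' gc => [|n] good mini good' gc.
    by exfalso; apply: (good 0%N) => //; left; rewrite (leq_trans _ n02).
  have badn : bad C K n0 (N w) a n.
    apply: contrapT => nb; have := mini n; rewrite ltnn => H.
    suff : false by []. apply: H; apply/asboolP => k; rewrite leq_eqVlt => /predU1P[<- //|]; exact: good.
  have e1 : 1 <= edges N a n.+1 [set s] w.
    have [_ w1 w2 l1 l2] := gc _ _ _ ch0 cross0 edge0 s0; apply: edges1 => // j.
    by apply: lt_trans (w1 j) _; rewrite mulr_natl mulr2n ltrDl exprn_gt0 // base_gt0.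
  apply: (@le_trans _ _ (edge_cost a n [set s] w)); last first.
    apply: le_trans (nneseries_lim_ge n.+1 _) => //; last by move=> k _ _; exact: edge_cost_ge0.
    rewrite big_nat_recr //= leeDr // sume_ge0 // => k _; exact: edge_cost_ge0.
  apply: le_trans (cost_ge e1 badn).
  have Mle : (ereal_sup (CFD eta (- h) 0 @` descendants eta (- h) 0 0) <= (d%:R * A ^+ n.+1)%:E)%E.
    apply: ge_ereal_sup => _ [x' dx' <-]; have [m [c [ch cross edge le]]] := chain _ dx'.
    by apply: le_trans le _; rewrite lee_fin; have [] := gc _ _ _ ch cross edge s0.
  have M0 : (0 <= ereal_sup (CFD eta (- h) 0 @` descendants eta (- h) 0 0))%E.
    apply: (@le_trans _ _ (CFD eta (- h) 0 x0)); last by apply: ereal_sup_ubound; exists x0.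
    rewrite /CFD; case: ifP => // _; apply: integral_ge0 => r _; rewrite lee_fin; exact: eucl_norm_ge0.
  apply: le_trans (gt0_ler_poweR (ltW p0) _ _ Mle) _.
  - by rewrite in_itv /= M0 leey.
  - by rewrite in_itv /= leey andbT lee_fin.
  rewrite poweR_EFin lee_fin -(powR_mulrn q (dA0 n.+1)).
  exact: ler_powR.
(* With infinitely many bad scales, the right-hand side is infinite: the edge
that crosses height 1 lies in all sufficiently large boxes. *)
suff -> : (\sum_(0 <= n <oo) edge_cost a n [set s] w = +oo)%E by rewrite leey.
pose X := \sum_j `|(c0 m0).1 ord0 j - (a - s) ord0 j| +
  \sum_j `|(c0 m0.+1).1 ord0 j - (a - s) ord0 j| + (c0 m0).2^-1 + (c0 m0.+1).2.
have [ez [ez' lt _]] := ch0 m0 (leqnn _).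
have y0 : 0 < (c0 m0).2 by have := pts_half_space ez.
have y1 : 0 < (c0 m0.+1).2 by have := pts_half_space ez'.
have S0 (v : 'rV[R]_d) : 0 <= \sum_j `|v ord0 j - (a - s) ord0 j| by apply: sumr_ge0.
have late n : (Num.bound X <= n)%N -> 1 <= edges N a n.+1 [set s] w.
  move=> Xn; have XA : X < A ^+ n.+1.
    apply: lt_le_trans (upper_nthrootP (leqW Xn)) _.
    by rewrite lerXn2r ?nnegrE ?(ltW base_gt0) //; apply: le_trans (@base_ge8 R d); lra.
  have A0 : 0 < A ^+ n.+1 by rewrite exprn_gt0 // base_gt0.
  have iy : 0 < (c0 m0).2^-1 by rewrite invr_gt0.
  have sj (v : 'rV[R]_d) j : `|v ord0 j - (a - s) ord0 j| <= \sum_j `|v ord0 j - (a - s) ord0 j|.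
    by rewrite (bigD1 j) //= lerDl sumr_ge0.
  have S1 := S0 (c0 m0).1; have S2 := S0 (c0 m0.+1).1.
  apply: edges1 => [j|j||].
  - by apply: le_lt_trans (sj _ j) _; move: XA; rewrite /X; move: S1 S2 iy y1 A0; lra.
  - by apply: le_lt_trans (sj _ j) _; move: XA; rewrite /X; move: S1 S2 iy y1 A0; lra.
  - rewrite -[leRHS]invrK lef_pV2 ?posrE //; move: XA; rewrite /X; move: S1 S2 iy y1 A0; lra.
  - by move: XA; rewrite /X; move: S1 S2 iy y1 A0; lra.
have big M : exists k, (M%:R%:E <= \sum_(0 <= n < k) edge_cost a n [set s] w)%E.
  elim: M => [|M [k Mk]]; first by exists 0%N; rewrite big_nil.
  have [n kn badn] : exists2 n, (maxn k (Num.bound X) <= n)%N & bad C K n0 (N w) a n.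
    apply: contrapT => H; apply: inf; exists (maxn k (Num.bound X)) => n kn badn.
    by apply: H; exists n.
  move: kn; rewrite geq_max => /andP[kn Xn].
  exists n.+1; rewrite big_nat_recr //= -natr1 EFinD; apply: leeD.
    apply: le_trans Mk _; rewrite (big_cat_nat (leq0n k) kn) /=.
    by rewrite leeDl // sume_ge0 // => i _; exact: edge_cost_ge0.
  apply: le_trans (cost_ge (late n Xn) badn); rewrite lee_fin exprn_ege1 //.
apply/eqyP => r r0; have [k Hk] := big (Num.bound r).
apply: le_trans (nneseries_lim_ge k _); last by move=> i _ _; exact: edge_cost_ge0.
by apply: le_trans Hk; rewrite lee_fin ltW // archi_boundP // ltW.
Qed.

End domination.

(** * The moment bound *)
Section integer_cubes.
Context {R : realType} {d : nat}.
Local Notation lattice := 'rV[int]_d.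

Definition lattice_point (q : lattice) : 'rV[R]_d := \row_j (q ord0 j)%:~R.

(** The unit cubes with integer corners are enumerated by [nat] so that sums over
them are series; a code of no lattice point gets the empty set. *)
Definition cube_corner (i : nat) : 'rV[R]_d :=
  if @pickle_inv lattice i is Some q then lattice_point q else 0.
Definition unit_cube (i : nat) : set 'rV[R]_d :=
  if @pickle_inv lattice i is Some q then cube (lattice_point q) 1 else set0.

Let floorE (q : lattice) (x : 'rV[R]_d) : cube (lattice_point q) 1 x -> q = \row_j Num.floor (x ord0 j).
Proof.
move=> H; apply/rowP => j; rewrite mxE; apply/esym/floor_def.
by have := H j; rewrite mxE intrD.
Qed.

Lemma unit_cube_trivIset : trivIset setT unit_cube.
Proof.
move=> i j _ _ [x []]; rewrite /unit_cube.
have := @pickle_invK lattice i; have := @pickle_invK lattice j.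
case: (pickle_inv i) => // q; case: (pickle_inv j) => // q' /= qj qi.
by move=> /floorE E /floorE E'; rewrite -qi -qj E E'.
Qed.

Lemma unit_cube_cover (x : 'rV[R]_d) : exists i, unit_cube i x.
Proof.
exists (choice.pickle (\row_j Num.floor (x ord0 j) : lattice)); rewrite /unit_cube pickleK_inv => j.
by have := floor_itv (x ord0 j); rewrite intrD !mxE.
Qed.

Lemma unit_cube_dist i x : unit_cube i x -> forall j, `|x ord0 j - cube_corner i ord0 j| <= 1.
Proof.
rewrite /unit_cube /cube_corner; case: (pickle_inv i) => // q H j.
by have := H j; rewrite ler_norml => /andP[? ?]; apply/andP; split; lra.
Qed.

Lemma measurable_unit_cube i : measurable (unit_cube i).
Proof. by rewrite /unit_cube; case: pickle_inv => // q; exact: measurable_cube. Qed.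

End integer_cubes.

Section no_vertex.
Context {R : realType} {d : nat} {disp : measure_display} {Omega : measurableType disp}.
Variables (lambda : R) (P : probability Omega R) (N : {mfun Omega >-> config R d}).
Hypothesis PN : poisson_process lambda P N.
Local Notation point := ('rV[R]_d * R)%type.

Let plane : set point := setT `*` [set 1].

(** The null event excluded in [CFD_le_chain]. *)
Definition vertex_at_1 : set Omega := [set w | count_in plane (N w) != 0%:R%:E].

Let mplane : measurable plane.
Proof. by apply: measurableX => //; exact: measurable_set1. Qed.

Let plane_half_space : plane `<=` @half_space R d.
Proof. by move=> z [_ /=]; rewrite /half_space /= => ->. Qed.

Lemma measurable_vertex_at_1 : measurable vertex_at_1.
Proof.
have -> : vertex_at_1 = (fun w => count_in plane (N w)) @^-1` (~` [set 0%:R%:E]).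
  by apply/seteqP; split=> w /= /eqP.
rewrite -[X in measurable X]setTI; apply: measurable_count_in => //.
by apply: measurableC; exact: emeasurable_set1.
Qed.

Lemma prob_vertex_at_1 : P vertex_at_1 = 0%E.
Proof.
have h0 : hyp_volume plane = 0%E.
  by rewrite -(hyp_measureE plane_half_space); exact: hyp_horizontal.
have E : P (~` vertex_at_1) = 1%E.
  have -> : ~` vertex_at_1 = [set w | count_in plane (N w) = 0%:R%:E].
    apply/seteqP; split=> w; rewrite /vertex_at_1 /=.
      by move=> /negP; rewrite negbK => /eqP.
    by move=> ->; apply/negP; rewrite negbK.
  rewrite PN.1 // ?h0 ?ltry // mulr0 poisson_probE // /pois expr0 fact0 divr1 mul1r oppr0.
  by rewrite expR0.
rewrite -[vertex_at_1]setCK probability_setC ?E ?subee //.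
by apply: measurableC; exact: measurable_vertex_at_1.
Qed.

Lemma not_vertex_at_1 w : ~ vertex_at_1 w -> forall z, pts (N w) z -> z.2 != 1.
Proof.
move=> /negP; rewrite negbK => /eqP c0 z ez; apply/eqP => z1.
have zp : (pts (N w) `&` plane) z by split.
move: c0; rewrite /count_in /counting; case: asboolP => // fin [] /eqP.
rewrite pnatr_eq0 cardfs_eq0 => /eqP E.
have : z \in fset_set (pts (N w) `&` plane) by rewrite in_fset_set //; exact/mem_set.
by rewrite E inE.
Qed.

End no_vertex.

Lemma nneseries_le (R : realType) (u : nat -> \bar R) (x : \bar R) : (forall n, 0 <= u n)%E ->
  (forall k, \sum_(0 <= n < k) u n <= x)%E -> (\sum_(0 <= n <oo) u n <= x)%E.
Proof.
move=> u0 ux; apply: lime_le; first by apply: is_cvg_nneseries => n _ _.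
by near=> k; exact: ux.
Unshelve. all: by end_near. Qed.

Lemma geometric_sum_le (R : realType) (x : R) : 0 <= x ->
  (\sum_(0 <= n <oo) (x / 2 ^+ n)%:E <= (x * 2)%:E)%E.
Proof.
move=> x0; apply: nneseries_le => [n|k]; first by rewrite lee_fin divr_ge0 ?exprn_ge0.
rewrite sumEFin lee_fin -mulr_sumr ler_wpM2l //.
have -> : \sum_(0 <= n < k) (2 ^+ n)^-1 = 2 - 2 ^- k *+ 2 :> R.
  elim: k => [|k IH]; first by rewrite big_nil expr0 invr1 subrr.
  by rewrite big_nat_recr //= IH exprS invfM; move: (2 ^- k) => y; lra.
by rewrite gerBl // mulrn_wge0 // invr_ge0 exprn_ge0.
Qed.

Section moment_bound.
Context {R : realType} {d : nat} {disp : measure_display} {Omega : measurableType disp}.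
Variables (lambda : R) (P : probability Omega R) (N : {mfun Omega >-> config R d}).
Hypothesis d0 : (0 < d)%N.
Hypothesis lambda0 : 0 < lambda.
Hypothesis PN : poisson_process lambda P N.
Variables (B : set 'rV[R]_d) (p : R).
Hypotheses (mB : measurable B) (Bfin : (lebesgue_rV B < +oo)%E) (p1 : 1 <= p).
Local Notation A := ((@base d)%:R : R).

Let bcell (i : nat) : R := fine (lebesgue_rV (B `&` unit_cube i)).

Let mcell i : measurable (B `&` @unit_cube R d i).
Proof. by apply: measurableI => //; exact: measurable_unit_cube. Qed.

Let bcellE i : lebesgue_rV (B `&` unit_cube i) = (bcell i)%:E.
Proof.
rewrite fineK // ge0_fin_numE; last exact: measure_ge0.
by apply: le_lt_trans Bfin; apply: le_measure; [exact: mem_set (mcell i)|exact: mem_set|move=> x []].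
Qed.

Let bcell0 i : 0 <= bcell i.
Proof. by rewrite fine_ge0. Qed.

Let sum_bcell : (\sum_(0 <= i <oo) (bcell i)%:E = lebesgue_rV B)%E.
Proof.
have BE : B = \bigcup_i (B `&` unit_cube i).
  apply/seteqP; split=> [x Bx|x [i _ []] //].
  by have [i xi] := unit_cube_cover x; exists i.
rewrite [in RHS]BE.
have t : trivIset setT (fun i => B `&` @unit_cube R d i).
  by move=> i j _ _ [x [[_ xi] [_ xj]]]; apply: (@unit_cube_trivIset R d) => //; exists x.
have mU : measurable (\bigcup_i (B `&` @unit_cube R d i)) by rewrite -BE.
rewrite (@measure_semi_bigcup _ _ _ (@lebesgue_rV R d) _ mcell t mU).
by apply: eq_eseriesr => i _; exact/esym/bcellE.
Qed.

(** [Psi] adds up [edge_cost] over all cubes and scales, which does not involve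
[h], and is infinite on the null event that some vertex has height 1. *)
Lemma MBD_moment_le : exists2 x : R, 0 <= x & exists Psi : Omega -> \bar R,
  (\int[P]_w Psi w <= x%:E)%E /\ forall h, 0 < h -> forall w,
  ((\esum_(s in level (N w) 0 `&` B) (MBD (translate (- s) (N w)) (- h) 0 0 `^ p)) <= Psi w)%E.
Proof.
pose q := Num.bound p.
have pq : p <= q%:R by apply/ltW/archi_boundP; exact: le_trans p1.
have [C [K [n0 [M [[C0 K0 n02] n0P M0 H]]]]] := exists_parameters lambda0 PN d0 q.
pose cost i n w := edge_cost N C K n0 q (cube_corner i) n (B `&` unit_cube i) w.
have cost0 i n w : (0 <= cost i n w)%E by exact: edge_cost_ge0.
have mcost i n : measurable_fun setT (cost i n).
  apply/measurable_EFinP; apply: measurable_funM => //; apply: measurable_funM.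
    exact: measurable_edges.
  by have [] := edge_expect_bad_weight lambda0 PN d0 (cube_corner i) (ltn0Sn n) (mcell i) (bcellE i) n0 C0 K0 n.
pose V := @vertex_at_1 R d disp Omega N.
have mV : measurable V by exact: measurable_vertex_at_1.
pose total w := (\sum_(0 <= i <oo) \sum_(0 <= n <oo) cost i n w)%E.
have total0 w : (0 <= total w)%E.
  by apply: nneseries_ge0 => i _ _; apply: nneseries_ge0.
have mrow i : measurable_fun setT (fun w => \sum_(0 <= n <oo) cost i n w)%E.
  by apply: ge0_emeasurable_sum.
have mtotal : measurable_fun setT total.
  by apply: ge0_emeasurable_sum => // i w _ _; exact: nneseries_ge0.
pose top : Omega -> \bar R := (fun=> +oo%E) \_ V.
have top0 w : (0 <= top w)%E by rewrite /top patchE; case: ifP.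
have mtop : measurable_fun setT top by exact: (proj1 (measurable_restrictT _ mV) (measurable_cst _)).
exists (M * 2 * fine (lebesgue_rV B)).
  by rewrite !mulr_ge0 // fine_ge0.
exists (fun w => total w + top w)%E; split.
  rewrite ge0_integralD //.
  have -> : (\int[P]_w top w = 0)%E.
    rewrite -integral_mkcond; apply: etrans (integral_cst P mV +oo%E) _.
    by apply: etrans (congr1 (mule +oo) (prob_vertex_at_1 PN)) _; rewrite mule0.
  rewrite adde0 integral_nneseries //; last by move=> i w _; exact: nneseries_ge0.
  have row i : (\int[P]_w (\sum_(0 <= n <oo) cost i n w) <= (M * 2)%:E * (bcell i)%:E)%E.
    rewrite integral_nneseries //.
    apply: (@le_trans _ _ (\sum_(0 <= n <oo) (M * bcell i / 2 ^+ n)%:E)%E).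
      apply: lee_nneseries => [n _ _|n _]; first exact: integral_ge0.
      exact: H.
    apply: le_trans (geometric_sum_le _) _; first by rewrite mulr_ge0.
    by rewrite -EFinM lee_fin mulrAC.
  apply: (@le_trans _ _ (\sum_(0 <= i <oo) ((M * 2)%:E * (bcell i)%:E))%E).
    apply: lee_nneseries => [i _ _|i _]; last exact: row.
    by apply: integral_ge0 => w _; exact: nneseries_ge0.
  rewrite nneseriesZl => [|i _]; last by rewrite lee_fin.
  by rewrite sum_bcell [in leRHS]EFinM fineK // ge0_fin_numE.
move=> h h0 w; have [Vw|nVw] := pselect (V w).
  by rewrite /top patchE mem_set // addey ?leey // gt_eqF // (lt_le_trans (ltNy0)).
rewrite {1}/top patchE memNset // adde0.
have no1 := not_vertex_at_1 nVw.
have -> : level (N w) 0 `&` B = \bigcup_i (level (N w) 0 `&` (B `&` unit_cube i)).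
  apply/seteqP; split=> [x [Lx Bx]|x [i _ [? []]] //].
  by have [i xi] := unit_cube_cover x; exists i.
rewrite esum_bigcupT; last 2 first.
- by move=> i j _ _ [x [[_ [_ xi]] [_ [_ xj]]]]; apply: (@unit_cube_trivIset R d) => //; exists x.
- by move=> s; exact: poweR_ge0.
rewrite -nneseries_esumT; last by move=> i; apply: esum_ge0 => s _; exact: poweR_ge0.
apply: lee_nneseries => [i _ _|i _]; first by apply: esum_ge0 => s _; exact: poweR_ge0.
apply: ge_ereal_sup => _ [S [finS SL] <-].
rewrite fsbig_finite //=.
apply: (@le_trans _ _ (\sum_(s <- fset_set S) \sum_(0 <= n <oo)
    edge_cost N C K n0 q (cube_corner i) n [set s] w)%E).
  rewrite big_seq [leRHS]big_seq; apply: lee_sum => s.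
  rewrite in_fset_set // => /set_mem Ss; have [_ [_ si]] := SL _ Ss.
  exact: (MBD_le_edge_cost d0 C0 K0 n0P n02 p1 pq h0 no1 (unit_cube_dist si)).
rewrite -nneseries_sum; last by move=> s n _; exact: edge_cost_ge0.
apply: lee_nneseries => [n _ _|n _]; first by apply: sume_ge0 => s _; exact: edge_cost_ge0.
rewrite /cost /edge_cost sumEFin lee_fin -!mulr_suml.
have bw : 0 <= bad_weight N (cube_corner i) C K n0 n w.
  by have [_ ->] := edge_expect_bad_weight lambda0 PN d0 (cube_corner i) (ltn0Sn n) (mcell i) (bcellE i) n0 C0 K0 n.
apply: ler_wpM2r; first by rewrite exprn_ge0 // mulr_ge0 // exprn_ge0 // ltW // base_gt0.
apply: ler_wpM2r => //; apply: edges_sum_le; first exact: fset_uniq.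
by move=> s; rewrite in_fset_set // => /set_mem /SL[].
Qed.

End moment_bound.

Theorem theorem4p5 (R : realType) (d : nat) (lambda : R)
    (disp : measure_display) (Omega : measurableType disp)
    (P : probability Omega R) (N : {mfun Omega >-> config R d}) :
  (0 < d)%N -> 0 < lambda -> poisson_process lambda P N ->
  forall B : set 'rV[R]_d,
    measurable B -> (0 < lebesgue_rV B)%E -> (lebesgue_rV B < +oo)%E ->
  forall p : R, 1 <= p ->
  (limf_esup
     (fun h : R => \int[palm P N 0%R B]_eta (MBD eta (- h)%R 0%R 0%R `^ p))
     (+oo)%R < +oo)%E.
Proof.
move=> d0 lambda0 PN B mB B0 Bfin p p1.
have [x x0 [Psi [PsiM HPsi]]] := MBD_moment_le d0 lambda0 PN mB Bfin p1.
have X0 : (0 < alpha0 P N * (expR (- (d%:R * 0)))%:E * lebesgue_rV B)%E.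
  by rewrite !mule_gt0 ?(alpha0_gt0 lambda0 PN d0) // lte_fin expR_gt0.
have [c c0 cE] : exists2 c, 0 <= c & ((alpha0 P N * (expR (- (d%:R * 0)))%:E * lebesgue_rV B)^-1 = c%:E)%E.
  move: X0; case: (_ * _)%E => [r r0||] //.
    by exists r^-1; [rewrite invr_ge0 ltW|rewrite inver gt_eqF].
  by exists 0; rewrite ?invey.
apply: (@le_lt_trans _ _ (c%:E * x%:E)%E); last by rewrite -EFinM ltry.
rewrite /limf_esup.
pose f h := (\int[palm P N 0%R B]_eta (MBD eta (- h)%R 0%R 0%R `^ p))%E.
apply: (@le_trans _ _ (ereal_sup (f @` `]0, +oo[%classic))).
  apply: ereal_inf_lbound; exists `]0, +oo[%classic => //.
  by exists 0; split => // y y0; rewrite /= in_itv /= y0.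
apply: ge_ereal_sup => _ [h /= h0 <-]; rewrite in_itv /= andbT in h0.
apply: le_trans (lee_wpmul2l _ PsiM); last by rewrite lee_fin.
apply: (palm_integral_le c0 cE) => [eta|w]; first exact: poweR_ge0.
exact: HPsi.
Qed.
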